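(* Let $q\geq 2$ be an integer, $z>2$, $\beta>0$, and let $(\mathcal{A}_t)_{t=0,\dots,T}$ be a regular collapsing scheme of $\{1,\dots,q\}$. Consider the generalized fuzzy Potts models with spin partitions $\mathcal{A}_t$, $t=1,\dots,T$. Then: (i) The model is Gibbs for all $t\in\{1,\dots,T\}$ if and only if $\beta<\beta_c(r_*(\mathcal{A}_1,z),z)$. (ii) The model is non-Gibbs for all $t\in\{1,\dots,T-1\}$ if and only if $\beta\geq\beta_c(r_*(\mathcal{A}_{T-1},z),z)$. (iii) For $\beta\in[\beta_c(r_*(\mathcal{A}_1,z),z),\beta_c(r_*(\mathcal{A}_{T-1},z),z))$ there is a transition time $t_G\in\{2,\dots,T-1\}$ such that the model is non-Gibbs for $t\in\{1,\dots,t_G-1\}$ and Gibbs for $t\in\{t_G,\dots,T\}$.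
   Context: Generalized Potts measure $\pi^N_{\beta,q,z}(\xi)=\frac1Z\exp\big(\frac{N\beta}{z}\sum_{i=1}^q(L_N^\xi(i))^z\big)$ on $\{1,\dots,q\}^N$ with $L_N^\xi$ the empirical distribution; $\beta_c(r,z)$ is the critical inverse temperature of the $r$-state generalized Potts model with exponent $z$. For a partition $\mathcal{A}=\{I_1,\dots,I_s\}$ of $\{1,\dots,q\}$, the fuzzy Potts measure on $\{1,\dots,s\}^N$ is the image of $\pi^N_{\beta,q,z}$ under the sitewise map sending spin $k$ to the index $l$ with $k\in I_l$. Its single-site conditional probabilities depend only on the empirical distribution $\bar\eta$ of the other $N-1$ fuzzy spins, $Q^N(k\mid\bar\eta)$; the model is Gibbs if for every $\nu$ the limits $Q^\infty(k\mid\nu)=\lim_N Q^N(k\mid\nu_N)$ exist for all admissible $\nu_N\to\nu$ and $\nu\mapsto Q^\infty(\cdot\mid\nu)$ is continuous; otherwise non-Gibbs. A collapsing scheme is a strictly decreasing (strictly coarsening) sequence of partitions $(\mathcal{A}_t)_{t=0,\dots,T}$ with $\mathcal{A}_0=\{\{1\},\dots,\{q\}\}$ and $\mathcal{A}_T=\{\{1,\dots,q\}\}$. For a partition $\mathcal{A}$, $r_*(\mathcal{A},z)$ is the size of the smallest class $r$ of $\mathcal{A}$ with $(r,z)\in([2,\infty)\times[2,\infty))\setminus(\{2\}\times[2,4])$ (smallest class size $\geq2$ if $z>4$, $\geq3$ if $2<z\leq4$). A collapsing scheme is regular if $T\geq 2$ and $(r_*(\mathcal{A}_t,z))_{t=1,\dots,T-1}$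 is increasing. *)

(* Defs.v *)
From HB Require Import structures.
From mathcomp Require Import all_boot all_order all_algebra.
From mathcomp Require Import all_classical all_reals all_analysis.
Set Implicit Arguments. Unset Strict Implicit. Unset Printing Implicit Defensive.
Import Order.TTheory GRing.Theory Num.Theory.
Import numFieldNormedType.Exports.
Local Open Scope classical_set_scope.
Local Open Scope ring_scope.

Section Defs.
Variable R : realType.

Definition emp (N m : nat) (xi : {ffun 'I_N -> 'I_m}) : 'rV[R]_m :=
  \row_(i < m) (#|[set x | xi x == i]|%:R / N%:R).

Definition simplex (m : nat) : set 'rV[R]_m :=
  [set nu | (forall i, 0 <= nu 0 i) /\ \sum_(i < m) nu 0 i = 1].
Arguments simplex : clear implicits.

Definition potts_weight (N q : nat) (beta z : R) (xi : {ffun 'I_N -> 'I_q}) : R :=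
  expR (N%:R * beta / z * \sum_(i < q) (emp xi 0 i) `^ z).
Definition potts_measure (N q : nat) (beta z : R) (xi : {ffun 'I_N -> 'I_q}) : R :=
  potts_weight beta z xi / \sum_(xi' : {ffun 'I_N -> 'I_q}) potts_weight beta z xi'.

(* fuzzy Potts measure: image under the sitewise map f : {1..q} -> {1..s}
   (f labels the classes of the partition: i in I_l  <->  f i = l) *)
Definition fuzzy_measure (N q s : nat) (f : 'I_q -> 'I_s) (beta z : R)
    (eta : {ffun 'I_N -> 'I_s}) : R :=
  \sum_(xi : {ffun 'I_N -> 'I_q} | [forall x, f (xi x) == eta x])
     potts_measure beta z xi.

Definition ext (n s : nat) (k : 'I_s) (eta : {ffun 'I_n -> 'I_s}) : {ffun 'I_n.+1 -> 'I_s} :=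
  [ffun i => if unlift ord0 i is Some j then eta j else k].

Definition Qcond (n q s : nat) (f : 'I_q -> 'I_s) (beta z : R)
    (eta : {ffun 'I_n -> 'I_s}) : 'rV[R]_s :=
  \row_(k < s) (fuzzy_measure f beta z (ext k eta) /
                \sum_(k' < s) fuzzy_measure f beta z (ext k' eta)).

Definition fuzzy_gibbs (q s : nat) (f : 'I_q -> 'I_s) (beta z : R) : Prop :=
  exists Qinf : 'rV[R]_s -> 'rV[R]_s,
    {within simplex s, continuous Qinf} /\
    forall nu, simplex s nu ->
    forall eta : forall n : nat, {ffun 'I_n -> 'I_s},
      emp (eta n) @[n --> \oo] --> nu ->
      Qcond f beta z (eta n) @[n --> \oo] --> Qinf nu.

Definition potts_free_energy (r : nat) (beta z : R) (nu : 'rV[R]_r) : R :=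
  \sum_(i < r) (nu 0 i * ln (nu 0 i) - beta / z * (nu 0 i) `^ z).

Definition unif (r : nat) : 'rV[R]_r := const_mx (r%:R)^-1.
Arguments unif : clear implicits.

Definition uniform_unique_minimizer (r : nat) (beta z : R) : Prop :=
  forall nu, simplex r nu -> nu <> unif r ->
    potts_free_energy beta z (unif r) < potts_free_energy beta z nu.

Definition beta_c (r : nat) (z : R) : R :=
  inf [set b : R | 0 < b /\ ~ uniform_unique_minimizer r b z].

Definition class_size (q s : nat) (f : 'I_q -> 'I_s) (l : 'I_s) : nat :=
  #|[set i | f i == l]|.

Definition admissible (r : nat) (z : R) : bool :=
  [&& (2 <= r)%N, 2 <= z & ~~ ((r == 2)%N && (z <= 4))].

Definition has_rstar (q s : nat) (f : 'I_q -> 'I_s) (z : R) : Prop :=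
  exists l, admissible (class_size f l) z.

(* r_*(A,z): smallest admissible class size (q.+1 if there is none) *)
Definition r_star (q s : nat) (f : 'I_q -> 'I_s) (z : R) : nat :=
  \big[minn/q.+1]_(l < s | admissible (class_size f l) z) class_size f l.

(* partition A_t is encoded by the surjective labelling f t : {1..q} -> {1..s t} *)
Definition collapsing_scheme (q T : nat) (s : nat -> nat)
    (f : forall t, 'I_q -> 'I_(s t)) : Prop :=
  [/\ (forall t, (t <= T)%N -> forall l : 'I_(s t), exists i, f t i = l),
      injective (f 0%N),            (* A_0 = singletons *)
      s T = 1%N,                    (* A_T = {{1..q}} *)
      (forall t, (t < T)%N -> forall i j, f t i = f t j -> f t.+1 i = f t.+1 j)
        (* A_{t+1} is coarser than A_t *) &
      (forall t, (t < T)%N -> exists i j, f t i <> f t j /\ f t.+1 i = f t.+1 j)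
        (* ... strictly *) ].

Definition regular_scheme (q T : nat) (s : nat -> nat)
    (f : forall t, 'I_q -> 'I_(s t)) (z : R) : Prop :=
  [/\ collapsing_scheme T f, (2 <= T)%N,
      (forall t, (1 <= t <= T.-1)%N -> has_rstar (f t) z) &
      (forall t1 t2, (1 <= t1)%N -> (t1 <= t2)%N -> (t2 <= T.-1)%N ->
         (r_star (f t1) z <= r_star (f t2) z)%N)].

End Defs.

(* Main.v *)
(* Let r_l be the size of the class l and n_l the number of spins in it. Summing out the
   spins class by class, the weight of a fuzzy configuration of N spins is the product
   over l of Z_l(n_l), a partition function of n_l spins with r_l states at mean-field
   scale N. Hence Q(k | eta) is proportional to the ratio Z_k(n_k + 1) / Z_k(n_k), the
   growth of class k. As Z_l is log-convex, the growth is nondecreasing in n_l, and its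
   limit at density nu = n/N is the exponential of the derivative of the limiting pressure
   wherever the minimisers of the Potts free energy at the inverse temperature
   beta nu^(z-1) all have the same energy.

   If beta < beta_c(r_star), this holds at every density in every class: classes of size 1,
   or 2 when z <= 4, have no first-order transition, and beta_c increases with the number
   of states. Otherwise let nu_c solve beta nu_c^(z-1) = beta_c(r_star). There the uniform
   minimiser coexists with an ordered one, and beta_c lies strictly below the spinodal
   point, so the fluctuations around the uniform phase are Gaussian and its weight is at
   most comparable to that of the ordered phase. The ordered phase therefore keeps a
   positive probability, on which the growth exceeds its uniform value by a fixed amount:
   the growth jumps at nu_c, and the limiting conditional probability is discontinuous. *)

Require Import Defs.
From HB Require Import structures.
From mathcomp Require Import all_boot all_order all_algebra.
From mathcomp Require Import all_classical all_reals all_analysis.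
From mathcomp Require Import ring lra zify.
Import Order.TTheory GRing.Theory Num.Theory.
Import numFieldNormedType.Exports.
Set Implicit Arguments. Unset Strict Implicit. Unset Printing Implicit Defensive.
Local Open Scope ring_scope.

(** At [nu_c] both phases have the same exponential rate, so prefactors decide. The bound [part_le]
    loses a polynomial factor, which is harmless for the limits away from coexistence but fatal
    here. Hence both weights are estimated up to constants: the window around the uniform phase from
    above, the ordered phase from below, where tangents of [phi] reduce the weight to a product
    measure. As [beta_c] is an infimum without closed form, coexistence is obtained by compactness,
    and the spinodal bound from a descent direction at the spinodal point itself.

    A jump of one growth is not yet a jump of a conditional probability, since the growths of the
    other classes could compensate it. Configurations of two blocks, one of class [k] and one of
    another class, exclude this: as the density of [k] rises to [nu_c], the other growths can only
    decrease, by log-convexity. The approach is from below, where the growth of [k] has a known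
    limit; this also covers the endpoint [nu_c = 1], that is, [beta] equal to the critical value. *)

(** * Convexity inequalities for powers and logarithms *)

Section Calculus.
Variable R : realType.
Implicit Types (x y t v a b c : R).

(** The bound [ln u <= u - 1] at [u = t / x], in a form that survives [x = 0]. Summed over
    coordinates it says that relative entropy is nonnegative. *)
Lemma mul_ln_le t x : 0 < t -> 0 <= x -> x * (ln t - ln x) <= t - x.
Proof.
move=> t0; rewrite le_eqVlt => /predU1P[<-|x0]; first by rewrite mul0r subr0 ltW.
rewrite -ln_div ?posrE// -ler_pdivlMl// mulrBr mulVf ?gt_eqF//.
rewrite (_ : x^-1 * t = t / x); last by rewrite mulrC.
have := @le_ln1Dx R (t / x - 1); rewrite (addrC 1) subrK; apply.
by rewrite ltrBrDr addNr divr_gt0.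
Qed.

Lemma mul_ln_lt t x : 0 < t -> 0 <= x -> t <> x -> x * (ln t - ln x) < t - x.
Proof.
move=> t0; rewrite le_eqVlt => /predU1P[<- _|x0 tx]; first by rewrite mul0r subr0.
rewrite -ln_div ?posrE// -ltr_pdivlMl// mulrBr mulVf ?gt_eqF//.
rewrite (_ : x^-1 * t = t / x); last by rewrite mulrC.
rewrite -ltr_expR lnK ?posrE ?divr_gt0//.
have : t / x - 1 != 0.
  by rewrite subr_eq0; apply/eqP => /divr1_eq.
by move/expR_gt1Dx; rewrite addrC subrK.
Qed.

Lemma powR_ge1D_ln t c : 0 < t -> 1 + c * ln t <= t `^ c.
Proof. by move=> t0; rewrite /powR gt_eqF// expR_ge1Dx. Qed.

(** Write [t ^ c = t * t ^ (c - 1)] and use [t ^ (c - 1) >= 1 + (c - 1) ln t] together with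
    [t ln t > t - 1]. *)
Lemma bernoulli_lt t c : 0 <= t -> t <> 1 -> 1 < c -> 1 + c * (t - 1) < t `^ c.
Proof.
rewrite le_eqVlt => /predU1P[<- _ c1|t0 t1 c1]; first by rewrite powR0; nra.
have H1 := powR_ge1D_ln (c - 1) t0.
have H2 : t * (1 - ln t) < 1.
  have := mul_ln_lt ltr01 (ltW t0) (nesym t1); rewrite ln1; lra.
rewrite -(mulr_powRB1 (ltW t0)) ?(lt_trans _ c1)//.
nra.
Qed.

Lemma bernoulli_le t c : 0 <= t -> 1 <= c -> 1 + c * (t - 1) <= t `^ c.
Proof.
move=> t0; rewrite le_eqVlt => /predU1P[<-|c1]; first by rewrite powRr1; lra.
have [->|t1] := eqVneq t 1; first by rewrite subrr powR1; lra.
by apply/ltW/bernoulli_lt => //; apply/eqP.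
Qed.

Lemma powR_tangent_lt c y v : 1 < c -> 0 <= y -> 0 <= v -> v <> y ->
  y `^ c + c * y `^ (c - 1) * (v - y) < v `^ c.
Proof.
move=> c1; rewrite le_eqVlt => /predU1P[<- v0 vy|y0 v0 vy].
  have c0 : 0 < c by rewrite (lt_trans _ c1).
  rewrite !powR0 ?subr_eq0 ?gt_eqF// mulr0 mul0r add0r powR_gt0//.
  by rewrite lt0r v0 andbT; apply/eqP.
have t1 : v / y <> 1 by move/divr1_eq.
have t0 : 0 <= v / y by rewrite divr_ge0 // ltW.
have := bernoulli_lt t0 t1 c1.
rewrite -(ltr_pM2l (powR_gt0 c y0)) -powRM // ?(ltW y0) //.
rewrite (_ : y * (v / y) = v); last by field; rewrite gt_eqF.
apply: le_lt_trans; rewrite -(mulr_powRB1 (ltW y0)) ?(lt_trans _ c1)//.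
by rewrite le_eqVlt; apply/orP; left; apply/eqP; field; rewrite gt_eqF.
Qed.

Lemma powR_tangent c y v : 1 <= c -> 0 <= y -> 0 <= v ->
  y `^ c + c * y `^ (c - 1) * (v - y) <= v `^ c.
Proof.
move=> c1 y0 v0; have [->|/eqP vy] := eqVneq v y; first by rewrite subrr mulr0 addr0.
move: c1; rewrite le_eqVlt => /predU1P[<-|c1].
  by rewrite subrr powRr0 !powRr1//; lra.
exact/ltW/powR_tangent_lt.
Qed.

Lemma powR_ge0_lt c x y : 0 < c -> 0 <= x -> x < y -> x `^ c < y `^ c.
Proof.
move=> c0 x0 xy; apply: gt0_ltr_powR => //; rewrite nnegrE//.
by rewrite ltW// (le_lt_trans x0).
Qed.

Lemma powR_ge0_le c x y : 0 <= c -> 0 <= x -> x <= y -> x `^ c <= y `^ c.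
Proof.
move=> c0 x0 xy; apply: ge0_ler_powR => //; rewrite nnegrE//.
by rewrite (le_trans x0).
Qed.

Lemma is_derive_cont_itv (f df : R -> R) a b :
  (forall x, a <= x <= b -> is_derive x 1 f (df x)) ->
  ({within `[a, b], continuous f})%classic.
Proof.
move=> H; apply: continuous_in_subspaceT => x; rewrite inE/= in_itv/= => /H xab.
by apply: differentiable_continuous; apply/derivable1_diffP.
Qed.

Lemma derive_MVT (f df : R -> R) a b : a < b ->
  (forall x, a <= x <= b -> is_derive x 1 f (df x)) ->
  exists2 c, a < c < b & f b - f a = df c * (b - a).
Proof.
move=> ab H; have [|c] := @MVT R f df a b ab _ (is_derive_cont_itv H).
  by move=> x; rewrite in_itv/= => /andP[ax xb]; apply: H; rewrite !ltW.
by rewrite in_itv/=; exists c.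
Qed.

Lemma derive_Rolle (f df : R -> R) a b : a < b -> f a = f b ->
  (forall x, a <= x <= b -> is_derive x 1 f (df x)) ->
  exists2 c, a < c < b & df c = 0.
Proof.
move=> ab fab H; have [c cab E] := derive_MVT ab H.
exists c => //; move: E; rewrite fab subrr => /esym/eqP.
by rewrite mulf_eq0 subr_eq0 (gt_eqF ab) orbF => /eqP.
Qed.

(** For [c >= 2] the second derivative of [v ^ c / c] is nondecreasing, so a bound at the larger
    endpoint holds on the whole interval. *)
Lemma powR_taylor2_le c k a v : 2 <= c -> 0 < a -> 0 < v ->
  (c - 1) * (Num.max a v) `^ (c - 2) <= k ->
  v `^ c / c <= a `^ c / c + a `^ (c - 1) * (v - a) + k / 2 * (v - a) ^+ 2.
Proof.
move=> c2 a0 v0 Hk.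
have c1 : 1 <= c - 1 by lra.
have c0 : 0 < c by lra.
have Hslope (u w : R) : 0 < u -> 0 < w -> u <= w -> w <= Num.max a v ->
    w `^ (c - 1) - u `^ (c - 1) <= k * (w - u).
  move=> u0 w0 uw wm.
  have := powR_tangent c1 (ltW w0) (ltW u0).
  rewrite (_ : c - 1 - 1 = c - 2); last by ring.
  have : w `^ (c - 2) <= (Num.max a v) `^ (c - 2).
    by apply: powR_ge0_le => //; [lra|exact: ltW].
  move=> H1 H2.
  have : (c - 1) * w `^ (c - 2) <= k by apply: le_trans Hk; rewrite ler_wpM2l//; lra.
  nra.
pose h := fun w : R => a `^ (c - 1) * (w - a) + k / 2 * (w - a) ^+ 2 - w `^ c / c.
pose dh := fun w : R => a `^ (c - 1) + k * (w - a) - w `^ (c - 1).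
have dhP (w : R) : 0 < w -> is_derive w 1 h (dh w).
  move=> w0; rewrite /h /dh; have wd := is_derive1_powR c w0.
  apply: is_derive_eq; rewrite /GRing.scale /=; field; lra.
suff : h a <= h v by rewrite /h; lra.
have [->//|va] := eqVneq v a; rewrite -subr_ge0.
move: va; rewrite neq_lt => /orP[va|av].
- have [x xv|w /andP[vw wa] E] := @derive_MVT h dh v a va.
    by apply: dhP; apply: lt_le_trans v0 _; case/andP: xv.
  rewrite -opprB E oppr_ge0 mulr_le0_ge0 ?subr_ge0 ?(ltW va)//.
  have := Hslope w a (lt_trans v0 vw) a0 (ltW wa); rewrite le_max lexx => /(_ isT).
  rewrite /dh; nra.
- have [x xv|w /andP[aw wv] E] := @derive_MVT h dh a v av.
    by apply: dhP; apply: lt_le_trans a0 _; case/andP: xv.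
  rewrite E mulr_ge0 ?subr_ge0 ?(ltW av)//.
  have := Hslope a w a0 (lt_trans a0 aw) (ltW aw); rewrite le_max (ltW wv) orbT => /(_ isT).
  rewrite /dh; nra.
Qed.

(** The second derivative [1 / v - b (c - 1) v ^ (c - 2)] is positive where
    [b (c - 1) v ^ (c - 1) < 1]. The hypothesis states this at the larger endpoint, hence it holds
    on the interval between [a] and [v], where the function is strictly convex. *)
Lemma xlnx_tangent_lt b c a v : 2 <= c -> 0 <= b -> 0 < a -> 0 < v -> v <> a ->
  b * (c - 1) * (Num.max a v) `^ (c - 1) < 1 ->
  a * ln a - b / c * a `^ c + (ln a + 1 - b * a `^ (c - 1)) * (v - a)
    < v * ln v - b / c * v `^ c.
Proof.
move=> c2 b0 a0 v0 va Hb.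
have c0 : 0 < c by lra.
have c1 : 1 <= c - 1 by lra.
pose h := fun w : R => w * ln w - b / c * w `^ c - (ln a + 1 - b * a `^ (c - 1)) * w.
pose dh := fun w : R => ln w - ln a - b * (w `^ (c - 1) - a `^ (c - 1)).
have dhP (w : R) : 0 < w -> is_derive w 1 h (dh w).
  move=> w0; rewrite /h /dh; have wd := is_derive1_powR c w0.
  have wl := is_derive1_ln w0.
  by apply: is_derive_eq; rewrite /GRing.scale /=; field; rewrite ?gt_eqF.
have Hslope (u w : R) : 0 < u -> 0 < w -> u < w -> w <= Num.max a v ->
    b * (w `^ (c - 1) - u `^ (c - 1)) < ln w - ln u.
  move=> u0 w0 uw wm.
  have L : (w - u) / w < ln w - ln u.
    rewrite ltr_pdivrMr //.
    have := @mul_ln_lt u w u0 (ltW w0).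
    by move/(_ (fun E => ltac:(by rewrite E ltxx in uw))); lra.
  apply: le_lt_trans L; rewrite ler_pdivlMr//.
  have Hw : b * (c - 1) * w `^ (c - 1) <= 1.
    apply: ltW; apply: le_lt_trans Hb; rewrite ler_wpM2l//; first by rewrite mulr_ge0//; lra.
    by apply: powR_ge0_le => //; [lra|exact: ltW].
  have := powR_tangent c1 (ltW w0) (ltW u0).
  rewrite -subr_ge0 => K.
  (* The tangent inequality at [w] is multiplied by [w]: the exponent [c - 2] of its slope becomes
     [c - 1], to which the bound [Hw] applies. *)
  have K1 : 0 <= (u `^ (c - 1) - (w `^ (c - 1))) * w + (c - 1) * w `^ (c - 1) * (w - u).
    have E : w * w `^ (c - 1 - 1) = w `^ (c - 1) by rewrite mulr_powRB1 ?ltW//; lra.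
    rewrite -[in X in _ + X]E; have := mulr_ge0 (ltW w0) K; lra.
  have := mulr_ge0 b0 K1.
  have : b * (c - 1) * w `^ (c - 1) * (w - u) <= 1 * (w - u).
    by rewrite ler_wpM2r // subr_ge0 ltW.
  rewrite mulrDr; lra.
suff : h a < h v by rewrite /h; lra.
rewrite -subr_gt0.
move/eqP: va; rewrite neq_lt => /orP[va|av].
- have [x xv|w /andP[vw wa] E] := @derive_MVT h dh v a va.
    by apply: dhP; apply: lt_le_trans v0 _; case/andP: xv.
  rewrite -opprB E oppr_gt0 pmulr_llt0 ?subr_gt0//.
  have := Hslope w a (lt_trans v0 vw) a0 wa; rewrite le_max lexx => /(_ isT).
  rewrite /dh; lra.
- have [x xv|w /andP[aw wv] E] := @derive_MVT h dh a v av.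
    by apply: dhP; apply: lt_le_trans a0 _; case/andP: xv.
  rewrite E pmulr_lgt0 ?subr_gt0//.
  have := Hslope a w a0 (lt_trans a0 aw) aw; rewrite le_max (ltW wv) orbT => /(_ isT).
  rewrite /dh; lra.
Qed.

End Calculus.

(** * Multinomial sums *)

Section SpinSums.
Variable R : realType.

Definition addspin (r : nat) (m : 'I_r -> nat) (j : 'I_r) : 'I_r -> nat :=
  fun i => (m i + (i == j))%N.

(* Sum over all ways of adding [n] spins one by one to the occupation numbers [m];
   a multinomial sum, without the multinomial coefficients. *)
Fixpoint spinsum (r n : nat) (w : ('I_r -> nat) -> R) (m : 'I_r -> nat) : R :=
  if n is n'.+1 then \sum_(j < r) spinsum n' w (addspin m j) else w m.

Lemma sum_addspin r (m : 'I_r -> nat) j :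
  (\sum_i addspin m j i = (\sum_i m i).+1)%N.
Proof.
rewrite big_split /= [X in (_ + X)%N](bigD1 j) //= eqxx.
by rewrite [X in (_ + (_ + X))%N]big1 ?addn0 ?addn1// => i /negbTE ->.
Qed.

Lemma prod_addspin r (a : 'I_r -> R) (m : 'I_r -> nat) j :
  \prod_i a i ^+ addspin m j i = a j * \prod_i a i ^+ m i.
Proof.
under eq_bigr do rewrite exprD.
rewrite big_split /= mulrC; congr (_ * _).
rewrite (bigD1 j) //= eqxx expr1 big1 ?mulr1// => i /negbTE -> //.
Qed.

(** The definition peels off the first spin. Peeling off the last one turns the passage from [n] to
    [n + 1] spins into a change of the weight, so that the two sums can be compared term by term. *)
Lemma spinsumS r n (w : ('I_r -> nat) -> R) m :
  spinsum n.+1 w m = spinsum n (fun m' => \sum_j w (addspin m' j)) m.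
Proof.
elim: n m => [|n IH] m //=.
by apply: eq_bigr => j _; rewrite -IH.
Qed.

Lemma spinsum_le r n (w v : ('I_r -> nat) -> R) m :
  (forall m', (\sum_i m' i = \sum_i m i + n)%N -> w m' <= v m') ->
  spinsum n w m <= spinsum n v m.
Proof.
elim: n m => [|n IH] m H /=; first by apply: H; rewrite addn0.
apply: ler_sum => j _; apply: IH => m'; rewrite sum_addspin addSnnS; exact: H.
Qed.

Lemma spinsum_lin r n (w v : ('I_r -> nat) -> R) (a b : R) m :
  spinsum n (fun m' => a * w m' + b * v m') m = a * spinsum n w m + b * spinsum n v m.
Proof.
elim: n m => [|n IH] m //=.
by rewrite !mulr_sumr -big_split /=; apply: eq_bigr => j _.
Qed.

Lemma spinsumZ r n (w : ('I_r -> nat) -> R) (a : R) m :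
  spinsum n (fun m' => a * w m') m = a * spinsum n w m.
Proof.
elim: n m => [|n IH] m //=.
by rewrite !mulr_sumr; apply: eq_bigr => j _.
Qed.

Lemma spinsum_sum r n (I : Type) (s : seq I) (P : pred I)
    (w : I -> ('I_r -> nat) -> R) m :
  spinsum n (fun m' => \sum_(i <- s | P i) w i m') m =
  \sum_(i <- s | P i) spinsum n (w i) m.
Proof.
elim: n m => [|n IH] m //=.
by rewrite [RHS]exchange_big /=; apply: eq_bigr => j _.
Qed.

Lemma spinsum_gt0 r n (w : ('I_r -> nat) -> R) m : (0 < r)%N ->
  (forall m', 0 < w m') -> 0 < spinsum n w m.
Proof.
move=> r0 H; elim: n m => [|n IH] m //=.
rewrite (bigD1 (Ordinal r0)) //= ltr_pwDl// sumr_ge0// => j _; exact: ltW.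
Qed.

(** The multinomial theorem. Product weights are summed exactly, and the later bounds on [bweight]
    compare it with them. *)
Lemma spinsum_prod r n (a : 'I_r -> R) m :
  spinsum n (fun m' => \prod_i a i ^+ m' i) m =
  (\sum_i a i) ^+ n * \prod_i a i ^+ m i.
Proof.
elim: n m => [|n IH] m /=; first by rewrite expr0 mul1r.
rewrite exprSr -mulrA mulr_suml mulr_sumr; apply: eq_bigr => j _.
by rewrite IH prod_addspin.
Qed.

Lemma spinsum_moment r n (a : 'I_r -> R) k m : \sum_i a i = 1 ->
  spinsum n (fun m' => (\prod_i a i ^+ m' i) * (m' k)%:R) m =
  (\prod_i a i ^+ m i) * ((m k)%:R + n%:R * a k).
Proof.
move=> a1; elim: n m => [|n IH] m /=; first by rewrite mul0r addr0.
under eq_bigr do rewrite IH prod_addspin /addspin natrD addrAC mulrDr.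
rewrite big_split /= -!mulr_suml a1 mul1r.
rewrite [X in _ + X](bigD1 k) //= eqxx mulr1 [X in _ + (_ + X)]big1 ?addr0; last first.
  by move=> j /negbTE jk; rewrite eq_sym jk mulr0.
rewrite -addn1 natrD; ring.
Qed.

(** With [Y] and [Z] the sums of [Tw] and [w], the pointwise bound [2 (Y / Z) Tw - (Y / Z) ^ 2 w <=
    Tw ^ 2 / w <= TTw] sums to [Y ^ 2 / Z] on the left. In this linearised form, linearity and
    monotonicity of [spinsum] suffice. *)
Lemma spinsum_CauchySchwarz r n (w : ('I_r -> nat) -> R) m : (0 < r)%N ->
  (forall m', 0 < w m') ->
  (forall m', (\sum_i w (addspin m' i)) ^+ 2 <=
      w m' * \sum_i \sum_j w (addspin (addspin m' i) j)) ->
  spinsum n.+1 w m ^+ 2 <= spinsum n w m * spinsum n.+2 w m.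
Proof.
move=> r0 w0 H.
rewrite !spinsumS; set Tw := fun m' => _; set TTw := fun m' => _.
have Z0 := spinsum_gt0 n m r0 w0.
set Z := spinsum n w m in Z0 *; set Y := spinsum n Tw m.
have K : spinsum n (fun m' => (2 * (Y / Z)) * Tw m' + (- (Y / Z) ^+ 2) * w m') m
    <= spinsum n TTw m.
  apply: spinsum_le => m' _; rewrite -(ler_pM2l (w0 m')).
  apply: le_trans (H m').
  have := sqr_ge0 (Tw m' - (Y / Z) * w m'); rewrite /Tw; nra.
move: K; rewrite spinsum_lin -/Z -/Y => /(ler_wpM2l (ltW Z0)).
apply: le_trans; rewrite le_eqVlt; apply/orP; left; apply/eqP; field.
by rewrite gt_eqF.
Qed.

(** After expanding the square, the terms for [i], [j] compare factor by factor. The factors agree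
    except the one at [i] when [i = j], where the log-convexity of [u] enters. *)
Lemma prodw_logconvex r (u : nat -> R) (m : 'I_r -> nat) :
  (forall k, 0 < u k) -> (forall k, u k.+1 ^+ 2 <= u k * u k.+2) ->
  (\sum_i \prod_k u (addspin m i k)) ^+ 2 <=
  (\prod_k u (m k)) * \sum_i \sum_j \prod_k u (addspin (addspin m i) j k).
Proof.
move=> u0 Hu; rewrite expr2 mulr_suml mulr_sumr; apply: ler_sum => i _.
rewrite !mulr_sumr; apply: ler_sum => j _.
rewrite -!big_split /=; apply: ler_prod => k _.
apply/andP; split; first by rewrite mulr_ge0 ?ltW.
rewrite /addspin; case: (k == i); case: (k == j); rewrite ?addn0 ?addn1 //= -?expr2 //.
by rewrite mulrC.
Qed.

Lemma prodw_addspin r (u : nat -> R) (m : 'I_r -> nat) j :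
  (\prod_i u (addspin m j i)) * u (m j) = (\prod_i u (m i)) * u (m j).+1.
Proof.
rewrite (bigD1 j) //= [in RHS](bigD1 j) //= /addspin eqxx addn1.
rewrite (eq_bigr (fun i => u (m i))) => [|i /negbTE ->]; last by rewrite addn0.
by ring.
Qed.

End SpinSums.

(** * Partition function of one class: log-convexity and free energy bounds *)

Section Partition.
Variables (R : realType) (z beta : R).
Hypotheses (z2 : 2 <= z) (beta0 : 0 < beta).

Definition energy (r : nat) (x : 'rV[R]_r) : R := \sum_(i < r) x 0 i `^ z.

Lemma free_energyE r b (x : 'rV[R]_r) :
  potts_free_energy b z x = \sum_i x 0 i * ln (x 0 i) - b / z * energy x.
Proof. by rewrite /potts_free_energy /energy mulr_sumr -sumrB. Qed.

Lemma simplex_ge0 r (x : 'rV[R]_r) i : simplex x -> 0 <= x 0 i.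
Proof. by case. Qed.

Lemma simplex_le1 r (x : 'rV[R]_r) i : simplex x -> x 0 i <= 1.
Proof.
case=> x0 <-; rewrite (bigD1 i) //= lerDl sumr_ge0 // => j _; exact: x0.
Qed.

Lemma simplex_gt0 r (x : 'rV[R]_r) : simplex x -> (0 < r)%N.
Proof.
case: r x => // x [_]; rewrite big_ord0 => /eqP.
by rewrite eq_sym oner_eq0.
Qed.

Lemma simplex_unif r : (0 < r)%N -> simplex (unif R r).
Proof.
move=> r0; split=> [i|]; first by rewrite mxE invr_ge0.
under eq_bigr do rewrite mxE.
by rewrite sumr_const card_ord -[LHS]mulr_natl mulfV // pnatr_eq0 -lt0n.
Qed.

Lemma sum_unif r (h : R -> R) : \sum_i h (unif R r 0 i) = r%:R * h (r%:R^-1).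
Proof. by under eq_bigr do rewrite mxE; rewrite sumr_const card_ord mulr_natl. Qed.

Lemma gibbs_inequality r (a : 'I_r -> R) (x : 'rV[R]_r) : simplex x ->
  (forall i, 0 < a i) -> expR (\sum_i x 0 i * (ln (a i) - ln (x 0 i))) <= \sum_i a i.
Proof.
move=> sx a0; have r0 := simplex_gt0 sx; have [x0 x1] := sx.
set S := \sum_i a i.
have S0 : 0 < S.
  by rewrite /S (bigD1 (Ordinal r0)) //= ltr_pwDl// sumr_ge0// => j _; exact: ltW.
rewrite -[leRHS]lnK ?posrE// ler_expR -subr_le0 -[ln S]mul1r -{1}x1 mulr_suml -sumrB.
have E : \sum_i (a i / S - x 0 i) = 0.
  by rewrite sumrB -mulr_suml x1 mulfV ?subrr// gt_eqF.
rewrite -[leRHS]E.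
apply: ler_sum => i _.
have := mul_ln_le (divr_gt0 (a0 i) S0) (x0 i).
by rewrite ln_div ?posrE //; lra.
Qed.

Definition phi (N m : nat) : R := N%:R * beta / z * (m%:R / N%:R) `^ z.

Let z0 : 0 < z. Proof. exact: lt_le_trans z2. Qed.

Lemma phi_tangent N m (y : R) : (0 < N)%N -> 0 <= y ->
  N%:R * beta / z * y `^ z + beta * y `^ (z - 1) * (m%:R - N%:R * y) <= phi N m.
Proof.
move=> N0 y0; have N0' : 0 < N%:R :> R by rewrite ltr0n.
have T := @powR_tangent _ z y (m%:R / N%:R) (le_trans (ler1n _ 2) z2) y0
  (divr_ge0 (ler0n _ _) (ler0n _ _)).
rewrite /phi; have := ler_wpM2l (ltW (divr_gt0 (mulr_gt0 N0' beta0) z0)) T.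
apply: le_trans; rewrite le_eqVlt; apply/orP; left; apply/eqP; field.
by rewrite !gt_eqF.
Qed.

Lemma phi_succ_ge N m : (0 < N)%N ->
  beta * (m%:R / N%:R) `^ (z - 1) <= phi N m.+1 - phi N m.
Proof.
move=> N0; have N0' : 0 < N%:R :> R by rewrite ltr0n.
have := @phi_tangent N m.+1 (m%:R / N%:R) N0 (divr_ge0 (ler0n _ _) (ler0n _ _)).
rewrite -/(phi N m) mulrCA mulfV ?gt_eqF// mulr1 -natr1; lra.
Qed.

Lemma phi_succ_le N m : (0 < N)%N ->
  phi N m.+1 - phi N m <= beta * (m.+1%:R / N%:R) `^ (z - 1).
Proof.
move=> N0; have N0' : 0 < N%:R :> R by rewrite ltr0n.
have := @phi_tangent N m (m.+1%:R / N%:R) N0 (divr_ge0 (ler0n _ _) (ler0n _ _)).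
rewrite -/(phi N m.+1); have -> : N%:R * (m.+1%:R / N%:R) = m%:R + 1 :> R.
  by rewrite mulrCA mulfV ?gt_eqF// mulr1 natr1.
lra.
Qed.

Definition bweight r N (m : 'I_r -> nat) : R := \prod_i expR (phi N (m i)).

Definition part r n N : R := spinsum n (@bweight r N) (fun=> 0%N).

(* [N] is the size of the whole system and stays fixed while a class receives one
   more spin, so [growth r n N] is the factor by which the weight of the class increases. *)
Definition growth r n N : R := part r n.+1 N / part r n N.

Lemma bweight_gt0 r N (m : 'I_r -> nat) : 0 < bweight N m.
Proof. by apply: prodr_gt0 => i _; exact: expR_gt0. Qed.

Lemma part_gt0 r n N : (0 < r)%N -> 0 < part r n N.
Proof. by move=> r0; apply: spinsum_gt0 => // m; exact: bweight_gt0. Qed.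

Lemma part0 r N : part r 0 N = 1.
Proof.
rewrite /part /= /bweight big1 // => i _.
by rewrite /phi mul0r powR0 ?gt_eqF// mulr0 expR0.
Qed.

Lemma growth_gt0 r n N : (0 < r)%N -> 0 < growth r n N.
Proof. by move=> r0; rewrite divr_gt0// part_gt0. Qed.

Lemma part_logconvex r n N : (0 < r)%N -> (0 < N)%N ->
  part r n.+1 N ^+ 2 <= part r n N * part r n.+2 N.
Proof.
move=> r0 N0; apply: spinsum_CauchySchwarz => // [m|m]; first exact: bweight_gt0.
apply: (@prodw_logconvex _ _ (fun k => expR (phi N k))) => k; first exact: expR_gt0.
rewrite expr2 -!expRD ler_expR.
have := phi_succ_ge k.+1 N0; have := phi_succ_le k N0; lra.
Qed.

Lemma growth_le r n n' N : (0 < r)%N -> (0 < N)%N -> (n <= n')%N ->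
  growth r n N <= growth r n' N.
Proof.
move=> r0 N0; elim: n' => [|n' IH]; first by rewrite leqn0 => /eqP ->.
rewrite leq_eqVlt ltnS => /predU1P[->//|/IH] /le_trans; apply.
rewrite /growth ler_pdivrMr ?part_gt0// mulrAC ler_pdivlMr ?part_gt0//.
by rewrite -expr2 mulrC part_logconvex.
Qed.

Lemma part_step_ge r n N k : (0 < r)%N -> (0 < N)%N ->
  part r n N * growth r n N ^+ k <= part r (n + k) N.
Proof.
move=> r0 N0; elim: k => [|k IH]; first by rewrite expr0 mulr1 addn0.
rewrite exprSr mulrA addnS.
rewrite -(divfK (lt0r_neq0 (part_gt0 (n + k) N r0)) (part r (n + k).+1 N)) mulrC.
apply: ler_pM => //; [exact/ltW/growth_gt0|by rewrite mulr_ge0 ?exprn_ge0// ltW// ?part_gt0// growth_gt0|].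
by apply: growth_le => //; exact: leq_addr.
Qed.

Lemma part_step_le r n N k : (0 < r)%N -> (0 < N)%N ->
  part r (n + k) N <= part r n N * growth r (n + k) N ^+ k.
Proof.
move=> r0 N0; elim: k => [|k IH]; first by rewrite expr0 mulr1 addn0.
apply: (@le_trans _ _ (part r n N * growth r (n + k) N ^+ k * growth r (n + k) N)).
  rewrite addnS -(divfK (lt0r_neq0 (part_gt0 (n + k) N r0)) (part r (n + k).+1 N)).
  by rewrite mulrC ler_wpM2r// ltW// growth_gt0.
rewrite -mulrA -exprSr ler_wpM2l ?(ltW (part_gt0 _ _ r0))//.
apply: lerXn2r; rewrite ?nnegrE ?(ltW (growth_gt0 _ _ r0))//.
by apply: growth_le => //; rewrite addnS.
Qed.

(** Replacing [phi] by its tangents at the occupations [n x] makes the weight a product, which sums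
    to an [n]-th power. The Gibbs inequality with trial point [x] then produces the free energy of
    [x], without error term. *)
Lemma part_ge r n N (x : 'rV[R]_r) : (0 < N)%N -> simplex x ->
  expR (- (n%:R * potts_free_energy (beta * (n%:R / N%:R) `^ (z - 1)) z x)) <= part r n N.
Proof.
move=> N0 sx; have N0' : 0 < N%:R :> R by rewrite ltr0n.
have r0 := simplex_gt0 sx; have [x0 x1] := sx.
have c0 : 0 < z - 1 by have := z2; lra.
set nu : R := n%:R / N%:R; have nu0 : 0 <= nu by rewrite divr_ge0.
pose y i := nu * x 0 i; have y0 i : 0 <= y i by rewrite mulr_ge0.
pose a i := expR (beta * y i `^ (z - 1)).
pose K := \sum_i (N%:R * beta / z * y i `^ z - beta * y i `^ (z - 1) * (N%:R * y i)).
have H1 (m : 'I_r -> nat) : expR K * \prod_i a i ^+ m i <= bweight N m.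
  rewrite /bweight /K -expR_sum; under [X in _ * X]eq_bigr do rewrite -expRM_natl.
  rewrite -expR_sum -expRD ler_expR -big_split /=; apply: ler_sum => i _.
  by have := phi_tangent (m i) N0 (y0 i); lra.
apply: le_trans (spinsum_le (fun m' _ => H1 m')).
rewrite spinsumZ spinsum_prod [X in _ * (_ * X)]big1 ?mulr1; last by move=> i _; rewrite expr0.
have G := gibbs_inequality sx (fun i => expR_gt0 (beta * y i `^ (z - 1))).
have : expR K * (expR (\sum_i x 0 i * (ln (a i) - ln (x 0 i)))) ^+ n <=
    expR K * (\sum_i a i) ^+ n.
  by rewrite ler_wpM2l ?expR_ge0//; apply: lerXn2r; rewrite ?nnegrE ?expR_ge0 ?sumr_ge0// => i _; exact: expR_ge0.
apply: le_trans; rewrite -expRM_natl -expRD ler_expR.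
rewrite /K mulr_sumr -big_split /= /potts_free_energy mulr_sumr -sumrN.
apply: ler_sum => i _; rewrite /a expRK.
have E : n%:R = N%:R * nu by rewrite /nu mulrCA mulfV ?mulr1// gt_eqF.
have E1 : y i `^ z = nu * (nu `^ (z - 1) * x 0 i `^ z).
  by rewrite /y powRM// mulrA mulr_powRB1.
rewrite E1 E /y; lra.
Qed.

(** The method of types: the weight of [m] is at most [exp (n p)] times the product weight with its
    own frequencies [m / n]. Summing over all frequency vectors makes the bound uniform in [m]; each
    product weight has total 1, and there are at most [(n + 1) ^ r] vectors. *)
Lemma part_le r n N p : (0 < r)%N -> (0 < N)%N ->
  (forall x : 'rV[R]_r, simplex x ->
     - p <= potts_free_energy (beta * (n%:R / N%:R) `^ (z - 1)) z x) ->
  part r n N <= n.+1%:R ^+ r * expR (n%:R * p).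
Proof.
move=> r0 N0 Hp; have N0' : 0 < N%:R :> R by rewrite ltr0n.
case: n Hp => [_|n Hp]; first by rewrite part0 mul0r expR0 mulr1 expr1n.
have n0 : 0 < n.+1%:R :> R by rewrite ltr0n.
pose P (tau : {ffun 'I_r -> 'I_n.+2}) := (\sum_i tau i == n.+1)%N.
pose a (tau : {ffun 'I_r -> 'I_n.+2}) (i : 'I_r) : R := (tau i)%:R / n.+1%:R.
have H1 (m : 'I_r -> nat) : (\sum_i m i = \sum_(i < r) 0 + n.+1)%N ->
    bweight N m <= \sum_(tau | P tau) expR (n.+1%:R * p) * \prod_i a tau i ^+ m i.
  rewrite [X in (X + _)%N]big1 // add0n => Hm.
  have mn i : (m i < n.+2)%N by rewrite ltnS -Hm (bigD1 i) //= leq_addr.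
  pose tau0 : {ffun 'I_r -> 'I_n.+2} := [ffun i => inord (m i)].
  have tauE i : tau0 i = m i :> nat by rewrite ffunE inordK.
  rewrite (bigD1 tau0) /=; last first.
    by rewrite /P; under eq_bigr do rewrite tauE; rewrite Hm.
  apply: ler_wpDr.
    apply: sumr_ge0 => tau _; rewrite mulr_ge0 ?expR_ge0//.
    by apply: prodr_ge0 => i _; rewrite exprn_ge0// divr_ge0.
  under eq_bigr do rewrite /a tauE.
  pose x : 'rV[R]_r := \row_i ((m i)%:R / n.+1%:R).
  have sx : simplex x.
    split=> [i|]; first by rewrite mxE divr_ge0.
    by under eq_bigr do rewrite mxE; rewrite -mulr_suml -natr_sum Hm mulfV// gt_eqF.
  have -> : \prod_(i < r) ((m i)%:R / n.+1%:R) ^+ m i =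
      expR (\sum_i (m i)%:R * ln ((m i)%:R / n.+1%:R)) :> R.
    rewrite expR_sum; apply: eq_bigr => i _.
    have [->|mi] := posnP (m i); first by rewrite expr0 mulr0n !mul0r expR0.
    by rewrite expRM_natl lnK // posrE divr_gt0// ltr0n.
  rewrite -expRD /bweight -expR_sum ler_expR.
  have := ler_wpM2l (ltW n0) (Hp x sx).
  have -> : n.+1%:R * potts_free_energy (beta * (n.+1%:R / N%:R) `^ (z - 1)) z x =
     \sum_i (m i)%:R * ln ((m i)%:R / n.+1%:R) - \sum_i phi N (m i).
    rewrite /potts_free_energy mulr_sumr -sumrB; apply: eq_bigr => i _.
    rewrite !mxE mulrBr mulrA (mulrCA n.+1%:R) mulfV ?gt_eqF// mulr1; congr (_ - _).
    set nu : R := n.+1%:R / N%:R.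
    have nu0 : 0 <= nu by rewrite divr_ge0.
    have E : n.+1%:R = N%:R * nu by rewrite /nu mulrCA mulfV ?mulr1// gt_eqF.
    rewrite /phi (_ : (m i)%:R / N%:R = nu * ((m i)%:R / n.+1%:R)); last first.
      by rewrite /nu; field; rewrite !gt_eqF.
    rewrite powRM ?divr_ge0// -(mulr_powRB1 nu0 z0) {1}E; lra.
  rewrite mulrN; lra.
apply: le_trans (spinsum_le H1) _.
rewrite spinsum_sum.
have -> : \sum_(tau | P tau) spinsum n.+1
    (fun m => expR (n.+1%:R * p) * \prod_i a tau i ^+ m i) (fun=> 0%N) =
    \sum_(tau | P tau) expR (n.+1%:R * p).
  apply: eq_bigr => tau /eqP Ptau; rewrite spinsumZ spinsum_prod.
  rewrite /a -mulr_suml -natr_sum Ptau mulfV ?gt_eqF// expr1n mul1r big1 ?mulr1//.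
rewrite sumr_const -[leLHS]mulr_natl -natrX ler_wpM2r ?expR_ge0// ler_nat.
by rewrite (leq_trans (max_card _))// card_ffun !card_ord.
Qed.

End Partition.

(** * Existence of minimisers of the free energy on closed sets *)

Section FreeEnergyMin.
Local Open Scope classical_set_scope.
Local Open Scope ring_scope.
Variable R : realType.

(** With [v = s ^ 2] one has [v ln v = 2 s (s ln s)], and [s ln (1 / s) <= 1 - s]. This settles
    continuity at 0. *)
Lemma xlnx_sqrt_bound (v : R) : v < 1 -> `|v * ln v| <= 2 * Num.sqrt `|v|.
Proof.
move=> v1; have [v0|v0] := lerP v 0.
  by rewrite ln0 // mulr0 normr0 mulr_ge0.
have s0 : 0 < Num.sqrt v by rewrite sqrtr_gt0.
have E : v = Num.sqrt v ^+ 2 by rewrite sqr_sqrtr // ltW.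
rewrite (gtr0_norm v0); set s := Num.sqrt v in s0 E *.
rewrite E lnXn // normrM ger0_norm ?sqr_ge0// -[_ *+ 2]mulr_natl normrM.
rewrite (ger0_norm (ler0n R 2)).
have s1 : s <= 1 by nra.
have := mul_ln_le ltr01 (ltW s0); rewrite ln1.
have := ln_le0 s1; move=> L0; rewrite (ler0_norm L0); nra.
Qed.

(** As [ln] is 0 on the nonpositive half-line, continuity holds on the whole line and not only where
    the simplex lives. *)
Lemma xlnx_continuous : continuous (fun v : R => v * ln v).
Proof.
move=> v; have [v0|v0] := lerP v 0; last first.
  by apply: cvgM; [exact: cvg_id|exact: continuous_ln].
have s0 : Num.sqrt `|x| @[x --> (0 : R)] --> (0 : R).
  rewrite -[X in _ --> X](@sqrtr0 R) -[in X in _ --> X](@normr0 R R).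
  apply: (@continuous_comp _ _ _ (fun x : R => `|x|) Num.sqrt 0).
    exact: norm_continuous.
  exact: sqrt_continuous.
move: v0; rewrite le_eqVlt => /predU1P[->|v0]; last first.
  rewrite /continuous_at /=; apply: cvg_near_cst; near=> x.
  by rewrite !ln0 ?mulr0 ?ltW//; near: x; exact: lt_nbhsl.
rewrite /continuous_at /= mul0r; apply/norm_cvg0P.
apply: (@squeeze_cvgr _ _ _ _ (cst 0) (fun x : R => 2 * Num.sqrt `|x|)).
- near=> x; rewrite normr_ge0 /= xlnx_sqrt_bound//; near: x.
  exact: lt_nbhsl.
- exact: cvg_cst.
- by rewrite -[X in _ --> X](mulr0 2); apply: cvgM => //; exact: cvg_cst.
Unshelve. all: end_near. Qed.

(** On the simplex the absolute value changes nothing; it yields a function continuous on the whole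
    space, as the compactness argument wants. *)
Lemma powR_norm_continuous (z : R) : 1 <= z -> continuous (fun v : R => `|v| `^ z).
Proof.
move=> z1 v; have z0 : 0 < z by apply: lt_le_trans z1.
have [->|v0] := eqVneq v 0.
  suff H : `|x| `^ z @[x --> (0 : R)] --> (0 : R).
    by rewrite /continuous_at /= normr0 powR0 ?gt_eqF.
  apply: (@squeeze_cvgr _ _ _ _ (cst 0) (fun x : R => `|x|)).
  - near=> x; rewrite powR_ge0 /=.
    have [->|x0] := eqVneq x 0; first by rewrite normr0 powR0 ?gt_eqF.
    apply: ge1r_powR => //; rewrite normr_gt0 x0 /=.
    by near: x; apply: (@cvgr0_norm_le _ _ _ _ _ id) => //; exact: cvg_id.
  - exact: cvg_cst.
  - by apply/norm_cvg0P; exact: cvg_id.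
apply: (@continuous_comp _ _ _ (fun x : R => `|x| : R) (fun x : R => x `^ z)).
  exact: norm_continuous.
apply: differentiable_continuous; apply/derivable1_diffP.
by have [] := is_derive1_powR z (etrans (normr_gt0 v) v0).
Unshelve. all: end_near. Qed.

Lemma sum_coord_continuous r (g : R -> R) : continuous g ->
  continuous (fun x : 'rV[R]_r => \sum_i g (x 0 i)).
Proof.
move=> cg.
suff H s : continuous (fun x : 'rV[R]_r => \sum_(i <- s) g (x 0 i)) by exact: H.
elim: s => [|i s IH].
  rewrite (_ : (fun _ => _) = cst (0 : R)); last by apply/funext => x; rewrite big_nil.
  exact: cst_continuous.
rewrite (_ : (fun _ => _) = fun x : 'rV[R]_r => g (x 0 i) + \sum_(j <- s) g (x 0 j)).
  move=> x; apply: (@continuousD _ _ _ (fun y : 'rV[R]_r => g (y 0 i))); last exact: IH.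
  apply: (@continuous_comp _ _ _ (fun y : 'rV[R]_r => y 0 i) g); last exact: cg.
  exact: coord_continuous.
by apply/funext => x; rewrite big_cons.
Qed.

Lemma simplex_compact r : compact (@simplex R r).
Proof.
have -> : @simplex R r = [set x : 'rV[R]_r | forall i, x ord0 i \in `[0, 1]%R] `&`
    ((fun x : 'rV[R]_r => \sum_i x 0 i) @^-1` [set 1]).
  apply/seteqP; split => [x sx|x [x01 x1]]; split => //.
  - by move=> i; rewrite in_itv/= simplex_ge0 // simplex_le1.
  - by case: sx => _ /= ->.
  - by move=> i; have := x01 i; rewrite /= in_itv/= => /andP[].
apply: compact_closedI.
  by apply: (@rV_compact R r (fun=> `[0, 1]%classic)) => i; exact: segment_compact.
apply: preimage_closed; last exact: closed_eq.
by move=> x _; apply: (@sum_coord_continuous r id) => ? ; exact: cvg_id.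
Qed.

(** The closed set [C] allows minimising at a distance from given points, which produces the free
    energy gaps used below. *)
Lemma simplex_min r (b z : R) (C : set 'rV[R]_r) : 1 <= z -> closed C ->
  (exists x, simplex x /\ C x) ->
  exists x, [/\ simplex x, C x & forall y, simplex y -> C y ->
    potts_free_energy b z x <= potts_free_energy b z y].
Proof.
move=> z1 cC [x0 [sx0 Cx0]].
pose F (x : 'rV[R]_r) := \sum_i (x 0 i * ln (x 0 i) - b / z * `|x 0 i| `^ z).
have FE x : simplex x -> F x = potts_free_energy b z x.
  by move=> sx; apply: eq_bigr => i _; rewrite ger0_norm ?simplex_ge0.
have cF : continuous F.
  apply: (@sum_coord_continuous r (fun v => v * ln v - b / z * `|v| `^ z)) => v.
  apply: cvgB; first exact: xlnx_continuous.
  by apply: cvgM; [exact: cvg_cst|exact: powR_norm_continuous].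
have cK : compact (@simplex R r `&` C) by apply: compact_closedI => //; exact: simplex_compact.
have [|x] := @compact_EVT_min _ R F _ _ cK (continuous_subspaceT cF).
  by exists x0.
rewrite inE => -[sx Cx] H; exists x; split=> // y sy Cy.
by rewrite -!FE//; apply: H; rewrite inE.
Qed.

End FreeEnergyMin.

(** * The pressure and its derivative *)

Section Minimizers.
Local Open Scope classical_set_scope.
Local Open Scope ring_scope.
Variables (R : realType) (z : R).

Definition minimizer r (b : R) (x : 'rV[R]_r) : Prop :=
  simplex x /\
  forall y : 'rV[R]_r, simplex y ->
    potts_free_energy b z x <= potts_free_energy b z y.

Lemma argmin_sig : {am : forall r, R -> 'rV[R]_r |
  forall r b, 2 <= z -> (0 < r)%N -> minimizer b (am r b)}.
Proof.
exists (fun r b => xget 0 [set x | minimizer b x]) => r b z2 r0.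
have z1 : 1 <= z by apply: le_trans z2; rewrite ler1n.
have [|x [sx _ H]] := @simplex_min R r b z setT z1 closedT.
  by exists (unif R r); split=> //; exact: simplex_unif.
case: xgetP => [y _|/(_ x)] //; case; split=> // y sy; exact: H.
Qed.

Definition argmin r b : 'rV[R]_r := sval argmin_sig r b.

Hypothesis z2 : 2 <= z.

Let z1 : 1 <= z. Proof. by have := z2; lra. Qed.
Let z0 : 0 < z. Proof. by have := z2; lra. Qed.

Lemma argminP r b : (0 < r)%N -> minimizer b (argmin r b).
Proof. exact: (svalP argmin_sig). Qed.

Definition press r b : R := - potts_free_energy b z (argmin r b).

(** By the envelope theorem, the derivative in [nu] of [nu * press (beta nu ^ (z - 1))] at
    [b = beta nu ^ (z - 1)]. Given [b], it depends on the minimiser only through its energy, as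
    [slopeE] shows. *)
Definition slope r b : R :=
  b * energy z (argmin r b) - \sum_i argmin r b 0 i * ln (argmin r b 0 i).

Lemma energy_ge0 r (x : 'rV[R]_r) : 0 <= energy z x.
Proof. by apply: sumr_ge0 => i _; exact: powR_ge0. Qed.

Lemma energy_le1 r (x : 'rV[R]_r) : simplex x -> energy z x <= 1.
Proof.
move=> sx; have [_ <-] := sx; apply: ler_sum => i _.
have [->|xi] := eqVneq (x 0 i) 0; first by rewrite powR0 ?gt_eqF.
by apply: ge1r_powR => //; rewrite simplex_le1// lt0r xi simplex_ge0.
Qed.

Lemma free_energy_shift r b b' (x : 'rV[R]_r) :
  potts_free_energy b z x = potts_free_energy b' z x + (b' - b) / z * energy z x.
Proof. by rewrite !free_energyE; ring. Qed.

Lemma free_energy_lip r b b' (x : 'rV[R]_r) : simplex x ->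
  potts_free_energy b z x <= potts_free_energy b' z x + `|b' - b| / z.
Proof.
move=> sx; rewrite (free_energy_shift b b') lerD2l.
have := energy_le1 sx; have := energy_ge0 x; have := ler_norm (b' - b).
move=> H e0 e1; apply: (@le_trans _ _ (`|b' - b| / z * energy z x)).
  by rewrite ler_wpM2r// ler_wpM2r// invr_ge0 ltW.
by rewrite ler_piMr// divr_ge0 // ltW.
Qed.

Lemma press_ge r b (x : 'rV[R]_r) : (0 < r)%N -> simplex x ->
  - potts_free_energy b z x <= press r b.
Proof. by move=> r0 sx; rewrite lerN2; apply: (argminP b r0).2. Qed.

Lemma press_lip r b b' : (0 < r)%N -> `|press r b - press r b'| <= `|b - b'| / z.
Proof.
move=> r0; wlog suff H : b b' / press r b - press r b' <= `|b - b'| / z.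
  rewrite ler_norml H andbT.
  by have := H b' b; rewrite distrC; lra.
have [s _] := argminP b r0.
have := press_ge b' r0 s; have := free_energy_lip b' b s.
rewrite /press; lra.
Qed.

Lemma slopeE r b : slope r b = press r b + b * (1 - z^-1) * energy z (argmin r b).
Proof. rewrite /slope /press free_energyE; field; exact: lt0r_neq0. Qed.

(** Weaker than uniqueness of the minimiser: in a symmetry-broken phase the minimisers are exchanged
    by permutations of the states, which preserve the energy. *)
Definition unique_energy r b : Prop :=
  forall x y : 'rV[R]_r, minimizer b x -> minimizer b y -> energy z x = energy z y.

(** On the closed set where the energy differs by at least [eps] from that of the minimisers, the
    free energy at [b0] exceeds its minimum by some [g > 0]. Free energies are Lipschitz in [b], so
    a minimiser at a nearby [b] cannot lie there. *)
Lemma energy_near r b0 eps : (0 < r)%N -> unique_energy r b0 -> 0 < eps ->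
  exists2 d, 0 < d & forall b, `|b - b0| < d ->
    `|energy z (argmin r b) - energy z (argmin r b0)| < eps.
Proof.
move=> r0 U eps0; set e0 := energy z (argmin r b0).
pose e' (x : 'rV[R]_r) := \sum_i `|x 0 i| `^ z.
have eE x : simplex x -> e' x = energy z x.
  by move=> sx; apply: eq_bigr => i _; rewrite ger0_norm ?simplex_ge0.
pose C : set 'rV[R]_r := (fun x => `|e' x - e0|) @^-1` [set v | eps <= v].
have cC : closed C.
  apply: preimage_closed; last exact: closed_ge.
  move=> x _; apply: (@continuous_comp _ _ _ (fun x => e' x - e0) (fun v : R => `|v|)).
    apply: (@continuousB _ _ _ e' (cst e0)); last exact: cst_continuous.
    exact: (@sum_coord_continuous R r (fun v => `|v| `^ z) (powR_norm_continuous z1)).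
  exact: norm_continuous.
have [CE|NC] := pselect (exists x, simplex x /\ C x); last first.
  exists 1 => // b _; rewrite ltNge; apply/negP => H; apply: NC.
  by exists (argmin r b); have [s _] := argminP b r0; split=> //; rewrite /C /= eE.
have [x1 [sx1 Cx1 Hx1]] := simplex_min b0 z1 cC CE.
have [sa Ha] := argminP b0 r0.
have g0 : 0 < potts_free_energy b0 z x1 - potts_free_energy b0 z (argmin r b0).
  rewrite subr_gt0 lt_neqAle Ha // andbT; apply/eqP => E.
  have M1 : minimizer b0 x1 by split=> // y sy; rewrite -E; exact: Ha.
  by move: Cx1; rewrite /C /= eE // (U _ _ M1 (argminP b0 r0)) subrr normr0 leNgt eps0.
set g := _ - _ in g0.
(* Two Lipschitz errors occur, one at each of the points compared; each is below [g / 2]. *)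
exists (g * z / 2); first by rewrite divr_gt0// mulr_gt0.
move=> b Hb; rewrite ltNge; apply/negP => H.
have [sb Hb'] := argminP b r0.
have K1 := Hx1 _ sb; have {}K1 := K1 ltac:(by rewrite /C /= eE).
have K2 := Hb' _ sa; have K3 := free_energy_lip b0 b sb.
have K4 := free_energy_lip b b0 sa.
have : `|b - b0| / z < g / 2 by rewrite ltr_pdivrMr // mulrAC.
move: K3 K4; rewrite (distrC b0 b) /g; lra.
Qed.

Lemma slope_near_aux (w p p' b b0 e e' eps : R) : 0 < w < 1 -> 0 <= b0 -> 0 < eps ->
  `|p - p'| <= `|b - b0| * w -> `|b - b0| < eps / 3 ->
  `|e - e'| < eps / (3 * (b0 + 1)) -> 0 <= e -> e <= 1 ->
  `|p + b * (1 - w) * e - (p' + b0 * (1 - w) * e')| < eps.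
Proof.
move=> w01 b00 eps0 P Hb He e0 e1.
have -> : p + b * (1 - w) * e - (p' + b0 * (1 - w) * e') =
   (p - p') + ((1 - w) * e * (b - b0) + (1 - w) * (b0 * (e - e'))).
  by ring.
apply: le_lt_trans (ler_normD _ _) _.
apply: (@le_lt_trans _ _ (`|b - b0| * w + ((1 - w) * `|b - b0| + b0 * `|e - e'|))).
  apply: lerD => //; apply: le_trans (ler_normD _ _) _; apply: lerD.
    rewrite !normrM; apply: ler_wpM2r => //; rewrite !ger0_norm//; last lra.
    by rewrite ler_piMr//; lra.
  rewrite !normrM mulrA ler_wpM2r// (ger0_norm b00) ger0_norm; last lra.
  by rewrite ler_piMl//; lra.
have : b0 * `|e - e'| <= eps / 3.
  apply: (@le_trans _ _ (b0 * (eps / (3 * (b0 + 1))))); first by rewrite ler_wpM2l// ltW.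
  by rewrite mulrA ler_pdivrMr; nra.
lra.
Qed.

Lemma slope_near r b0 eps : (0 < r)%N -> unique_energy r b0 -> 0 <= b0 -> 0 < eps ->
  exists2 d, 0 < d & forall b, `|b - b0| < d -> `|slope r b - slope r b0| < eps.
Proof.
move=> r0 U b00 eps0.
have zi : 0 < z^-1 < 1 by rewrite invr_gt0 z0 invf_lt1//; apply: lt_le_trans z2; rewrite ltr1n.
have e30 : 0 < eps / (3 * (b0 + 1)) by rewrite divr_gt0// mulr_gt0//; lra.
have [d d0 Hd] := energy_near r0 U e30.
exists (Num.min d (eps / 3)); first by rewrite lt_min d0 divr_gt0.
move=> b; rewrite lt_min => /andP[/Hd He Hb].
have [sa _] := argminP b r0; have e1 := energy_le1 sa.
rewrite (slopeE r b) (slopeE r b0); apply: slope_near_aux => //; first exact: press_lip.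
exact: energy_ge0.
Qed.

End Minimizers.

(** * Convergence of the growth at densities without coexistence *)

Section GrowthLimit.
Variables (R : realType) (z beta : R).
Hypotheses (z2 : 2 <= z) (beta0 : 0 < beta).

Let z1 : 1 <= z. Proof. by apply: le_trans z2; rewrite ler1n. Qed.
Let z0 : 0 < z. Proof. exact: lt_le_trans z2. Qed.

Let bet (nu : R) := beta * nu `^ (z - 1).

Lemma ln_part_ge r n N : (0 < r)%N -> (0 < N)%N ->
  n%:R * press z r (bet (n%:R / N%:R)) <= ln (part z beta r n N).
Proof.
move=> r0 N0; rewrite -ler_expR lnK ?posrE ?part_gt0 // /press mulrN.
by apply: part_ge => //; exact: (argminP z2 _ r0).1.
Qed.

Lemma ln_part_le r n N : (0 < r)%N -> (0 < N)%N ->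
  ln (part z beta r n N) <= r%:R * ln n.+1%:R + n%:R * press z r (bet (n%:R / N%:R)).
Proof.
move=> r0 N0; rewrite -ler_expR lnK ?posrE ?part_gt0 // expRD expRM_natl.
rewrite lnK ?posrE ?ltr0n//; apply: part_le => // x sx.
by rewrite /press opprK; apply: (argminP z2 _ r0).2.
Qed.

Lemma bet_secant n n' N : (0 < N)%N ->
  n%:R * bet (n%:R / N%:R) + z * bet (n%:R / N%:R) * (n'%:R - n%:R) <=
  n'%:R * bet (n'%:R / N%:R).
Proof.
move=> N0; have N0' : 0 < N%:R :> R by rewrite ltr0n.
have E m : m%:R * bet (m%:R / N%:R) = N%:R * beta * (m%:R / N%:R) `^ z.
  rewrite -(@mulr_powRB1 _ _ z) ?divr_ge0// /bet; field; exact: lt0r_neq0.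
have := powR_tangent z1 (divr_ge0 (ler0n R n) (ler0n R N)) (divr_ge0 (ler0n R n') (ler0n R N)).
rewrite !E => /(ler_wpM2l (ltW (mulr_gt0 N0' beta0))); apply: le_trans.
rewrite le_eqVlt /bet; apply/orP; left; apply/eqP; field; exact: lt0r_neq0.
Qed.

(** The minimiser at [n] is a trial point at [n'], and for a fixed trial point the pressure of [n]
    spins is convex in [n] by [bet_secant]. So [slope] is a subgradient at every density. *)
Lemma press_secant_ge r n n' N : (0 < r)%N -> (0 < N)%N ->
  n%:R * press z r (bet (n%:R / N%:R)) + slope z r (bet (n%:R / N%:R)) * (n'%:R - n%:R) <=
  n'%:R * press z r (bet (n'%:R / N%:R)).
Proof.
move=> r0 N0; have [sx _] := argminP z2 (bet (n%:R / N%:R)) r0.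
have := ler_wpM2l (ler0n R n') (press_ge z2 (bet (n'%:R / N%:R)) r0 sx).
apply: le_trans; rewrite /press /slope !free_energyE.
set S := \sum_i _; set e := energy _ _.
have := bet_secant n n' N0; have e0 : 0 <= e by exact: energy_ge0.
move=> /(ler_wpM2r (divr_ge0 e0 (ltW z0))).
rewrite -subr_ge0 => H; rewrite -subr_ge0; apply: le_trans H _.
rewrite le_eqVlt; apply/orP; left; apply/eqP; field; exact: lt0r_neq0.
Qed.

Let secant_le (l l' g p p' a t u u' : R) : l + g <= l' -> p <= l -> l' <= a + p' ->
  p' + t * (u - u') <= p -> g <= a + t * (u' - u).
Proof. by move=> *; lra. Qed.

Let secant_ge (l l' g p p' a t u u' : R) : l <= l' + g -> p <= l -> l' <= a + p' ->
  p' + t * (u - u') <= p -> t * (u - u') - a <= g.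
Proof. by move=> *; lra. Qed.

(** The growth is nondecreasing, so its logarithm at [n] is at most the mean increment of [ln part]
    up to [n'], which the subgradient at the far end [n'] controls. The error [r ln (n' + 1)] is
    negligible once [n' - n] is of order [N]. *)
Lemma ln_growth_le r n n' N : (0 < r)%N -> (0 < N)%N -> (n < n')%N ->
  ln (growth z beta r n N) * (n' - n)%:R <=
  r%:R * ln n'.+1%:R + slope z r (bet (n'%:R / N%:R)) * (n' - n)%:R.
Proof.
move=> r0 N0 nn'.
have := @part_step_ge _ z beta z2 beta0 r n N (n' - n) r0 N0.
rewrite subnKC ?(ltnW nn')// -ler_ln ?posrE ?mulr_gt0 ?exprn_gt0 ?part_gt0 ?growth_gt0//.
rewrite lnM ?posrE ?exprn_gt0 ?part_gt0 ?growth_gt0// lnXn ?growth_gt0// => H.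
rewrite mulr_natr (natrB _ (ltnW nn')).
exact: secant_le H (ln_part_ge n r0 N0) (ln_part_le n' r0 N0) (press_secant_ge n' n r0 N0).
Qed.

Lemma ln_growth_ge r n n' N : (0 < r)%N -> (0 < N)%N -> (n' < n)%N ->
  slope z r (bet (n'%:R / N%:R)) * (n - n')%:R - r%:R * ln n'.+1%:R <=
  ln (growth z beta r n N) * (n - n')%:R.
Proof.
move=> r0 N0 nn'.
have := @part_step_le _ z beta z2 beta0 r n' N (n - n') r0 N0.
rewrite subnKC ?(ltnW nn')// -ler_ln ?posrE ?mulr_gt0 ?exprn_gt0 ?part_gt0 ?growth_gt0//.
rewrite lnM ?posrE ?exprn_gt0 ?part_gt0 ?growth_gt0// lnXn ?growth_gt0// => H.
rewrite [leRHS]mulr_natr (natrB _ (ltnW nn')).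
exact: secant_ge H (ln_part_ge n r0 N0) (ln_part_le n' r0 N0) (press_secant_ge n' n r0 N0).
Qed.

Lemma bweight_addspin r N (m : 'I_r -> nat) j :
  bweight z beta N (addspin m j) =
  bweight z beta N m * expR (phi z beta N (m j).+1 - phi z beta N (m j)).
Proof.
apply: (mulIf (lt0r_neq0 (expR_gt0 (phi z beta N (m j))))).
rewrite -mulrA -expRD subrK.
exact: (prodw_addspin (fun k => expR (phi z beta N k))).
Qed.

Lemma growth_ge r n N c : (0 < r)%N ->
  (forall m : 'I_r -> nat, (\sum_i m i = n)%N ->
     c <= \sum_i expR (phi z beta N (m i).+1 - phi z beta N (m i))) ->
  c <= growth z beta r n N.
Proof.
move=> r0 H; rewrite /growth ler_pdivlMr ?part_gt0 // /part spinsumS -spinsumZ.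
apply: spinsum_le => m; rewrite [X in (X + _)%N]big1// add0n => Hm.
under [leRHS]eq_bigr do rewrite bweight_addspin.
by rewrite -mulr_sumr mulrC ler_wpM2l ?(ltW (bweight_gt0 _ _ _ _)) ?H.
Qed.

Lemma growth_ge_card r n N : (0 < r)%N -> (0 < N)%N -> r%:R <= growth z beta r n N.
Proof.
move=> r0 N0; apply: growth_ge => // m _.
rewrite -[r in leLHS]card_ord -sumr_const; apply: ler_sum => i _.
apply: le_trans (expR_ge1Dx _); rewrite lerDl.
by apply: le_trans (phi_succ_ge z2 beta0 _ N0); rewrite mulr_ge0 ?powR_ge0 ?ltW.
Qed.

Lemma slope0 r : (0 < r)%N -> slope z r 0 <= ln r%:R.
Proof.
move=> r0; have [sx _] := argminP z2 0 r0.
rewrite -ler_expR lnK ?posrE ?ltr0n// /slope mul0r add0r.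
have := gibbs_inequality sx (fun=> ltr01).
rewrite sumr_const card_ord; apply: le_trans; rewrite ler_expR -sumrN.
by apply: ler_sum => i _; rewrite ln1 sub0r mulrN.
Qed.

(** [ln y = 2 ln (sqrt y) <= 2 sqrt y], and [2 sqrt (K N) <= eps N] as soon as
    [N >= 4 K / eps ^ 2]. *)
Lemma ln_lin_bound (K eps : R) : 0 < K -> 0 < eps -> exists N0 : nat, forall N,
  (N0 <= N)%N -> (0 < N)%N -> ln (K * N%:R) <= eps * N%:R.
Proof.
move=> K0 eps0; exists (Num.truncn (4 * K / eps ^+ 2)).+1 => N NN N0.
have N0' : 0 < N%:R :> R by rewrite ltr0n.
have HN : 4 * K / eps ^+ 2 < N%:R.
  by apply: lt_le_trans (truncnS_gt _) _; rewrite ler_nat.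
have y0 : 0 < K * N%:R by rewrite mulr_gt0.
have s0 : 0 < Num.sqrt (K * N%:R) by rewrite sqrtr_gt0.
rewrite -[in leLHS](sqr_sqrtr (ltW y0)) lnXn // -[_ *+ 2]mulr_natl.
have L := ln_sublinear s0.
have : Num.sqrt (K * N%:R) <= eps * N%:R / 2.
  rewrite -(@ler_pXn2r _ 2) ?nnegrE ?sqrtr_ge0 ?divr_ge0 ?mulr_ge0 ?ltW// sqr_sqrtr ?ltW//.
  move: HN; rewrite ltr_pdivrMr ?exprn_gt0// => HN.
  have := ltr_pM2r N0' (4 * K) (N%:R * eps ^+ 2); rewrite HN => HN'.
  have -> : (eps * N%:R / 2) ^+ 2 = N%:R * eps ^+ 2 * N%:R / 4 by field.
  by rewrite ltr_pdivlMr// mulrAC (mulrC K) HN'.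
lra.
Qed.

Lemma growth_cvg r nu0 eps : (0 < r)%N -> 0 <= nu0 -> unique_energy z r (bet nu0) ->
  0 < eps -> exists2 d, 0 < d & exists N0 : nat, forall N n, (N0 <= N)%N -> (0 < N)%N ->
    `|n%:R / N%:R - nu0| < d ->
    `|ln (growth z beta r n N) - slope z r (bet nu0)| < eps.
Proof.
move=> r0 nu00 U eps0.
have b0 : 0 <= bet nu0 by rewrite mulr_ge0 ?powR_ge0// ltW.
have e20 : 0 < eps / 2 by rewrite divr_gt0.
have [d1 d10 Hd1] := slope_near z2 r0 U b0 e20.
have [d2 d20 Hd2] : exists2 d2, 0 < d2 & forall nu, 0 <= nu -> `|nu - nu0| < d2 ->
    `|bet nu - bet nu0| < d1.
  have c1 : 1 <= z - 1 by have := z2; lra.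
  have := @powR_norm_continuous R (z - 1) c1 nu0.
  move=> /cvgrPdist_lt /(_ (d1 / beta) (divr_gt0 d10 beta0)) [/= d2 d20 H].
  exists d2 => // nu nu0' Hnu; have := H nu; rewrite /ball_ /= distrC => /(_ Hnu).
  rewrite (ger0_norm nu00) (ger0_norm nu0') distrC ltr_pdivlMr// -[X in _ * X](gtr0_norm beta0) -normrM.
  by rewrite mulrC mulrBr.
(* Below, [n] is shifted by [M <= d N], which keeps the density within [2 d] of [nu0], hence within
   [d2]. For [nu0 > 0], the bound [3 d <= nu0] leaves room for a shift to the left. *)
pose d := if nu0 == 0 then d2 / 3 else Num.min d2 nu0 / 3.
have d0 : 0 < d.
  rewrite /d; case: eqVneq => [_|n0]; rewrite divr_gt0// lt_min d20 lt0r n0 //.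
have dd2 : 3 * d <= d2.
  rewrite /d mulrC; case: ifP => _; first by rewrite divfK.
  by rewrite divfK // ge_min lexx.
have dnu : nu0 != 0 -> 3 * d <= nu0.
  by rewrite /d mulrC; case: eqVneq => //= _ _; rewrite divfK // ge_min lexx orbT.
move: d d0 dd2 dnu => d d0 dd2 dnu.
have K0 : 0 < nu0 + 2 * d + 1 by lra.
have eps'0 : 0 < eps / 2 * (d / 2) / r%:R by rewrite divr_gt0 ?ltr0n// !mulr_gt0.
have [N1 HN1] := ln_lin_bound K0 eps'0.
exists d => //; exists (maxn N1 (Num.truncn (2 / d)).+1) => N n; rewrite geq_max => /andP[NN1 NN2] N0 Hn.
have N0' : 0 < N%:R :> R by rewrite ltr0n.
pose M := Num.truncn (d * N%:R).
have dN2 : 2 < d * N%:R.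
  rewrite mulrC -ltr_pdivrMr//; apply: lt_le_trans (truncnS_gt _) _.
  by rewrite ler_nat.
have MdN : M%:R <= d * N%:R by rewrite truncn_le ?mulr_ge0// ltW.
have dNM : d / 2 * N%:R <= M%:R.
  have := truncnS_gt (d * N%:R); rewrite -/M -natr1; lra.
move: M MdN dNM => M MdN dNM.
have M0 : 0 < M%:R :> R by apply: lt_le_trans dNM; rewrite mulr_gt0// divr_gt0.
have M0' : (0 < M)%N by rewrite -(ltr0n R).
move: Hn; rewrite ltr_distl => /andP[Hn1 Hn2].
have n1 : (nu0 - d) * N%:R < n%:R by rewrite -ltr_pdivlMr.
have n2 : n%:R < (nu0 + d) * N%:R by rewrite -ltr_pdivrMr.
have lnb k : k%:R <= (nu0 + 2 * d) * N%:R -> r%:R * ln k.+1%:R <= eps / 2 * M%:R.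
  move=> Hk; have := HN1 _ NN1 N0.
  have : ln k.+1%:R <= ln ((nu0 + 2 * d + 1) * N%:R).
    rewrite ler_ln ?posrE ?mulr_gt0 ?ltr0n// -natr1.
    have : 1 <= N%:R :> R by rewrite ler1n.
    lra.
  move=> L1 L2; have := le_trans L1 L2; rewrite mulrAC ler_pdivlMr ?ltr0n// mulrC => L.
  by apply: (le_trans L); rewrite -[leLHS]mulrA ler_wpM2l// ltW.
have near k : `|k%:R / N%:R - nu0| < d2 ->
    `|slope z r (bet (k%:R / N%:R)) - slope z r (bet nu0)| < eps / 2.
  by move=> Hk; apply: Hd1; apply: Hd2 => //; rewrite divr_ge0.
rewrite ltr_distl; apply/andP; split; last first.
  have := @ln_growth_le r n (n + M) N r0 N0; rewrite -[X in (X < _)%N]addn0 ltn_add2l => /(_ M0').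
  rewrite addKn => G.
  have /lnb L : (n + M)%:R <= (nu0 + 2 * d) * N%:R by rewrite natrD; lra.
  have /near : `|(n + M)%:R / N%:R - nu0| < d2.
    rewrite ltr_distl ltr_pdivlMr// ltr_pdivrMr// natrD.
    by have := ler_wpM2r (ltW N0') dd2; lra.
  rewrite ltr_distl => /andP[_ S].
  rewrite -(ltr_pM2r M0); apply: (le_lt_trans G).
  have := ltr_pM2r M0; move: S L; set t := slope z r _; set t' := slope z r _ => S L _.
  have : t * M%:R < (t' + eps / 2) * M%:R by rewrite ltr_pM2r.
  lra.
(* There is no room to the left of density 0. There the lower bound comes from [growth >= r], the
   slope at 0 being at most [ln r]. *)
have [nu00'|nupos] := eqVneq nu0 0.
  have := growth_ge_card n r0 N0; rewrite -ler_ln ?posrE ?ltr0n ?growth_gt0// => G.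
  rewrite nu00' /bet powR0 ?mulr0; last by have := z2; lra.
  by have := slope0 r0; lra.
have nM : (M < n)%N.
  rewrite -(ltr_nat R); have := ler_wpM2r (ltW N0') (dnu nupos); lra.
have := @ln_growth_ge r n (n - M) N r0 N0; rewrite -[X in (_ < X)%N](subn0 n).
rewrite ltn_sub2l ?(leq_ltn_trans (leq0n _) nM)// subKn ?(ltnW nM)// => /(_ isT) G.
have nME : (n - M)%:R = n%:R - M%:R :> R by rewrite natrB // ltnW.
have /lnb L : (n - M)%:R <= (nu0 + 2 * d) * N%:R by rewrite nME; nra.
have /near : `|(n - M)%:R / N%:R - nu0| < d2.
  rewrite ltr_distl ltr_pdivlMr// ltr_pdivrMr// nME.
  by have := ler_wpM2r (ltW N0') dd2; lra.
rewrite ltr_distl => /andP[S _].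
rewrite -(ltr_pM2r M0); apply: (lt_le_trans _ G).
move: S L; set t := slope z r _; set t' := slope z r _ => S L.
have : (t - eps / 2) * M%:R < t' * M%:R by rewrite ltr_pM2r.
lra.
Qed.

End GrowthLimit.

(** * Summing out the spins class by class *)

Section Factorization.
Variable R : realType.

Definition cnt n s (eta : {ffun 'I_n -> 'I_s}) (l : 'I_s) : nat :=
  #|[set x | eta x == l]|.

Lemma cntE n s (eta : {ffun 'I_n -> 'I_s}) l : cnt eta l = (\sum_x (eta x == l))%N.
Proof. by rewrite /cnt cardsE -sum1_card big_mkcond. Qed.

Lemma ext0 n s (k : 'I_s) (eta : {ffun 'I_n -> 'I_s}) : ext k eta ord0 = k.
Proof. by rewrite ffunE unlift_none. Qed.

Lemma ext_lift n s (k : 'I_s) (eta : {ffun 'I_n -> 'I_s}) x :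
  ext k eta (lift ord0 x) = eta x.
Proof. by rewrite ffunE liftK. Qed.

Lemma cnt_ext n s (k : 'I_s) (eta : {ffun 'I_n -> 'I_s}) l :
  cnt (ext k eta) l = (cnt eta l + (l == k))%N.
Proof.
rewrite !cntE big_ord_recl ext0 addnC eq_sym; congr (_ + _)%N.
by apply: eq_bigr => i _; rewrite ext_lift.
Qed.

Definition behead_ffun n s (eta : {ffun 'I_n.+1 -> 'I_s}) : {ffun 'I_n -> 'I_s} :=
  [ffun x => eta (lift ord0 x)].

Lemma ext_behead n s (eta : {ffun 'I_n.+1 -> 'I_s}) :
  ext (eta ord0) (behead_ffun eta) = eta.
Proof.
by apply/ffunP => x; rewrite ffunE; case: unliftP => [y ->|->//]; rewrite ffunE.
Qed.

Lemma behead_ext n s (k : 'I_s) (eta : {ffun 'I_n -> 'I_s}) :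
  behead_ffun (ext k eta) = eta.
Proof. by apply/ffunP => x; rewrite ffunE ext_lift. Qed.

Lemma sum_ext n q (P : pred {ffun 'I_n.+1 -> 'I_q}) (F : {ffun 'I_n.+1 -> 'I_q} -> R) :
  \sum_(xi | P xi) F xi = \sum_j \sum_(xi | P (ext j xi)) F (ext j xi).
Proof.
rewrite pair_big_dep /=.
rewrite (reindex (fun p : 'I_q * {ffun 'I_n -> 'I_q} => ext p.1 p.2)) //=.
exists (fun xi : {ffun 'I_n.+1 -> 'I_q} => (xi ord0, behead_ffun xi)) => [[j xi] _|xi _] /=.
  by rewrite ext0 behead_ext.
exact: ext_behead.
Qed.

Variables (q s : nat) (f : 'I_q -> 'I_s) (u : nat -> R).

Let restr l (m : 'I_q -> nat) : 'I_#|[set i | f i == l]| -> nat := fun i => m (enum_val i).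

Lemma restr_addspin_out l (m : 'I_q -> nat) j : f j != l ->
  restr (l := l) (addspin m j) = restr (l := l) m.
Proof.
move=> fjl; apply/funext => i; rewrite /restr /addspin.
case: eqP => [E|]; last by rewrite addn0.
by have := enum_valP i; rewrite E inE (negbTE fjl).
Qed.

Lemma restr_addspin_in l (m : 'I_q -> nat) i :
  restr (l := l) (addspin m (enum_val i)) = addspin (restr (l := l) m) i.
Proof.
apply/funext => i'; rewrite /restr /addspin; congr (_ + nat_of_bool _)%N.
by apply/eqP/eqP => [/enum_val_inj|->].
Qed.

(** Induction on the number of spins. The state [j] of the first one must lie in the class [k] of
    its fuzzy spin and raises [m] at [j], which affects only the factor of class [k]; hence the
    general initial occupations [m]. *)
Lemma fiber_sum_factor n (eta : {ffun 'I_n -> 'I_s}) (m : 'I_q -> nat) :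
  \sum_(xi : {ffun 'I_n -> 'I_q} | [forall x, f (xi x) == eta x])
     \prod_i u (m i + cnt xi i)%N =
  \prod_l spinsum (cnt eta l) (fun m' => \prod_i u (m' i)) (restr (l := l) m).
Proof.
elim: n eta m => [|n IH] eta m.
  rewrite [LHS](eq_bigr (fun=> \prod_i u (m i))); last first.
    move=> xi _; apply: eq_bigr => i _; rewrite cntE big_ord0 addn0 //.
  rewrite [LHS](eq_bigl xpredT) => [|xi]; last by apply/forallP; case.
  have c1 : #|{ffun 'I_0 -> 'I_q}| = 1%N by rewrite card_ffun !card_ord expn0.
  rewrite sumr_const (_ : #|_| = 1%N) ?mulr1n; last by rewrite -[RHS]c1; apply: eq_card.
  rewrite (partition_big f xpredT) //=; apply: eq_bigr => l _.
  rewrite cntE big_ord0 /= /restr -(big_enum_val (fun i => u (m i))).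
  by apply: eq_bigl => i; rewrite inE.
rewrite sum_ext -{2}(ext_behead eta); set k := eta ord0; set eta' := behead_ffun eta.
rewrite (bigID (fun j => f j == k)) /= [X in _ + X]big1 ?addr0; last first.
  move=> j fjk; apply: big1 => xi /forallP /(_ ord0).
  by rewrite ext0 (negbTE fjk).
transitivity (\sum_(j | f j == k)
    \prod_l spinsum (cnt eta' l) (fun m' => \prod_i u (m' i)) (restr (l := l) (addspin m j))).
  apply: eq_bigr => j fjk; rewrite -IH; apply: eq_big => [xi|xi _].
    apply/forallP/forallP => H x; first by have := H (lift ord0 x); rewrite ext_lift ffunE.
    rewrite ffunE; case: unliftP => [y ->|-> //].
    by have := H y; rewrite ffunE.
  by apply: eq_bigr => i _; rewrite cnt_ext /addspin addnA addnAC.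
rewrite [RHS](bigD1 k) //= cnt_ext eqxx addn1 /=.
rewrite [RHS]mulrC mulr_sumr.
rewrite (eq_bigl (mem [set i | f i == k])) => [|i]; last by rewrite !inE.
rewrite big_enum_val /=; apply: eq_bigr => i _.
rewrite (bigD1 k) //= mulrC restr_addspin_in; congr (_ * _).
apply: eq_bigr => l lk; rewrite cnt_ext (negbTE lk) addn0 restr_addspin_out //.
by have := enum_valP i; rewrite inE => /eqP ->; rewrite eq_sym.
Qed.

End Factorization.

(** * Conditional probabilities as ratios of growths *)

Section ConditionalProbability.
Variables (R : realType) (z beta : R).
Hypotheses (z2 : 2 <= z) (beta0 : 0 < beta).
Variables (q s : nat) (f : 'I_q -> 'I_s).
Hypothesis fsurj : forall l, exists i, f i = l.

Lemma card_classical_set (T : finType) (P : pred T) :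
  #|[set x | P x]%classic| = #|[set x | P x]|.
Proof.
apply: eq_card => x; rewrite inE; apply/idP/idP; first by move/set_mem.
by move=> Px; apply: mem_set.
Qed.

Lemma class_sizeE l : class_size f l = #|[set i | f i == l]|.
Proof. exact: card_classical_set. Qed.

Lemma empE n m (eta : {ffun 'I_n -> 'I_m}) l : emp R eta 0 l = (cnt eta l)%:R / n%:R.
Proof. by rewrite mxE card_classical_set. Qed.

Lemma class_size_gt0 l : (0 < class_size f l)%N.
Proof.
have [i <-] := fsurj l; rewrite class_sizeE; apply/card_gt0P.
by exists i; rewrite inE.
Qed.

Lemma potts_weightE N (xi : {ffun 'I_N -> 'I_q}) :
  potts_weight beta z xi = \prod_i expR (phi z beta N (0 + cnt xi i)%N).
Proof.
rewrite /potts_weight -expR_sum mulr_sumr; congr expR.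
by apply: eq_bigr => i _; rewrite empE.
Qed.

Lemma fuzzy_measureE N (eta : {ffun 'I_N -> 'I_s}) :
  fuzzy_measure f beta z eta =
  (\prod_l part z beta (class_size f l) (cnt eta l) N) /
  \sum_(xi : {ffun 'I_N -> 'I_q}) potts_weight beta z xi.
Proof.
rewrite /fuzzy_measure /potts_measure -mulr_suml; congr (_ / _).
rewrite (eq_bigr _ (fun xi _ => potts_weightE xi)).
rewrite (fiber_sum_factor f (fun k => expR (phi z beta N k)) eta (fun=> 0%N)).
by apply: eq_bigr => l _; rewrite class_sizeE.
Qed.

(** Placing the conditioned spin in class [l] multiplies a factor common to all [l] by the growth of
    [l]. The scale is [n + 1], since the system consists of the [n] given spins and the conditioned
    one. *)
Lemma QcondE n (eta : {ffun 'I_n -> 'I_s}) k :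
  Qcond f beta z eta 0 k =
  growth z beta (class_size f k) (cnt eta k) n.+1 /
  \sum_l growth z beta (class_size f l) (cnt eta l) n.+1.
Proof.
set W := \sum_(xi : {ffun 'I_n.+1 -> 'I_q}) potts_weight beta z xi.
pose P := \prod_l part z beta (class_size f l) (cnt eta l) n.+1.
have P0 : P != 0.
  by apply/lt0r_neq0/prodr_gt0 => l _; exact/part_gt0/class_size_gt0.
have W0 : W != 0.
  have [i0 _] := fsurj k.
  apply/lt0r_neq0; rewrite /W (bigD1 [ffun=> i0]) //= ltr_pwDl ?expR_gt0//.
  by apply: sumr_ge0 => xi _; exact: expR_ge0.
have E l : fuzzy_measure f beta z (ext l eta) =
    P / W * growth z beta (class_size f l) (cnt eta l) n.+1.
  rewrite fuzzy_measureE -/W mulrAC; congr (_ / _).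
  rewrite /P (bigD1 l) //= [in RHS](bigD1 l) //= cnt_ext eqxx addn1 mulrAC; congr (_ * _).
    by rewrite /growth mulrC divfK // lt0r_neq0// part_gt0 ?class_size_gt0.
  by apply: eq_bigr => l' /negbTE ll'; rewrite cnt_ext ll' addn0.
rewrite /Qcond mxE E; under eq_bigr do rewrite E.
rewrite -mulr_sumr -mulf_div mulfV ?mul1r// mulf_neq0 ?invr_eq0//.
Qed.

End ConditionalProbability.

(** * Uniqueness of the energy in every class implies the Gibbs property *)

Section GibbsLimit.
Local Open Scope classical_set_scope.
Local Open Scope ring_scope.
Variables (R : realType) (z beta : R).
Hypotheses (z2 : 2 <= z) (beta0 : 0 < beta).

Lemma cvg_sumr (T I : Type) (F : set_system T) (FF : Filter F) (s : seq I)
    (h : I -> T -> R) (l : I -> R) :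
  (forall i, h i x @[x --> F] --> l i) ->
  \sum_(i <- s) h i x @[x --> F] --> \sum_(i <- s) l i.
Proof.
move=> H; elim: s => [|i s IH].
  rewrite big_nil (_ : (fun _ => _) = cst (0 : R)); first exact: cvg_cst.
  by apply/funext => x; rewrite big_nil.
rewrite big_cons (_ : (fun _ => _) = (fun x => h i x + \sum_(j <- s) h j x)).
  exact: cvgD.
by apply/funext => x; rewrite big_cons.
Qed.

Lemma cvg_rV (T : Type) (F : set_system T) (FF : Filter F) m (h : T -> 'rV[R]_m)
    (l : 'rV[R]_m) :
  (forall i, h x 0 i @[x --> F] --> l 0 i) -> h x @[x --> F] --> l.
Proof.
move=> H; apply/cvg_ballP => e e0.
have : \forall x \near F, forall i, ball (l 0 i) e (h x 0 i).
  by apply: filter_forall => i; move/cvg_ballP: (H i); exact.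
by apply: filterS => x Hx; split=> // i j; rewrite (ord1 i).
Qed.

Lemma cvg_rV_coord (T : Type) (F : set_system T) (FF : Filter F) m (h : T -> 'rV[R]_m)
    (l : 'rV[R]_m) i :
  h x @[x --> F] --> l -> h x 0 i @[x --> F] --> l 0 i.
Proof.
by move=> H; apply: (cvg_comp h (fun x : 'rV[R]_m => x 0 i) H); exact: coord_continuous.
Qed.

(** Bridges the two normalisations: [emp] divides by the number [n] of given spins, [growth] by the
    size [n + 1] of the system. *)
Lemma cvg_density (c : nat -> nat) (nu : R) : (forall n, (c n <= n)%N) ->
  (c n)%:R / n%:R @[n --> \oo] --> nu -> (c n)%:R / n.+1%:R @[n --> \oo] --> nu.
Proof.
move=> cn H.
have -> : (fun n => (c n)%:R / n.+1%:R : R) =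
    (fun n => (c n)%:R / n%:R - (c n)%:R / n%:R * harmonic n).
  apply/funext => n; rewrite /harmonic; case: n => [|n].
    by have := cn 0%N; rewrite leqn0 => /eqP ->; rewrite !mul0r subrr.
  rewrite /= -[n.+2%:R]natr1; field.
  by rewrite nat1r natr1 !pnatr_eq0.
have L : (c n)%:R / n%:R - (c n)%:R / n%:R * harmonic n @[n --> \oo] --> nu - nu * 0.
  by apply: cvgB => //; apply: cvgM => //; exact: cvg_harmonic.
by rewrite mulr0 subr0 in L.
Qed.

Lemma cnt_le n m (eta : {ffun 'I_n -> 'I_m}) l : (cnt eta l <= n)%N.
Proof. by rewrite /cnt (leq_trans (max_card _))// card_ord. Qed.

Lemma growth_lim r nu (c : nat -> nat) : (0 < r)%N -> 0 <= nu ->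
  unique_energy z r (beta * nu `^ (z - 1)) ->
  (c n)%:R / n.+1%:R @[n --> \oo] --> nu ->
  growth z beta r (c n) n.+1 @[n --> \oo] --> expR (slope z r (beta * nu `^ (z - 1))).
Proof.
move=> r0 nu0 U H.
have -> : (fun n => growth z beta r (c n) n.+1) =
    (fun n => expR (ln (growth z beta r (c n) n.+1))).
  by apply/funext => n; rewrite lnK // posrE growth_gt0.
apply: (continuous_cvg _ (@continuous_expR R _)).
apply/cvgrPdist_lt => e e0.
have [d d0 [N0 HN]] := growth_cvg z2 beta0 r0 nu0 U e0.
move/cvgrPdist_lt: H => /(_ d d0) H; near=> n.
rewrite distrC; apply: HN => //; last first.
  by rewrite distrC; near: n.
by rewrite ltnW// ltnS; near: n; exact: nbhs_infty_ge.
Unshelve. all: end_near. Qed.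

Lemma slope_cvg r m (nu : 'rV[R]_m) k (A : set 'rV[R]_m) : (0 < r)%N ->
  (forall x, A x -> 0 <= x 0 k) -> A nu ->
  unique_energy z r (beta * nu 0 k `^ (z - 1)) ->
  (fun x : 'rV[R]_m => slope z r (beta * x 0 k `^ (z - 1))) @ within A (nbhs nu) -->
    slope z r (beta * nu 0 k `^ (z - 1)).
Proof.
move=> r0 A0 Anu U; apply/cvgrPdist_lt => e e0.
have b0 : 0 <= beta * nu 0 k `^ (z - 1) by rewrite mulr_ge0 ?powR_ge0// ltW.
have [d d0 Hd] := slope_near z2 r0 U b0 e0.
have c1 : 1 <= z - 1 by have := z2; lra.
have : (fun x : 'rV[R]_m => beta * `|x 0 k| `^ (z - 1)) x @[x --> nu] -->
    beta * `|nu 0 k| `^ (z - 1).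
  apply: (@continuous_comp _ _ _ (fun x : 'rV[R]_m => x 0 k) (fun v => beta * `|v| `^ (z - 1))).
    exact: coord_continuous.
  by apply: cvgM; [exact: cvg_cst|exact: powR_norm_continuous].
move=> /cvgrPdist_lt /(_ d d0) H; near=> x.
have Ax : A x by near: x; exact: withinT.
rewrite distrC; apply: Hd; rewrite distrC.
rewrite -(ger0_norm (A0 _ Ax)) -(ger0_norm (A0 _ Anu)).
by near: x; exact: cvg_within H.
Unshelve. all: end_near. Qed.

Lemma cvg_normalized (T : Type) (F : set_system T) (FF : Filter F) s
    (h : 'I_s -> T -> R) (l : 'I_s -> R) (G : T -> 'rV[R]_s) :
  (forall i, h i x @[x --> F] --> l i) -> (forall i, 0 < l i) ->
  (forall x i, G x 0 i = h i x / \sum_j h j x) ->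
  G x @[x --> F] --> \row_i (l i / \sum_j l j).
Proof.
move=> H l0 HG; apply: cvg_rV => k; rewrite mxE.
rewrite (_ : (fun x => G x 0 k) = (fun x => h k x * (\sum_j h j x)^-1)); last first.
  by apply/funext => x.
apply: cvgM; first exact: H.
apply: cvgV; last exact: cvg_sumr.
apply: lt0r_neq0; rewrite (bigD1 k) //= ltr_pwDl//.
by apply: sumr_ge0 => i _; exact: ltW.
Qed.

Lemma gibbs_of_unique_energy q s (f : 'I_q -> 'I_s) :
  (forall l, exists i, f i = l) ->
  (forall l nu, 0 <= nu <= 1 -> unique_energy z (class_size f l) (beta * nu `^ (z - 1))) ->
  fuzzy_gibbs f beta z.
Proof.
move=> fsurj U.
have r0 l := class_size_gt0 fsurj l.
pose L (l : 'I_s) (x : 'rV[R]_s) := slope z (class_size f l) (beta * x 0 l `^ (z - 1)).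
exists (fun x => \row_k (expR (L k x) / \sum_l expR (L l x))); split.
  apply/subspace_continuousP => nu snu.
  apply: (@cvg_normalized _ _ _ _ (fun l x => expR (L l x)) (fun l => expR (L l nu))).
  - move=> l; apply: (continuous_cvg _ (@continuous_expR R _)).
    apply: slope_cvg => //; first by move=> x sx; exact: simplex_ge0.
    by apply: U; rewrite simplex_ge0// simplex_le1.
  - by move=> l; exact: expR_gt0.
  - by move=> x k; rewrite mxE.
move=> nu snu eta Heta.
apply: (@cvg_normalized _ _ _ _
  (fun l n => growth z beta (class_size f l) (cnt (eta n) l) n.+1) (fun l => expR (L l nu))).
- move=> l; apply: growth_lim => //.
  + exact: simplex_ge0.
  + by apply: U; rewrite simplex_ge0// simplex_le1.
  + apply: cvg_density => [n|]; first exact: cnt_le.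
    rewrite (_ : (fun n => _) = (fun n => emp R (eta n) 0 l)); first exact: cvg_rV_coord.
    by apply/funext => n; rewrite empE.
- by move=> l; exact: expR_gt0.
- by move=> n k; rewrite QcondE.
Qed.

End GibbsLimit.

(** * The mean-field equation and monotonicity in the number of states *)

Section CriticalPoint.
Local Open Scope classical_set_scope.
Local Open Scope ring_scope.
Variables (R : realType) (z : R).
Hypothesis z2 : 2 <= z.

Let z1 : 1 <= z. Proof. by apply: le_trans z2; rewrite ler1n. Qed.
Let z0 : 0 < z. Proof. exact: lt_le_trans z2. Qed.

Lemma sumr_gt0_ex (I : finType) (h : I -> R) i :
  (forall j, 0 <= h j) -> 0 < h i -> 0 < \sum_j h j.
Proof.
move=> h0 hi; rewrite (bigD1 i) //= ltr_pwDl//.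
by apply: sumr_ge0 => j _; exact: h0.
Qed.

(** The mean-field equation, without differentiation: let [t] be the point with the coordinates on
    the right-hand side. Convexity of [v ^ z] shows that passing from [x] to [t] lowers the free
    energy by at least the relative entropy of [x] with respect to [t]. So a minimiser equals [t],
    and boundary points need no separate discussion. *)
Lemma minimizer_stationary r b (x : 'rV[R]_r) i : 0 <= b -> minimizer z b x ->
  x 0 i = expR (b * x 0 i `^ (z - 1)) / \sum_j expR (b * x 0 j `^ (z - 1)).
Proof.
move=> b0 [sx Hx]; have r0 := simplex_gt0 sx; have [x0 x1] := sx.
set G := \sum_j _.
have G0 : 0 < G.
  by rewrite /G (bigD1 i) //= ltr_pwDl ?expR_gt0// sumr_ge0// => j _; exact: expR_ge0.
pose t j := expR (b * x 0 j `^ (z - 1)) / G.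
have t0 j : 0 < t j by rewrite divr_gt0 ?expR_gt0.
have lnt j : ln (t j) = b * x 0 j `^ (z - 1) - ln G.
  by rewrite ln_div ?posrE ?expR_gt0// expRK.
have t1 : \sum_j t j = 1 by rewrite -mulr_suml mulfV// gt_eqF.
apply: contrapT; rewrite -/(t i) => xi.
clearbody t; clearbody G.
have st : simplex (\row_j t j : 'rV[R]_r).
  by split=> [j|]; [rewrite mxE ltW|under eq_bigr do rewrite mxE].
have := Hx _ st; apply/negP; rewrite -ltNge -subr_gt0 /potts_free_energy -sumrB.
under eq_bigr do rewrite mxE.
have K j : x 0 j * ln (x 0 j) - b / z * x 0 j `^ z - (t j * ln (t j) - b / z * t j `^ z)
    = (1 - ln G) * (x 0 j - t j) + ((t j - x 0 j - x 0 j * (ln (t j) - ln (x 0 j))) +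
      b / z * (t j `^ z - (x 0 j `^ z + z * x 0 j `^ (z - 1) * (t j - x 0 j)))).
  by rewrite lnt; field; exact: lt0r_neq0.
under eq_bigr do rewrite K.
rewrite big_split -mulr_sumr /= sumrB t1 x1 subrr mulr0 add0r.
have K0 j : 0 <= b / z * (t j `^ z - (x 0 j `^ z + z * x 0 j `^ (z - 1) * (t j - x 0 j))).
  by rewrite mulr_ge0 ?divr_ge0 ?(ltW z0)// subr_ge0 powR_tangent // ltW.
apply: (sumr_gt0_ex (i := i)) => [j|].
  by rewrite addr_ge0 // subr_ge0 mul_ln_le.
by rewrite ltr_pwDl // subr_gt0 mul_ln_lt //; exact: nesym.
Qed.

Lemma energy_unif_le r (x : 'rV[R]_r) : simplex x -> energy z (unif R r) <= energy z x.
Proof.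
move=> sx; have r0 := simplex_gt0 sx; have [x0 x1] := sx.
rewrite -subr_ge0 /energy -sumrB.
pose k := z * (r%:R^-1 : R) `^ (z - 1).
apply: (@le_trans _ _ (\sum_i k * (x 0 i - unif R r 0 i))).
  have [_ u1] := simplex_unif R r0.
  by rewrite -mulr_sumr sumrB x1 u1 subrr mulr0.
apply: ler_sum => i _; rewrite mxE lerBrDl.
by apply: powR_tangent => //; rewrite invr_ge0.
Qed.

(** The uniform point has the least energy, so a smaller [b] favours it. Hence the set whose infimum
    is [beta_c] is closed upwards in the positive reals. *)
Lemma uniform_unique_le r b b' : b' <= b ->
  uniform_unique_minimizer r b z -> uniform_unique_minimizer r b' z.
Proof.
move=> bb' H x sx xu; have := H x sx xu; rewrite !free_energyE.
have := energy_unif_le sx; set e := energy _ _; set e' := energy _ _.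
move=> ee'; have : b' / z * (e' - e) <= b / z * (e' - e).
  by rewrite ler_wpM2r ?subr_ge0// ler_wpM2r// invr_ge0 ltW.
lra.
Qed.

Lemma uniform_unique_nonpos r b : b <= 0 -> uniform_unique_minimizer r b z.
Proof.
move=> b0; apply: (uniform_unique_le b0) => x sx /eqP xu.
have r0 := simplex_gt0 sx; have [x0 x1] := sx.
have [u0 u1] := simplex_unif R r0.
have [i xi] : exists i, x 0 i <> r%:R^-1.
  apply: contrapT => H; move/eqP: xu; apply; apply/rowP => i; rewrite mxE.
  by apply: contrapT => Hi; apply: H; exists i.
rewrite !free_energyE !mul0r !subr0.
have ri : 0 < (r%:R^-1 : R) by rewrite invr_gt0 ltr0n.
have -> : \sum_i unif R r 0 i * ln (unif R r 0 i) = \sum_i x 0 i * ln (r%:R^-1).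
  transitivity (\sum_i unif R r 0 i * ln (r%:R^-1)); last by rewrite -!mulr_suml x1 u1.
  by apply: eq_bigr => j _; rewrite mxE.
rewrite -subr_gt0 -sumrB.
have S0 : \sum_i (unif R r 0 i - x 0 i) = 0 by rewrite sumrB x1 u1 subrr.
rewrite -[ltRHS]addr0 -[X in _ < _ + X]S0 -big_split /=; apply: (sumr_gt0_ex (i := i)) => [j|]; rewrite mxE.
  by have := mul_ln_le ri (x0 j); lra.
by have := mul_ln_lt ri (x0 i) (nesym xi); lra.
Qed.

Lemma split_free_energy r b (x : 'rV[R]_r.+1) (i : 'I_r.+1) :
  simplex x -> x 0 i < 1 ->
  let w := 1 - x 0 i in
  let y : 'rV[R]_r := \row_j (x 0 (lift i j) / w) in
  simplex y /\ potts_free_energy b z x =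
    x 0 i * ln (x 0 i) - b / z * x 0 i `^ z + w * ln w +
    w * potts_free_energy (b * w `^ (z - 1)) z y.
Proof.
move=> sx xi1 w y; have [x0 x1] := sx.
have w0 : 0 < w by rewrite subr_gt0.
have wE : \sum_j x 0 (lift i j) = w by rewrite /w -x1 (bigD1_ord i) //= addrAC subrr add0r.
clearbody w.
have sy : simplex y.
  split=> [j|]; first by rewrite mxE divr_ge0// ltW.
  by under eq_bigr do rewrite mxE; rewrite -mulr_suml wE mulfV ?gt_eqF.
split=> //; rewrite /potts_free_energy (bigD1_ord i) //= -[RHS]addrA; congr (_ + _).
have [_ y1] := sy; rewrite -[w * ln w]mulr1 -[X in _ * X + _]y1 !mulr_sumr -big_split /=.
apply: eq_bigr => j _; have -> : x 0 (lift i j) = w * y 0 j.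
  by rewrite mxE mulrC divfK ?gt_eqF.
have y0 : 0 <= y 0 j by exact: simplex_ge0.
rewrite powRM ?(ltW w0)// -(mulr_powRB1 (ltW w0) z0).
have -> : w * y 0 j * ln (w * y 0 j) = w * y 0 j * (ln w + ln (y 0 j)).
  have [->|yj] := eqVneq (y 0 j) 0; first by rewrite mulr0 !mul0r.
  by rewrite lnM // posrE // lt0r yj.
ring.
Qed.

Lemma glue_simplex r (x : 'rV[R]_r.+1) (i : 'I_r.+1) (y : 'rV[R]_r) :
  simplex x -> simplex y ->
  let x' : 'rV[R]_r.+1 :=
    \row_k (if unlift i k is Some j then (1 - x 0 i) * y 0 j else x 0 i) in
  [/\ simplex x', x' 0 i = x 0 i & forall j, x' 0 (lift i j) = (1 - x 0 i) * y 0 j].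
Proof.
move=> sx sy x'.
have E1 : x' 0 i = x 0 i by rewrite mxE unlift_none.
have E2 j : x' 0 (lift i j) = (1 - x 0 i) * y 0 j by rewrite mxE liftK.
split=> //; split=> [k|].
  case: (unliftP i k) => [j ->|->]; last by rewrite E1 simplex_ge0.
  by rewrite E2 mulr_ge0 ?simplex_ge0// subr_ge0 simplex_le1.
rewrite (bigD1_ord i) //= E1; under eq_bigr do rewrite E2.
by have [_ y1] := sy; rewrite -mulr_sumr y1 mulr1 addrC subrK.
Qed.

(* Given the coordinate [i], the others minimise, after normalisation by
   [w = 1 - x 0 i], the free energy at the lower inverse temperature [b w^(z-1)]. *)
Lemma minimizer_others_equal r b (x : 'rV[R]_r.+1) (i j k : 'I_r.+1) : 0 <= b ->
  uniform_unique_minimizer r b z -> minimizer z b x -> x 0 i < 1 ->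
  j != i -> k != i -> x 0 j = x 0 k.
Proof.
move=> b0 U [sx Hx] xi1 ji ki.
have [sy E] := split_free_energy b sx xi1.
set w := 1 - x 0 i in sy E; set y := \row_j _ in sy E.
have w0 : 0 < w by rewrite subr_gt0.
have w1 : w <= 1 by rewrite /w lerBlDr lerDl simplex_ge0.
have [yu|/eqP yu] := eqVneq y (unif R _).
  have H l : l != i -> x 0 l = w * (r%:R^-1).
    case: (unliftP i l) => [m -> _|->]; last by rewrite eqxx.
    have := congr1 (fun v : 'rV[R]_r => w * v 0 m) yu; rewrite !mxE.
    by rewrite mulrC divfK ?gt_eqF.
  by rewrite !H.
have bw : b * w `^ (z - 1) <= b.
  rewrite ler_piMr//; have c0 : 0 <= z - 1 by have := z1; lra.
  by have := powR_ge0_le c0 (ltW w0) w1; rewrite powR1.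
have := uniform_unique_le bw U sy yu => L.
have r0 := simplex_gt0 sy.
have [sx' E1 E2] := glue_simplex i sx (simplex_unif R r0).
set x' := \row_k _ in sx' E1 E2.
have x'i : x' 0 i < 1 by rewrite E1.
have [sy' E'] := split_free_energy b sx' x'i.
have yE : \row_j (x' 0 (lift i j) / (1 - x' 0 i)) = unif R r.
  by apply/rowP => m; rewrite mxE E2 E1 -/w mulrAC mulfV ?gt_eqF// mul1r.
rewrite yE E1 -/w in E'.
have := Hx _ sx'; rewrite E E' lerD2l ler_pM2l// => H.
by have := lt_le_trans L H; rewrite ltxx.
Qed.

(** Any two coordinates of a minimiser avoid a third one; given that one, the remaining [r]
    coordinates agree by uniqueness for [r] states. So all coordinates are equal. *)
Lemma uniform_unique_succ r b : (2 <= r)%N -> 0 <= b ->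
  uniform_unique_minimizer r b z -> uniform_unique_minimizer r.+1 b z.
Proof.
move=> r2 b0 U.
have third (i j : 'I_r.+1) : exists k, (k != i) && (k != j).
  apply/existsP; apply: contraTT r2; rewrite negb_exists -ltnNge ltnS => /forallP H.
  have : [set: 'I_r.+1]%SET \subset [set i; j]%SET.
    by apply/fintype.subsetP => k _; rewrite !inE; have := H k; rewrite -negb_or negbK.
  by move/subset_leq_card; rewrite cardsT card_ord cards2; case: (i != j) => //; lia.
have minU (x : 'rV[R]_r.+1) : minimizer z b x -> x = unif R r.+1.
  move=> mx; have [sx _] := mx; have [x0 x1] := sx.
  (* [minimizer_others_equal] fixes a coordinate below 1. If [x 0 i = 1], the others vanish; fixing
     some [k <> i] then gives [x 0 i = x 0 l] for a third index [l], that is, [1 = 0]. *)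
  have lt1 i : x 0 i < 1.
    rewrite lt_neqAle simplex_le1// andbT; apply/eqP => xi.
    have [k /andP[ki _]] := third i i.
    have x0' l : l != i -> x 0 l = 0.
      move=> li; have := x1; rewrite (bigD1 i) //= xi (bigD1 l) //= => H.
      have : 0 <= \sum_(i0 < r.+1 | (i0 != i) && (i0 != l)) x 0 i0 by exact: sumr_ge0.
      by have := x0 l; move: H; set S := \sum_(_ | _) _; lra.
    have [l /andP[lk li]] := third k i.
    have := @minimizer_others_equal r b x k i l b0 U mx.
    rewrite xi (x0' _ ki) (x0' _ li) ltr01 eq_sym ki lk => /(_ isT isT isT)/eqP.
    by rewrite oner_eq0.
  have eqx i j : x 0 i = x 0 j.
    have [k /andP[ki kj]] := third i j.
    by apply: (@minimizer_others_equal r b x k i j) => //; rewrite eq_sym.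
  apply/rowP => i; rewrite mxE.
  have := x1; under eq_bigr do rewrite (eqx _ i).
  rewrite sumr_const card_ord -[LHS]mulr_natr => H.
  by apply: (mulIf (x := r.+1%:R)); rewrite ?pnatr_eq0// H mulVf// pnatr_eq0.
move=> x sx xu; have am := argminP z2 b (ltn0Sn r).
have ua := minU _ am; rewrite -ua.
rewrite lt_neqAle (am.2 _ sx) andbT; apply/eqP => E; apply: xu.
apply: minU; split=> // y sy; rewrite -E; exact: am.2.
Qed.

(** * The spinodal point, the critical inverse temperature and coexistence *)

Lemma is_derive_affine (F dF : R -> R) (c d t : R) :
  (forall s : R, 0 < s -> is_derive s 1 F (dF s)) -> 0 < c + d * t ->
  is_derive t 1 (fun t : R => F (c + d * t)) (dF (c + d * t) * d).
Proof.
move=> HF H0; apply: (@is_derive1_comp _ F (fun t => c + d * t)); first exact: HF.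
by apply: is_derive_eq; rewrite /GRing.scale /=; ring.
Qed.

(** The free energy of one state at the spinodal point, in the variable [s] equal to the number of
    states times the coordinate. This puts the uniform point at [s = 1] and removes the number of
    states; the second derivative [1 / s - s ^ (z - 2)] vanishes at [s = 1]. *)
Definition spin_h (s : R) : R := s * ln s - s `^ z / (z * (z - 1)).

Definition spin_k (s : R) : R := ln s + 1 - s `^ (z - 1) / (z - 1).

Lemma is_derive_spin_h (s : R) : 0 < s -> is_derive s 1 spin_h (spin_k s).
Proof.
move=> s0; have zz1 : z - 1 != 0 by apply: lt0r_neq0; have := z2; lra.
rewrite /spin_h /spin_k; have wd := is_derive1_powR z s0; have wl := is_derive1_ln s0.
apply: is_derive_eq; rewrite /GRing.scale /=; field.
by rewrite zz1 !gt_eqF.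
Qed.

Lemma is_derive_spin_k (s : R) : 0 < s -> is_derive s 1 spin_k (s^-1 - s `^ (z - 2)).
Proof.
move=> s0; have zz1 : z - 1 != 0 by apply: lt0r_neq0; have := z2; lra.
rewrite /spin_k; have wd := is_derive1_powR (z - 1) s0; have wl := is_derive1_ln s0.
apply: is_derive_eq; rewrite /GRing.scale /= (_ : z - 1 - 1 = z - 2); last by ring.
by field; rewrite zz1 gt_eqF.
Qed.

Lemma spin_k_decr (u v : R) : 1 <= u -> u <= v -> spin_k v <= spin_k u.
Proof.
move=> u1 uv; have u0 : 0 < u by lra.
have v0 : 0 < v by lra.
have L : ln v - ln u <= v - u.
  have : u * (ln v - ln u) <= v - u by apply: mul_ln_le => //; exact: ltW.
  have : ln u <= ln v by rewrite ler_ln ?posrE.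
  nra.
have c1 : 1 <= z - 1 by have := z2; lra.
have T := powR_tangent c1 (ltW u0) (ltW v0).
have U : 1 <= u `^ (z - 1 - 1).
  have d0 : 0 <= z - 1 - 1 by have := z2; lra.
  by have := powR_ge0_le d0 ler01 u1; rewrite powR1.
have W : v - u <= (v `^ (z - 1) - u `^ (z - 1)) / (z - 1).
  rewrite ler_pdivlMr; last lra.
  have : (z - 1) * 1 * (v - u) <= (z - 1) * u `^ (z - 1 - 1) * (v - u).
    by rewrite ler_wpM2r ?subr_ge0// ler_wpM2l//; lra.
  lra.
rewrite /spin_k; rewrite mulrBl in W; lra.
Qed.

Lemma spin_h_free_energy r (v : 'I_r.+1 -> R) : (forall i, 0 < v i) -> \sum_i v i = r.+1%:R ->
  potts_free_energy (r.+1%:R `^ (z - 1) / (z - 1)) z (\row_i (v i / r.+1%:R)) =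
  r.+1%:R^-1 * (\sum_i spin_h (v i)) - ln r.+1%:R.
Proof.
move=> v0 v1; have zz1 : z - 1 != 0 by apply: lt0r_neq0; have := z2; lra.
have q0 : 0 < r.+1%:R :> R by rewrite ltr0n.
have -> : ln r.+1%:R = \sum_i v i / r.+1%:R * ln r.+1%:R :> R.
  by rewrite -!mulr_suml v1 mulfV ?mul1r// gt_eqF.
rewrite mulr_sumr -sumrB /potts_free_energy; apply: eq_bigr => i _.
rewrite mxE ln_div ?posrE// powRM ?(ltW (v0 i)) ?invr_ge0 ?(ltW q0)//.
have -> : (r.+1%:R^-1 : R) `^ z = (r.+1%:R * r.+1%:R `^ (z - 1))^-1.
  by rewrite mulr_powRB1 ?(ltW q0)// -powR_inv1 ?(ltW q0)// powRAC powR_inv1 ?powR_ge0.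
have P0 : r.+1%:R `^ (z - 1) != 0 :> R by rewrite gt_eqF// powR_gt0.
rewrite /spin_h; field; rewrite zz1 P0 !gt_eqF//.
Qed.

(* At the spinodal the second derivative vanishes in every direction, so the descent
   is tested along [(1 + r t, 1 - t, ..., 1 - t)]; any [a <= r] may replace [r] in the
   condition because [spin_k] decreases on [1, +oo[. *)
Lemma spinodal_direction (a t0 : R) (r : nat) : 0 < a -> a <= r%:R -> 0 < t0 < 1 ->
  (forall t, 0 < t <= t0 ->
     a / (1 + a * t) + (1 - t)^-1 < a * (1 + a * t) `^ (z - 2) + (1 - t) `^ (z - 2)) ->
  exists y : 'rV[R]_r.+1, simplex y /\
    potts_free_energy (r.+1%:R `^ (z - 1) / (z - 1)) z y <
    potts_free_energy (r.+1%:R `^ (z - 1) / (z - 1)) z (unif R r.+1).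
Proof.
move=> a0 ar /andP[t00 t01] Hp.
have r0 : 0 < r%:R :> R by apply: lt_le_trans ar.
pose E' (t : R) := spin_h (1 + r%:R * t) + r%:R * spin_h (1 + (-1) * t).
(* The mean value theorem is applied to the free energy along the direction, then to the difference
   of values of [spin_k] in its derivative, with [a] in place of [r]. *)
have [t|c /andP[c0 ct] EE] := @derive_MVT _ E'
    (fun t => spin_k (1 + r%:R * t) * r%:R + r%:R * (spin_k (1 + (-1) * t) * (-1))) 0 t0 t00.
  move=> /andP[t_ge0 tt0]; rewrite /E'.
  have p1 : 0 < 1 + r%:R * t by have := mulr_ge0 (ltW r0) t_ge0; lra.
  have p2 : 0 < 1 + (-1) * t by lra.
  have H1 := is_derive_affine is_derive_spin_h p1; have H2 := is_derive_affine is_derive_spin_h p2.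
  by apply: is_derive_eq; rewrite /GRing.scale /=; ring.
have [t|c' /andP[c'0 c'c] DE] := @derive_MVT _ (fun t => spin_k (1 + a * t) - spin_k (1 + (-1) * t))
    (fun t => ((1 + a * t)^-1 - (1 + a * t) `^ (z - 2)) * a -
       ((1 + (-1) * t)^-1 - (1 + (-1) * t) `^ (z - 2)) * (-1)) 0 c c0.
  move=> /andP[t_ge0 tc].
  have p1 : 0 < 1 + a * t by have := mulr_ge0 (ltW a0) t_ge0; lra.
  have p2 : 0 < 1 + (-1) * t by lra.
  have H1 := is_derive_affine is_derive_spin_k p1; have H2 := is_derive_affine is_derive_spin_k p2.
  by apply: is_derive_eq.
have c'r : 0 < c' <= t0 by rewrite c'0; lra.
have D0 : spin_k (1 + a * c) < spin_k (1 + (-1) * c).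
  rewrite -subr_lt0; move: DE; rewrite !mulr0 !addr0 !subr0 subrr subr0 => ->.
  rewrite pmulr_llt0//; have := Hp _ c'r; rewrite (_ : 1 + -1 * c' = 1 - c'); last by ring.
  rewrite -[a / _]mulrC; lra.
have kk : spin_k (1 + r%:R * c) <= spin_k (1 + a * c).
  apply: spin_k_decr; first by rewrite lerDl mulr_ge0// ltW.
  by rewrite lerD2l ler_wpM2r// ltW.
have EL : E' t0 < E' 0.
  rewrite -subr_lt0 EE subr0 pmulr_llt0//.
  have : r%:R * (spin_k (1 + r%:R * c) - spin_k (1 + -1 * c)) < 0.
    by rewrite pmulr_rlt0//; lra.
  lra.
pose s (i : 'I_r.+1) : R := if i == ord0 then 1 + r%:R * t0 else 1 + (-1) * t0.
have s0 i : 0 < s i.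
  by rewrite /s; case: ifP => _; [rewrite ltr_wpDr// mulr_ge0// ltW|lra].
have q0 : 0 < r.+1%:R :> R by rewrite ltr0n.
have sumS (F : R -> R) : \sum_i F (s i) = F (1 + r%:R * t0) + r%:R * F (1 + (-1) * t0).
  rewrite big_ord_recl {1}/s eqxx; congr (_ + _).
  by rewrite /s /= sumr_const card_ord mulr_natl.
exists (\row_i (s i / r.+1%:R)); split.
  split=> [i|]; first by rewrite mxE divr_ge0 ?(ltW (s0 i)).
  under eq_bigr do rewrite mxE; rewrite -mulr_suml (sumS id).
  by rewrite -natr1; field; rewrite natr1 gt_eqF.
have -> : unif R r.+1 = \row_i (1 / r.+1%:R) by apply/rowP => i; rewrite !mxE div1r.
rewrite !spin_h_free_energy//; last 2 first.
- by rewrite sumr_const card_ord.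
- by rewrite (sumS id) -natr1; ring.
rewrite ltrD2r ltr_pM2l ?invr_gt0// sumS sumr_const card_ord.
move: EL; rewrite /E' !mulr0 !addr0 -[_ *+ r.+1]mulr_natl -natr1; lra.
Qed.

(** With two states the odd orders cancel by symmetry and the fourth order decides, which has the
    favourable sign for [z > 4]. With three or more states the third order already decides. *)
Lemma spinodal_unstable r : 2 < z -> admissible r z ->
  exists y : 'rV[R]_r, simplex y /\
    potts_free_energy (r%:R `^ (z - 1) / (z - 1)) z y <
    potts_free_energy (r%:R `^ (z - 1) / (z - 1)) z (unif R r).
Proof.
move=> z2' /and3P[r2 _ adm]; case: r r2 adm => // r r2 adm.
have [r1|r1] := eqVneq r 1%N.
  move: adm; rewrite r1 eqxx /= -ltNge => z4.
  have p0 : 0 < z - 2 by lra.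
  (* The inequality will reduce to [t ^ 2 (z - 2) < z - 4], which follows from
     [t <= (z - 4) / (z - 2)] and [t < 1]. *)
  apply: (@spinodal_direction 1 ((z - 4) / (z - 2)) 1) => //.
    by rewrite divr_gt0 ?subr_gt0//= ltr_pdivrMr//; lra.
  move=> t /andP[t0]; rewrite ler_pdivlMr// => tp.
  rewrite !mul1r; set w := (z - 2) / 2.
  have w1 : 1 <= w by rewrite /w ler_pdivlMr//; lra.
  have t1 : t < 1 by rewrite -(ltr_pM2r p0); lra.
  have E (v : R) : 0 <= v -> v `^ (z - 2) = (v ^+ 2) `^ w.
    by move=> v0; rewrite -powR_mulrn// -powRrM; congr (_ `^ _); rewrite /w; field.
  rewrite !E; [|lra|lra].
  have m0 : 0 <= 1 + t ^+ 2 by rewrite addr_ge0 ?sqr_ge0.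
  have T1 := powR_tangent w1 m0 (sqr_ge0 (1 + t)).
  have T2 := powR_tangent w1 m0 (sqr_ge0 (1 - t)).
  have B : 1 + w * t ^+ 2 <= (1 + t ^+ 2) `^ w.
    by have := bernoulli_le m0 w1; rewrite (_ : 1 + t ^+ 2 - 1 = t ^+ 2) //; ring.
  have T : 2 * (1 + w * t ^+ 2) <= ((1 + t) ^+ 2) `^ w + ((1 - t) ^+ 2) `^ w.
    move: T1 T2 B; set c := w * _; nra.
  apply: lt_le_trans T.
  have -> : (1 + t)^-1 + (1 - t)^-1 = 2 / ((1 + t) * (1 - t)).
    by field; apply/andP; split; apply: lt0r_neq0; lra.
  rewrite ltr_pdivrMr; last by rewrite mulr_gt0; lra.
  have t2 : 0 < t ^+ 2 by rewrite exprn_gt0.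
  have tt : t ^+ 2 < t by rewrite expr2 gtr_pMr.
  have K : t ^+ 2 * (z - 2) < z - 4 by apply: lt_le_trans tp; rewrite ltr_pM2r.
  rewrite -subr_gt0 (_ : _ - _ = t ^+ 2 * (z - 4 - t ^+ 2 * (z - 2))).
    by rewrite mulr_gt0// subr_gt0.
  by rewrite /w; field.
have r2' : 2 <= r%:R :> R by rewrite ler_nat; case: r r1 r2 adm => [|[]].
(* For small [t] the left side is [3 / ((1 + 2 t) (1 - t)) < 3], while [(1 + 2 t) ^ 2 (1 - t) >= 1]
   makes the right side at least 3. *)
apply: (@spinodal_direction 2 4^-1 r) => //; first lra.
move=> t /andP[t0 t12].
have p0 : 0 < z - 2 by lra.
have X0 : 0 < 1 + 2 * t by lra.
have Y0 : 0 < 1 - t by lra.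
have PX := powR_ge1D_ln (z - 2) X0; have PY := powR_ge1D_ln (z - 2) Y0.
have t2 : 0 < t * (1 - 2 * t) by rewrite mulr_gt0//; lra.
have t3 : 0 <= t * t * (1 - 2 * t) by rewrite !mulr_ge0//; lra.
have L : 0 <= 2 * ln (1 + 2 * t) + ln (1 - t).
  have -> : 2 * ln (1 + 2 * t) = ln ((1 + 2 * t) ^+ 2) by rewrite lnXn // mulr_natl.
  rewrite -lnM ?posrE ?exprn_gt0// ln_ge0//.
  rewrite -subr_ge0 (_ : _ - _ = t * (1 - 2 * t) + 2 * t + 2 * (t * t * (1 - 2 * t))).
    by lra.
  by ring.
have : 3 <= 2 * (1 + 2 * t) `^ (z - 2) + (1 - t) `^ (z - 2).
  have := mulr_ge0 (ltW p0) L; lra.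
apply: lt_le_trans.
have -> : 2 / (1 + 2 * t) + (1 - t)^-1 = 3 / ((1 + 2 * t) * (1 - t)).
  by field; apply/andP; split; apply: lt0r_neq0.
rewrite ltr_pdivrMr ?mulr_gt0//; lra.
Qed.

(** The value of [b] at which the second derivative [1 / v - b (z - 1) v ^ (z - 2)] of the free
    energy of one state vanishes at [v = 1 / r]. *)
Definition spinodal r : R := r%:R `^ (z - 1) / (z - 1).

Let bset r : set R := [set b : R | 0 < b /\ ~ uniform_unique_minimizer r b z].

Lemma bset_lbound r : has_lbound (bset r).
Proof. by exists 0 => b [/ltW]. Qed.

(** The inequality at the spinodal point is strict, so it persists slightly below. This also shows
    that the infimum defining [beta_c] is over a nonempty set. *)
Lemma bset_lt_spinodal r : 2 < z -> admissible r z -> exists2 b, bset r b & b < spinodal r.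
Proof.
move=> z2' adm; have [y [sy Hy]] := spinodal_unstable z2' adm.
have r2 : (2 <= r)%N by case/and3P: adm.
have r0 : (0 < r)%N by apply: leq_trans r2.
have sp0 : 0 < spinodal r by rewrite divr_gt0 ?powR_gt0 ?ltr0n//; lra.
have su := simplex_unif R r0.
rewrite -/(spinodal r) in Hy; move: Hy; rewrite -subr_gt0.
set g := _ - _ => g0.
pose d := Num.min (g * z / 2) (spinodal r / 2).
have d0 : 0 < d by rewrite lt_min (divr_gt0 (mulr_gt0 g0 z0)) ?(divr_gt0 sp0).
have d1 : d / z <= g / 2 by rewrite ler_pdivrMr// mulrAC ge_min lexx.
have d2 : d <= spinodal r / 2 by rewrite ge_min lexx orbT.
exists (spinodal r - d); last by rewrite ltrBlDr ltrDl.
split=> [|U]; first lra.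
have yu : y <> unif R r by move=> E; move: g0; rewrite /g E subrr ltxx.
have L1 := free_energy_lip z2 (spinodal r - d) (spinodal r) sy.
have L2 := free_energy_lip z2 (spinodal r) (spinodal r - d) su.
have := U y sy yu; move: L1 L2.
rewrite (distrC (spinodal r - d)) subKr (gtr0_norm d0) => L1 L2 L3.
by move: d1; rewrite /g; lra.
Qed.

Lemma beta_c_lt_spinodal r : 2 < z -> admissible r z -> beta_c r z < spinodal r.
Proof.
move=> z2' adm; have [b Hb bs] := bset_lt_spinodal z2' adm.
by apply: le_lt_trans bs; apply: ge_inf => //; exact: bset_lbound.
Qed.

Lemma unique_below_beta_c r b : b < beta_c r z -> uniform_unique_minimizer r b z.
Proof.
move=> bb; have [b0|b0] := lerP b 0; first exact: uniform_unique_nonpos.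
apply: contrapT => H; move: bb; rewrite ltNge => /negP; apply.
by apply: ge_inf; [exact: bset_lbound|split].
Qed.

Lemma nonunique_above_beta_c r b : 2 < z -> admissible r z -> beta_c r z < b ->
  ~ uniform_unique_minimizer r b z.
Proof.
move=> z2' adm bb U; have [b1 Hb1 _] := bset_lt_spinodal z2' adm.
have ne : bset r !=set0 by exists b1.
have [b2 [_ H2] b2b] := inf_lt ne bb.
by apply: H2; apply: uniform_unique_le U; exact: ltW.
Qed.

Lemma beta_c_succ r : 2 < z -> admissible r z -> beta_c r z <= beta_c r.+1 z.
Proof.
move=> z2' adm; have r2 : (2 <= r)%N by case/and3P: adm.
have adm' : admissible r.+1 z.
  by rewrite /admissible ltnW //= z2 /= eqSS; case: eqP r2 => [->|].
have [b1 Hb1 _] := bset_lt_spinodal z2' adm'.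
apply: lb_le_inf; first by exists b1.
move=> b [b0 Hb]; rewrite leNgt; apply/negP => bb; apply: Hb.
by apply: uniform_unique_succ => //; [exact: ltW|exact: unique_below_beta_c].
Qed.

Lemma beta_c_le r r' : 2 < z -> admissible r z -> (r <= r')%N ->
  beta_c r z <= beta_c r' z.
Proof.
move=> z2' adm; elim: r' => [|r' IH].
  by rewrite leqn0 => /eqP r0; move: adm; rewrite r0.
rewrite leq_eqVlt ltnS => /predU1P[<-//|rr']; apply: (le_trans (IH rr')).
apply: beta_c_succ => //.
case/and3P: adm => r2 _ Hr; rewrite /admissible (leq_trans r2 rr') z2 /=.
apply: contra Hr => /andP[/eqP E ->]; rewrite andbT; move: rr'; rewrite E => rr'.
by rewrite eqn_leq rr' r2.
Qed.

(** Below the spinodal point the free energy of one state is strictly convex near [1 / r] and lies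
    above its tangent; on the simplex the tangent terms sum to 0. A single [eps] serves all
    [b <= b'], so that [b] can tend to [beta_c] afterwards. *)
Lemma unif_min_local r (b' : R) : (0 < r)%N -> 0 <= b' -> b' < spinodal r -> exists2 eps, 0 < eps &
  forall b (x : 'rV[R]_r), 0 <= b -> b <= b' -> simplex x -> x <> unif R r ->
    (forall i, `|x 0 i - r%:R^-1| <= eps) ->
    potts_free_energy b z (unif R r) < potts_free_energy b z x.
Proof.
move=> r0 b'0 bs; set a : R := r%:R^-1.
have q0 : 0 < r%:R :> R by rewrite ltr0n.
have a0 : 0 < a by rewrite invr_gt0.
have c0 : 0 < z - 1 by have := z2; lra.
have Ha : b' * (z - 1) * a `^ (z - 1) < 1.
  have P0 : 0 < (r%:R : R) `^ (z - 1) by rewrite powR_gt0.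
  have -> : a `^ (z - 1) = (r%:R `^ (z - 1))^-1.
    by rewrite /a -powR_inv1 ?(ltW q0)// powRAC powR_inv1 ?powR_ge0.
  by rewrite ltr_pdivrMr// mul1r -ltr_pdivlMr.
have [m [am Hm]] : exists m, a < m /\ b' * (z - 1) * m `^ (z - 1) < 1.
  have cc := @powR_norm_continuous R (z - 1) ltac:(have := z2; lra) a.
  pose k := b' * (z - 1) + 1; have k0 : 0 < k by rewrite ltr_wpDl ?mulr_ge0 // ltW.
  have : 0 < (1 - b' * (z - 1) * a `^ (z - 1)) / k by rewrite divr_gt0// subr_gt0.
  move/(cvgrPdist_lt _ _).1 : cc => /[apply] -[/= d d0 Hd].
  exists (a + d / 2); split; first by rewrite ltrDl divr_gt0.
  have := Hd (a + d / 2); rewrite /ball_ /= opprD addrA subrr add0r normrN.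
  rewrite (gtr0_norm a0) gtr0_norm ?divr_gt0// ltr_pdivrMr// ltr_pMr// ltr1n => /(_ isT).
  have ad0 : 0 < a + d / 2 by rewrite addr_gt0 ?divr_gt0.
  rewrite (gtr0_norm ad0) distrC.
  set A := a `^ _; set B := _ `^ (z - 1) => H.
  have AB : B - A < (1 - b' * (z - 1) * A) / k by apply: le_lt_trans H; exact: ler_norm.
  have : A <= B by apply: powR_ge0_le; [exact: ltW|exact: ltW|rewrite lerDl divr_ge0// ltW].
  move: AB; rewrite ltr_pdivlMr// /k; nra.
(* [m - a] keeps the coordinates where [xlnx_tangent_lt] applies, and [a / 2] keeps them
   positive. *)
exists (Num.min (m - a) (a / 2)); first by rewrite lt_min subr_gt0 am divr_gt0.
move=> b x b0 bb sx xu Hx; have [x0 x1] := sx.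
have [u0 u1] := simplex_unif R r0.
have [i xi] : exists i, x 0 i <> a.
  apply: contrapT => H; apply: xu; apply/rowP => i; rewrite mxE.
  by apply: contrapT => Hi; apply: H; exists i.
pose T := ln a + 1 - b * a `^ (z - 1).
pose f v := v * ln v - b / z * v `^ z.
have key j : x 0 j <> a -> f a + T * (x 0 j - a) < f (x 0 j).
  have := Hx j; rewrite le_min ler_norml => /andP[/andP[_ h2]]; rewrite ler_norml => /andP[h3 _] xj.
  apply: xlnx_tangent_lt => //; first lra.
  apply: le_lt_trans Hm; apply: ler_pM; rewrite ?powR_ge0 ?mulr_ge0 ?(ltW c0)//.
    by rewrite ler_wpM2r // ltW.
  by apply: powR_ge0_le; [exact: ltW|rewrite le_max ltW|rewrite ge_max (ltW am) /=; lra].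
have T0 : \sum_j T * (x 0 j - unif R r 0 j) = 0.
  by rewrite -mulr_sumr sumrB x1 u1 subrr mulr0.
have -> : potts_free_energy b z (unif R r) = \sum_(j < r) f a + \sum_j T * (x 0 j - unif R r 0 j).
  rewrite T0 addr0.
  by apply: eq_bigr => j _; rewrite mxE.
rewrite -big_split /= -subr_gt0 /potts_free_energy -sumrB.
apply: (sumr_gt0_ex (i := i)) => [j|]; rewrite mxE; last by rewrite subr_gt0; exact: key.
rewrite subr_ge0.
have [->|/eqP xj] := eqVneq (x 0 j) a; first by rewrite subrr mulr0 addr0.
exact/ltW/key.
Qed.

Lemma unif_min_beta_c r (x : 'rV[R]_r) : simplex x ->
  potts_free_energy (beta_c r z) z (unif R r) <= potts_free_energy (beta_c r z) z x.
Proof.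
move=> sx; have r0 := simplex_gt0 sx; have su := simplex_unif R r0.
have [->//|/eqP xu] := eqVneq x (unif R r).
rewrite leNgt -subr_gt0; apply/negP; set g := _ - _ => g0.
have d0 : 0 < g * z / 2 by rewrite divr_gt0// mulr_gt0.
have bb : beta_c r z - g * z / 2 < beta_c r z by rewrite ltrBlDr ltrDl.
have := unique_below_beta_c bb sx xu.
have := free_energy_lip z2 (beta_c r z - g * z / 2) (beta_c r z) sx.
have := free_energy_lip z2 (beta_c r z) (beta_c r z - g * z / 2) su.
rewrite (distrC (beta_c r z - _)) subKr (gtr0_norm d0).
have -> : g * z / 2 / z = g / 2 by field; exact: lt0r_neq0.
rewrite /g; lra.
Qed.

(** Just above [beta_c] some other point does as well as the uniform one, and by [unif_min_local] it
    stays outside a fixed neighbourhood of it. A free energy gap on the closed complement at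
    [beta_c] would persist for slightly larger [b], so there is none and a minimiser on the
    complement coexists. Positivity holds because for [b <= 0] the uniform point is alone. *)
Lemma beta_c_attained r : 2 < z -> admissible r z ->
  0 < beta_c r z /\ exists x : 'rV[R]_r, [/\ x <> unif R r, minimizer z (beta_c r z) x &
    potts_free_energy (beta_c r z) z x = potts_free_energy (beta_c r z) z (unif R r)].
Proof.
move=> z2' adm.
have r0 : (0 < r)%N by case/and3P: adm => /ltnW.
have su := simplex_unif R r0.
set bc := beta_c r z.
have bc0 : 0 <= bc.
  have [b1 Hb1 _] := bset_lt_spinodal z2' adm.
  by apply: lb_le_inf; [exists b1|move=> b [/ltW]].
have bcs : bc < spinodal r := beta_c_lt_spinodal z2' adm.
pose b' := (bc + spinodal r) / 2.
have b'0 : 0 <= b' by rewrite /b'; lra.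
have b's : b' < spinodal r by rewrite /b'; lra.
have bcb' : bc < b' by rewrite /b'; lra.
have [eps eps0 Hloc] := unif_min_local r0 b'0 b's.
pose S (x : 'rV[R]_r) := \sum_i `|x 0 i - r%:R^-1|.
pose C : set 'rV[R]_r := S @^-1` [set v | eps <= v].
have cC : closed C.
  apply: preimage_closed; last exact: closed_ge.
  move=> x _; apply: (@sum_coord_continuous R r (fun v => `|v - r%:R^-1|)) => v.
  apply: cvg_norm; apply: cvgB; [exact: cvg_id|exact: cvg_cst].
have inC (b : R) : bc < b -> b <= b' -> exists x, [/\ simplex x, C x &
    potts_free_energy b z x <= potts_free_energy b z (unif R r)].
  move=> b1 b2; have := nonunique_above_beta_c z2' adm b1.
  move=> H; apply: contrapT => H2; apply: H => x sx xu.
  rewrite ltNge; apply/negP => Fx; apply: H2; exists x; split=> //.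
  rewrite /C /= leNgt; apply/negP => HS.
  have := Hloc b x (le_trans bc0 (ltW b1)) b2 sx xu; rewrite ltNge Fx => H3.
  suff: false by []; apply: H3 => i; apply: le_trans (ltW HS).
  by rewrite /S (bigD1 i) //= lerDl sumr_ge0.
have [xc [sxc Cxc Hxc]] : exists x, [/\ simplex x, C x & forall y, simplex y -> C y ->
    potts_free_energy bc z x <= potts_free_energy bc z y].
  apply: simplex_min => //; have [x [sx Cx _]] := inC _ bcb' (lexx _).
  by exists x.
have xu : xc <> unif R r.
  move=> E; move: Cxc; rewrite /C /= /S E big1 ?leNgt ?eps0// => i _.
  by rewrite mxE subrr normr0.
have FE : potts_free_energy bc z xc = potts_free_energy bc z (unif R r).
  apply/eqP; rewrite eq_le unif_min_beta_c // andbT leNgt -subr_gt0.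
  apply/negP; set g := _ - _ => g0.
  pose d := Num.min (g * z / 4) (b' - bc).
  have d0 : 0 < d by rewrite lt_min divr_gt0 ?mulr_gt0//= subr_gt0.
  have d1 : d / z <= g / 4 by rewrite ler_pdivrMr// mulrAC ge_min lexx.
  have d2 : d <= b' - bc by rewrite ge_min lexx orbT.
  have [x [sx Cx Fx]] := inC (bc + d) ltac:(by rewrite ltrDl) ltac:(by rewrite -lerBrDl).
  have L1 := free_energy_lip z2 bc (bc + d) sx.
  have L2 := free_energy_lip z2 (bc + d) bc su.
  have L3 := Hxc _ sx Cx.
  move: L1 L2; rewrite (distrC bc) addrAC subrr add0r (gtr0_norm d0).
  move: g0 L3 Fx d1; rewrite /g; lra.
have mxc : minimizer z bc xc by split=> // y sy; rewrite FE; exact: unif_min_beta_c.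
split; last by exists xc.
rewrite lt0r bc0 andbT; apply/eqP => E.
have bn : bc <= 0 by rewrite E.
by have := uniform_unique_nonpos bn sxc xu; rewrite FE ltxx.
Qed.

(** * Uniqueness of the energy, in particular for two states *)

Lemma unique_energy_of_uniform r b : uniform_unique_minimizer r b z -> unique_energy z r b.
Proof.
move=> U; suff H (x : 'rV[R]_r) : minimizer z b x -> x = unif R r.
  by move=> x y /H -> /H ->.
move=> [sx Hx]; apply: contrapT => xu.
have := U x sx xu; rewrite ltNge Hx //.
exact: simplex_unif (simplex_gt0 sx).
Qed.

Lemma unique_energy1 b : unique_energy z 1 b.
Proof.
move=> x y [[_ x1] _] [[_ y1] _].
by rewrite /energy !big_ord1; move: x1 y1; rewrite !big_ord1 => -> ->.
Qed.

(** To first order at [rho = 1] the expression is [c (3 - c) (rho - 1)]. With [c = z - 1], this is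
    where [z <= 4] enters. *)
Lemma two_state_aux (c rho : R) : 1 <= c -> c <= 3 -> 1 < rho ->
  0 < rho `^ c - 1 - c * rho `^ (c - 1) + c * rho.
Proof.
move=> c1 c3 rho1.
pose J (t : R) := t `^ c - c * t `^ (c - 1) + c * t.
pose dJ (t : R) := c * t `^ (c - 1) - c * ((c - 1) * t `^ (c - 2)) + c.
have dP (t : R) : 0 < t -> is_derive t 1 J (dJ t).
  move=> t0; rewrite /J /dJ; have w1 := is_derive1_powR c t0.
  have := is_derive1_powR (c - 1) t0; rewrite (_ : c - 1 - 1 = c - 2); last by ring.
  by move=> w2; apply: is_derive_eq; rewrite /GRing.scale /=; ring.
have [t /andP[t1 _]|s /andP[s1 _] E] := @derive_MVT _ J dJ 1 rho rho1.
  by apply: dP; apply: lt_le_trans t1.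
suff : 0 < dJ s.
  move=> D; have : 0 < J rho - J 1 by rewrite E mulr_gt0 ?subr_gt0.
  by rewrite /J powR1; lra.
have s0 : 0 < s by lra.
have -> : dJ s = c * (s `^ (c - 1) - (c - 1) * s `^ (c - 2) + 1) by rewrite /dJ; ring.
rewrite mulr_gt0 //; first lra.
have [c2|c2] := lerP c 2.
  have : s `^ (c - 2) <= 1.
    by have := @ler_powR _ s (ltW s1) (c - 2) 0; rewrite powRr0; apply; lra.
  have : 1 <= s `^ (c - 1).
    by have := @ler_powR _ s (ltW s1) 0 (c - 1); rewrite powRr0; apply; lra.
  nra.
have -> : s `^ (c - 1) = s * s `^ (c - 2).
  by rewrite (_ : c - 2 = c - 1 - 1); [rewrite mulr_powRB1 ?ltW//; lra|ring].
have B : s `^ (c - 2) <= s by apply: ler1_powR => //; [exact: ltW|lra].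
have A : 0 < s `^ (c - 2) by exact: powR_gt0.
have : (c - 1) * s `^ (c - 2) <= 2 * s `^ (c - 2) by rewrite ler_wpM2r ?(ltW A)//; lra.
have [s2|s2] := lerP 2 s.
  have := mulr_ge0 (ltW A) (ltac:(by rewrite subr_ge0) : 0 <= s - 2).
  lra.
(* Here [s ^ (c - 2) (s - (c - 1)) + 1 >= 1 - (2 - s) s = (s - 1) ^ 2 > 0]. *)
have : (2 - s) * s `^ (c - 2) <= (2 - s) * s by rewrite ler_wpM2l//; lra.
have : 0 < (s - 1) * (s - 1) by rewrite mulr_gt0//; lra.
lra.
Qed.

Definition two_state_field b (v : R) : R :=
  ln v - ln (1 - v) - b * (v `^ (z - 1) - (1 - v) `^ (z - 1)).

(* For [r = 2] and [z <= 4] the transition is of second order: minimisers other than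
   the uniform one are determined up to exchange of the two states. *)
Lemma two_state_one_zero b (v1 v2 : R) : z <= 4 -> 2^-1 < v1 -> v1 < v2 -> v2 < 1 ->
  two_state_field b v1 = 0 -> two_state_field b v2 = 0 -> False.
Proof.
move=> z4 hv1 v12 v21 k1 k2; pose c := z - 1.
have c1 : 1 <= c by rewrite /c; have := z2; lra.
have c3 : c <= 3 by rewrite /c; lra.
have c0 : 0 < c by lra.
pose dk (v : R) := v^-1 + (1 - v)^-1 - b * (c * v `^ (c - 1) + c * (1 - v) `^ (c - 1)).
have refl (F dF : R -> R) (t : R) : (forall s : R, 0 < s -> is_derive s 1 F (dF s)) ->
    t < 1 -> is_derive t 1 (fun t : R => F (1 - t)) (- dF (1 - t)).
  move=> HF t1; have p : 0 < 1 + (-1) * t by lra.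
  have := is_derive_affine HF p.
  rewrite (_ : (fun t : R => F (1 + -1 * t)) = (fun t : R => F (1 - t))); last first.
    by apply/funext => u; congr F; ring.
  by rewrite (_ : 1 + -1 * t = 1 - t); [rewrite mulrN1|ring].
have dln (s : R) : 0 < s -> is_derive s 1 (@ln R) (s^-1) by exact: is_derive1_ln.
have dpow (e s : R) : 0 < s -> is_derive s 1 (fun s : R => s `^ e) (e * s `^ (e - 1)).
  exact: is_derive1_powR.
have dkP (v : R) : 0 < v -> v < 1 -> is_derive v 1 (two_state_field b) (dk v).
  move=> v0 v1'; rewrite /two_state_field -/c /dk.
  have a1 := dln v v0; have a2 := refl _ _ _ dln v1'.
  have a3 := dpow c v v0; have a4 := refl _ _ _ (dpow c) v1'.
  by apply: is_derive_eq; rewrite /GRing.scale /=; ring.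
(* With the zero at [1 / 2] there are three zeros, hence two zeros [u1 < u2] of the derivative.
   Multiplied by [v (1 - v)], the derivative vanishes where [b c Q = 1], so Rolle for [Q] yields a
   zero of [dQ] above [1 / 2]. *)
have k0 : two_state_field b 2^-1 = 0.
  rewrite /two_state_field (_ : 1 - 2^-1 = 2^-1); last by field.
  by rewrite !subrr mulr0 subr0.
have [t /andP[h1 h2]|u1 /andP[hu1 u1v]] := derive_Rolle hv1 (etrans k0 (esym k1)) (df := dk).
  by apply: dkP; lra.
have [t /andP[h1 h2]|u2 /andP[v1u2 u2v]] := derive_Rolle v12 (etrans k1 (esym k2)) (df := dk).
  by apply: dkP; lra.
pose Q (v : R) := v `^ c * (1 - v) + v * (1 - v) `^ c.
have toQ (u : R) : 2^-1 < u -> u < 1 -> dk u = 0 -> b * c * Q u = 1.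
  move=> u0 u1' /(congr1 (fun t => t * (u * (1 - u)))); rewrite mul0r /dk => D.
  have p1 : u `^ c = u * u `^ (c - 1) by rewrite mulr_powRB1//; lra.
  have p2 : (1 - u) `^ c = (1 - u) * (1 - u) `^ (c - 1) by rewrite mulr_powRB1//; lra.
  have un : u != 0 by apply: lt0r_neq0; lra.
  have un' : 1 - u != 0 by apply: lt0r_neq0; lra.
  have e1 : u^-1 * u = 1 by rewrite mulVf.
  have e2 : (1 - u)^-1 * (1 - u) = 1 by rewrite mulVf.
  have e3 : (u^-1 + (1 - u)^-1) * (u * (1 - u)) = 1.
    by rewrite mulrDl mulrA e1 mul1r mulrCA e2 mulr1 subrK.
  rewrite mulrBl e3 in D.
  by rewrite /Q p1 p2; move: D; lra.
have qu1 := toQ u1 hu1 ltac:(lra); have qu2 := toQ u2 ltac:(lra) ltac:(lra).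
move=> /qu2 {}qu2 /qu1 {}qu1.
have bc0 : b * c != 0 by apply/eqP => E; move: qu1; rewrite E mul0r => /eqP; rewrite eq_sym oner_eq0.
have QE : Q u1 = Q u2 by apply: (mulfI bc0); rewrite qu1 qu2.
have u12 : u1 < u2 by lra.
pose dQ (v : R) := c * v `^ (c - 1) * (1 - v) - v `^ c + (1 - v) `^ c -
  v * (c * (1 - v) `^ (c - 1)).
have [t /andP[h1 h2]|w /andP[hw w1]] := derive_Rolle u12 QE (df := dQ).
  have t0 : 0 < t by lra.
  have t1 : t < 1 by lra.
  rewrite /Q /dQ.
  have a3 := dpow c t t0; have a4 := refl _ _ _ (dpow c) t1.
  by apply: is_derive_eq; rewrite /GRing.scale /=; ring.
have w0 : 0 < 1 - w by lra.
(* By homogeneity, [dQ w] is [- (1 - w) ^ c] times the expression of [two_state_aux] at [rho]. *)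
pose rho := w / (1 - w).
have rho1 : 1 < rho by rewrite ltr_pdivlMr//; lra.
have wE : w = rho * (1 - w) by rewrite /rho divfK// gt_eqF.
have J := two_state_aux c1 c3 rho1.
have rho0 : 0 <= rho by lra.
rewrite /dQ.
have -> : w `^ (c - 1) = rho `^ (c - 1) * (1 - w) `^ (c - 1).
  by rewrite -(powRM _ rho0 (ltW w0)) -wE.
have -> : w `^ c = rho `^ c * ((1 - w) * (1 - w) `^ (c - 1)).
  by rewrite (mulr_powRB1 (ltW w0) c0) -(powRM _ rho0 (ltW w0)) -wE.
rewrite -(mulr_powRB1 (ltW w0) c0).
rewrite [X in _ - X * _]wE.
have P : 0 < (1 - w) * (1 - w) `^ (c - 1) by rewrite mulr_gt0 ?powR_gt0.
move: P J; set A := rho `^ c; set B := rho `^ (c - 1); set D := _ `^ (c - 1).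
move=> P J E.
have : ((1 - w) * D) * (A - 1 - c * B + c * rho) = 0 by move: E; lra.
by move/eqP; rewrite mulf_eq0 (gt_eqF P) (gt_eqF J).
Qed.

Definition two_state_energy b (v : R) : R :=
  v * ln v + (1 - v) * ln (1 - v) - b / z * (v `^ z + (1 - v) `^ z).

Lemma is_derive_two_state_energy b (v : R) : 0 < v -> v < 1 ->
  is_derive v 1 (two_state_energy b) (two_state_field b v).
Proof.
move=> v0 v1; pose h (s : R) := s * ln s - b / z * s `^ z.
pose k (s : R) := ln s + 1 - b * s `^ (z - 1).
have hP (s : R) : 0 < s -> is_derive s 1 h (k s).
  move=> s0; rewrite /h /k; have wd := is_derive1_powR z s0; have wl := is_derive1_ln s0.
  by apply: is_derive_eq; rewrite /GRing.scale /=; field; rewrite !gt_eqF.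
have p : 0 < 1 + (-1) * v by lra.
have H1 := is_derive_affine hP p; have H2 := hP v v0.
rewrite (_ : two_state_energy b = (fun s => h s + h (1 + -1 * s))); last first.
  by apply/funext => s; rewrite /two_state_energy /h (_ : 1 + -1 * s = 1 - s); ring.
apply: is_derive_eq.
rewrite /two_state_field /k (_ : 1 + -1 * v = 1 - v); last by ring.
ring.
Qed.

Lemma minimizer2 b (x : 'rV[R]_2) : 0 <= b -> minimizer z b x ->
  exists v, [/\ 2^-1 <= v, v < 1, two_state_field b v = 0,
    energy z x = v `^ z + (1 - v) `^ z & potts_free_energy b z x = two_state_energy b v].
Proof.
move=> b0 mx; have [sx _] := mx; have [x0 x1] := sx.
pose i0 : 'I_2 := ord0; pose i1 : 'I_2 := lift ord0 ord0.
have S (g : 'I_2 -> R) : \sum_i g i = g i0 + g i1 by rewrite !big_ord_recl big_ord0 addr0.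
have xx : x 0 i0 + x 0 i1 = 1 by rewrite -S.
have st i := minimizer_stationary i b0 mx.
have G0 : 0 < \sum_j expR (b * x 0 j `^ (z - 1)) by rewrite S addr_gt0// expR_gt0.
set G := \sum_j _ in st G0.
have pos i : 0 < x 0 i by rewrite st divr_gt0// expR_gt0.
have lnx i : ln (x 0 i) = b * x 0 i `^ (z - 1) - ln G.
  by rewrite {1}st ln_div ?posrE ?expR_gt0// expRK.
have core (i j : 'I_2) : x 0 i + x 0 j = 1 -> x 0 j <= x 0 i ->
    (forall g : 'I_2 -> R, \sum_i g i = g i + g j) ->
  exists v, [/\ 2^-1 <= v, v < 1, two_state_field b v = 0,
    energy z x = v `^ z + (1 - v) `^ z & potts_free_energy b z x = two_state_energy b v].
  move=> xij xle Sij; have xj : x 0 j = 1 - x 0 i by rewrite -xij addrC addKr.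
  exists (x 0 i); split.
  - have -> : 2^-1 = 1 / 2 :> R by rewrite mul1r.
    by rewrite ler_pdivrMr//; lra.
  - by have := pos j; rewrite xj subr_gt0.
  - by rewrite /two_state_field -xj !lnx; ring.
  - by rewrite /energy Sij xj.
  - by rewrite free_energyE /energy !Sij xj.
have [le|le] := lerP (x 0 i1) (x 0 i0); first exact: (core i0 i1).
apply: (core i1 i0); rewrite 1?addrC //; first exact: ltW.
by move=> g; rewrite S addrC.
Qed.

Lemma unique_energy2 b : 0 <= b -> z <= 4 -> unique_energy z 2 b.
Proof.
move=> b0 z4 x y mx my.
have [v [hv v1 kv -> Fx]] := minimizer2 b0 mx.
have [w [hw w1 kw -> Fy]] := minimizer2 b0 my.
have FE : two_state_energy b v = two_state_energy b w.
  rewrite -Fx -Fy; apply/eqP; rewrite eq_le (mx.2 _ my.1) (my.2 _ mx.1) //.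
have H (a c : R) : 2^-1 <= a -> a < 1 -> c < 1 -> two_state_field b a = 0 ->
    two_state_field b c = 0 -> two_state_energy b a = two_state_energy b c -> a < c -> False.
  move=> ha a1 c1 ka kc E ac.
  (* If [a = 1 / 2], the equal energies at [a] and [c] give by Rolle a further zero of the field
     between them, so there are again two zeros above [1 / 2]. *)
  move: ha; rewrite le_eqVlt => /predU1P[ha|ha]; last first.
    exact: (two_state_one_zero z4 ha ac c1 ka kc).
  have [t /andP[h1 h2]|u /andP[au uc] ku] := derive_Rolle ac E (df := two_state_field b).
    by apply: is_derive_two_state_energy; lra.
  by apply: (two_state_one_zero z4 _ uc c1 ku kc); rewrite ha.
have [vw|vw|->//] := ltgtP v w; first by case: (H v w).
by case: (H w v).
Qed.

End CriticalPoint.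

(** * The Gibbs property below the critical value *)

Section GibbsSide.
Variables (R : realType) (z beta : R).
Hypotheses (z2 : 2 < z) (beta0 : 0 < beta).
Variables (q s : nat) (f : 'I_q -> 'I_s).
Hypothesis fsurj : forall l, exists i, f i = l.

Lemma r_star_le l : admissible (class_size f l) z -> (r_star f z <= class_size f l)%N.
Proof.
rewrite /r_star; have : l \in index_enum 'I_s by rewrite mem_index_enum.
elim: (index_enum _) => // l' e IH; rewrite inE big_cons => /predU1P[-> ->|le adm].
  exact: geq_minl.
by case: ifP => _; [apply: leq_trans (geq_minr _ _) _|]; exact: IH.
Qed.

Lemma class_size_le l : (class_size f l <= q)%N.
Proof. by rewrite class_sizeE (leq_trans (max_card _)) ?card_ord. Qed.

Lemma r_star_attained : has_rstar f z ->
  exists2 l, admissible (class_size f l) z & class_size f l = r_star f z.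
Proof.
case=> l0 adm0; rewrite /r_star.
(* This excludes the default value [q.+1] of the minimum. *)
have : (\big[minn/q.+1]_(l < s | admissible (class_size f l) z) class_size f l <= q)%N.
  by apply: leq_trans (class_size_le l0); exact: r_star_le.
elim/big_ind: _ => [|a b Ha Hb|l adm _]; first by rewrite ltnn.
  by rewrite /minn; case: ifP => _; [exact: Ha|exact: Hb].
by exists l.
Qed.

Lemma gibbs_below_beta_c : has_rstar f z -> beta < beta_c (r_star f z) z ->
  fuzzy_gibbs f beta z.
Proof.
move=> hr bb; have z2' := ltW z2; apply: gibbs_of_unique_energy => // l nu /andP[nu0 nu1].
have b0 : 0 <= beta * nu `^ (z - 1) by rewrite mulr_ge0 ?powR_ge0// ltW.
have [l' adm' El'] := r_star_attained hr.
have [adm|nadm] := boolP (admissible (class_size f l) z).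
  apply: unique_energy_of_uniform; apply: unique_below_beta_c => //.
  apply: (@le_lt_trans _ _ beta).
    rewrite ler_piMr ?(ltW beta0)//.
    have c0 : 0 <= z - 1 by have := z2; lra.
    by have := powR_ge0_le c0 nu0 nu1; rewrite powR1.
  apply: (lt_le_trans bb); apply: beta_c_le => //; last exact: r_star_le.
  by rewrite -El'.
have r0 := class_size_gt0 fsurj l.
move: nadm; rewrite /admissible z2' /= negb_and negbK -ltnNge ltnS.
case/orP => [r1|/andP[/eqP -> z4]]; last exact: unique_energy2.
by have -> : class_size f l = 1%N; [apply/eqP; rewrite eqn_leq r1|exact: unique_energy1].
Qed.

End GibbsSide.

(** * Gaussian sums over a lattice *)

Section Lattice.
Variable R : realType.

Lemma expR_taylor2_le (H h : R) : `|h| <= H -> expR h <= 1 + h + expR H * h ^+ 2 / 2.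
Proof.
rewrite ler_norml => /andP[h1 h2].
pose g (t : R) := 1 + t + expR H * t ^+ 2 / 2 - expR t.
pose dg (t : R) := 1 + expR H * t - expR t.
have dP (t : R) : is_derive t 1 g (dg t).
  by rewrite /g /dg; apply: is_derive_eq; rewrite /GRing.scale /=; field.
have g0 : g 0 = 0 by rewrite /g expR0 expr2 !mulr0 mul0r; ring.
suff : 0 <= g h by rewrite /g; lra.
have [hneg|hpos|->] := ltgtP h 0; last by rewrite g0.
- have [c /andP[hc c0] E] := derive_MVT hneg (fun x _ => dP x).
  have : dg c <= 0.
    have := expR_ge1Dx c; have := expR_ge1Dx H.
    rewrite /dg => K1 K2; have : expR H * c <= 1 * c by rewrite ler_wnM2r//; lra.
    lra.
  move: E; rewrite g0 => E D.
  have : dg c * (0 - h) <= 0 by rewrite mulr_le0_ge0//; lra.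
  lra.
- have [c /andP[c0 ch] E] := derive_MVT hpos (fun x _ => dP x).
  have : 0 <= dg c.
    have K1 : expR c * (1 - c) <= 1.
      rewrite -[leRHS](expRxMexpNx_1 c) ler_wpM2l ?expR_ge0//.
      exact: expR_ge1Dx.
    have : expR c <= expR H by rewrite ler_expR; lra.
    rewrite /dg => K2; have : expR c * c <= expR H * c by rewrite ler_wpM2r//; lra.
    lra.
  move=> D; have : 0 <= dg c * (h - 0) by rewrite mulr_ge0//; lra.
  by rewrite -E g0 subr0.
Qed.

Lemma geometric_le (x : R) n : 0 <= x -> x < 1 -> \sum_(0 <= k < n) x ^+ k <= (1 - x)^-1.
Proof.
move=> x0 x1; have d : 0 < 1 - x by rewrite subr_gt0.
rewrite -(ler_pM2l d) mulfV ?gt_eqF//.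
elim: n => [|n IH]; first by rewrite big_geq// mulr0.
suff -> : (1 - x) * (\sum_(0 <= k < n.+1) x ^+ k) = 1 - x ^+ n.+1.
  by rewrite lerBlDr lerDl exprn_ge0.
elim: n {IH} => [|n IH]; first by rewrite big_nat1 expr0 expr1 mulr1.
by rewrite big_nat_recr //= mulrDr IH [in RHS]exprS; ring.
Qed.

(** [k ^ 2 >= k] reduces each half of the lattice to a geometric series, whose bound does not depend
    on [K]. *)
Lemma lattice_gauss_le (lam : R) K : 0 < lam ->
  \sum_(j < K + K.+1) expR (- (lam * (j%:R - K%:R) ^+ 2)) <= 2 / (1 - expR (- lam)).
Proof.
move=> lam0; set x := expR (- lam).
have x0 : 0 <= x by exact: expR_ge0.
have x1 : x < 1 by rewrite /x expR_lt1 oppr_lt0.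
have key (k : nat) (t : R) : t = k%:R \/ t = - k%:R -> expR (- (lam * t ^+ 2)) <= x ^+ k.
  move=> H; have -> : t ^+ 2 = k%:R ^+ 2 by case: H => ->; rewrite ?sqrrN.
  rewrite /x -expRM_natl ler_expR mulrN lerN2 mulrC ler_wpM2l ?(ltW lam0)//.
  by rewrite -natrX ler_nat; case: k {H} => // k; rewrite expnS expn1 leq_pmulr.
rewrite -(big_mkord xpredT (fun j => expR (- (lam * (j%:R - K%:R) ^+ 2)))).
rewrite (big_cat_nat (n := K)) ?leq_addr//= mulr2n mulrDl mul1r; apply: lerD.
- rewrite big_nat_rev /= add0n; apply: le_trans (geometric_le K.+1 x0 x1).
  rewrite [leRHS]big_nat_recl // ler_wpDl ?expr0//.
  apply: ler_sum_nat => i /andP[_ iK]; apply: key; right.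
  by rewrite natrB // addrAC subrr add0r.
- rewrite -{1}(add0n K) big_addn (addKn K); apply: le_trans (geometric_le K.+1 x0 x1).
  by apply: ler_sum_nat => i _; apply: key; left; rewrite natrD addrK.
Qed.

(** One lattice point suffices: for [u] within 1 of [t], [u t - u ^ 2 / 2 = t ^ 2 / 2 - (t - u) ^ 2
    / 2 >= t ^ 2 / 2 - 1 / 2]. *)
Lemma expR_sqr_le_lattice (kap t : R) K : 0 <= kap -> `|t| <= K%:R ->
  expR (kap * t ^+ 2 / 2) <= expR (kap / 2) *
    \sum_(j < K + K.+1) expR (kap * ((j%:R - K%:R) * t - (j%:R - K%:R) ^+ 2 / 2)).
Proof.
move=> kap0; rewrite ler_norml => /andP[t1 t2].
have tK : 0 <= t + K%:R by lra.
pose j0 := Num.truncn (t + K%:R).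
have /andP[l1 l2] := truncn_itv tK; rewrite -/j0 in l1 l2.
have j0K : (j0 < K + K.+1)%N.
  rewrite -(ltr_nat R) natrD -natr1; lra.
rewrite (bigD1 (Ordinal j0K)) //= mulrDr; apply: ler_wpDr.
  by rewrite mulr_ge0 ?expR_ge0// sumr_ge0// => i _; exact: expR_ge0.
rewrite -expRD ler_expR; rewrite -natr1 in l2; set u := j0%:R - K%:R.
have H1 : `|t - u| <= 1 by rewrite ler_norml /u; lra.
have : (t - u) ^+ 2 <= 1 by rewrite -(real_normK (num_real _)) expr_le1.
move=> H2; have := mulr_ge0 kap0 (ltac:(by rewrite subr_ge0) : 0 <= 1 - (t - u) ^+ 2).
by rewrite sqrrB; lra.
Qed.

End Lattice.

(** * Weights of the uniform and of the ordered phase up to constants *)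

Section PhaseWeights.
Local Open Scope classical_set_scope.
Local Open Scope ring_scope.
Variables (R : realType) (z beta : R).
Hypotheses (z2 : 2 <= z) (beta0 : 0 < beta).

Let z0 : 0 < z. Proof. exact: lt_le_trans z2. Qed.
Let c1 : 1 <= z - 1. Proof. by have := z2; lra. Qed.
Let c0 : 0 < z - 1. Proof. exact: lt_le_trans c1. Qed.

(** At [eps = 0] the last condition says that the spinodal point is not reached, and it persists for
    small [eps]. [kap] bounds the curvature of the interaction over the window; the exponential is
    the price of a second-order expansion of [expR] in [lattice_term_le]. *)
Lemma small_window (a bound : R) : 0 < a -> 0 < bound ->
  beta * (z - 1) * a `^ (z - 1) < 1 ->
  exists eps kap : R, [/\ 0 < eps, eps <= a / 2, eps <= bound,
    kap = beta * ((z - 1) * (a + eps) `^ (z - 2)) &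
    kap * (a + eps) * expR (2 * kap * eps) < 1].
Proof.
move=> a0 b0 s1; set sig := beta * _ * _ in s1.
(* Since [a + eps <= 2 a], [K] bounds [kap] and frees the exponent from its dependence on [eps]. *)
pose K := beta * ((z - 1) * (2 * a) `^ (z - 2)).
pose h (e : R) := beta * (z - 1) * `|a + e| `^ (z - 1) * expR (2 * K * e).
have ch : {for 0, continuous h}.
  apply: continuousM.
    apply: continuousM; first exact: cst_continuous.
    apply: (@continuous_comp _ _ _ (fun e : R => a + e) (fun v : R => `|v| `^ (z - 1))).
      by apply: continuousD; [exact: cst_continuous|exact: cvg_id].
    exact: powR_norm_continuous.
  apply: (@continuous_comp _ _ _ (fun e : R => 2 * K * e) expR); last exact: continuous_expR.
  by apply: continuousM; [exact: cst_continuous|exact: cvg_id].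
have h0 : h 0 < 1 by rewrite /h addr0 mulr0 expR0 mulr1 gtr0_norm.
have [d d0 Hd] : exists2 d, 0 < d & forall e, 0 <= e -> e < d -> h e < 1.
  have g0 : 0 < 1 - h 0 by rewrite subr_gt0.
  move/(cvgrPdist_lt _ _).1 : ch => /(_ _ g0) [/= d d0 Hd].
  exists d => // e e0 ed; have := Hd e; rewrite /ball_ /= sub0r normrN ger0_norm// => /(_ ed).
  by rewrite ltr_norml; lra.
pose eps := Num.min (d / 2) (Num.min (a / 2) bound).
have e0 : 0 < eps by rewrite !lt_min b0 !divr_gt0.
have e1 : eps <= a / 2 by rewrite /eps ge_min; apply/orP; right; rewrite ge_min lexx.
have e2 : eps <= bound by rewrite /eps ge_min; apply/orP; right; rewrite ge_min lexx orbT.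
have e3 : eps < d by apply: (@le_lt_trans _ _ (d / 2)); [rewrite /eps ge_min lexx|rewrite ltr_pdivrMr//; lra].
clearbody eps.
exists eps, (beta * ((z - 1) * (a + eps) `^ (z - 2))); split => //.
have ae0 : 0 < a + eps by exact: addr_gt0.
have := Hd eps (ltW e0) e3; rewrite /h (gtr0_norm ae0); apply: le_lt_trans.
have -> : beta * ((z - 1) * (a + eps) `^ (z - 2)) * (a + eps) =
    beta * (z - 1) * (a + eps) `^ (z - 1).
  by rewrite -(mulr_powRB1 (ltW ae0) c0) (_ : z - 1 - 1 = z - 2); ring.
rewrite ler_wpM2l ?mulr_ge0 ?powR_ge0 ?(ltW beta0) ?(ltW c0)// ler_expR.
rewrite ler_wpM2r ?(ltW e0)// ler_wpM2l// /K ler_wpM2l ?(ltW beta0)// ler_wpM2l ?(ltW c0)//.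
by apply: powR_ge0_le; [have := z2; lra|exact: ltW|lra].
Qed.

Definition inwin r (N : nat) (a eps : R) (m : 'I_r -> nat) : bool :=
  [forall i, `|(m i)%:R - N%:R * a| <= N%:R * eps].

Lemma phi_window_le (a eps kap s : R) N m : (0 < N)%N -> 0 < a -> 0 < eps -> eps <= a / 2 ->
  kap = beta * ((z - 1) * (a + eps) `^ (z - 2)) -> s ^+ 2 = N%:R -> 0 < s ->
  `|m%:R - N%:R * a| <= N%:R * eps ->
  phi z beta N m <= N%:R * beta / z * a `^ z + beta * a `^ (z - 1) * (m%:R - N%:R * a) +
    kap * ((m%:R - N%:R * a) / s) ^+ 2 / 2.
Proof.
move=> N0 a0 eps0 epsa kapE sN s0; rewrite ler_norml => /andP[h1 h2].
have N0' : 0 < N%:R :> R by rewrite ltr0n.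
set v : R := m%:R / N%:R.
have mE : m%:R = N%:R * v by rewrite /v mulrCA mulfV ?mulr1// gt_eqF.
have v1 : a - eps <= v by rewrite /v ler_pdivlMr//; lra.
have v2 : v <= a + eps by rewrite /v ler_pdivrMr//; lra.
have v0 : 0 < v by lra.
have hk : (z - 1) * (Num.max a v) `^ (z - 2) <= (z - 1) * (a + eps) `^ (z - 2).
  rewrite ler_wpM2l ?(ltW c0)//; apply: powR_ge0_le; first by have := z2; lra.
    by rewrite le_max ltW.
  by rewrite ge_max v2 andbT lerDl ltW.
have := powR_taylor2_le z2 a0 v0 hk.
move=> /(ler_wpM2l (ltW (mulr_gt0 N0' beta0))) T.
rewrite /phi -/v mulrAC -mulrA; apply: (le_trans T).
rewrite mE expr_div_n sN kapE -/v.
rewrite le_eqVlt; apply/orP; left; apply/eqP; field.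
by rewrite !gt_eqF.
Qed.

Definition theta K (j : nat) : R := j%:R - K%:R.

(** [expR_sqr_le_lattice] is applied to each state at [t = d i / s], and the product is distributed
    over the sums: each lattice point [tau] contributes a product weight in [m]. The linear terms
    involve only the sum of the [d i], which is at most [D]. *)
Lemma window_pointwise r (a eps kap D s : R) N n K (m : 'I_r -> nat) :
  (0 < N)%N -> 0 < a -> 0 < eps -> eps <= a / 2 ->
  kap = beta * ((z - 1) * (a + eps) `^ (z - 2)) -> s ^+ 2 = N%:R -> 0 < s -> s * eps <= K%:R ->
  `|n%:R - N%:R * (r%:R * a)| <= D -> (\sum_i m i = n)%N -> inwin N a eps m ->
  bweight z beta N m <=
  expR (N%:R * beta / z * (r%:R * a `^ z) + beta * a `^ (z - 1) * D) * expR (kap / 2) ^+ r *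
  \sum_(tau : {ffun 'I_r -> 'I_(K + K.+1)})
    (\prod_i expR (kap * (- theta K (tau i) * (N%:R * a) / s - theta K (tau i) ^+ 2 / 2))) *
    \prod_i expR (kap * theta K (tau i) / s) ^+ m i.
Proof.
move=> N0 a0 eps0 epsa kapE sN s0 sK nD Hm /forallP win.
have N0' : 0 < N%:R :> R by rewrite ltr0n.
have ae0 : 0 < a + eps by exact: addr_gt0.
have kap0 : 0 <= kap by rewrite kapE !mulr_ge0 ?powR_ge0 ?(ltW beta0) ?(ltW c0).
pose d i : R := (m i)%:R - N%:R * a.
have dsum : \sum_i d i <= D.
  rewrite /d sumrB -natr_sum Hm sumr_const card_ord -[X in _ - X]mulr_natl mulrCA.
  by apply: le_trans nD; exact: ler_norm.
have P i : expR (phi z beta N (m i)) <=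
    expR (N%:R * beta / z * a `^ z + beta * a `^ (z - 1) * d i) * expR (kap / 2) *
    \sum_(j < K + K.+1) expR (kap * (- theta K j * (N%:R * a) / s - theta K j ^+ 2 / 2)) *
      expR (kap * theta K j / s) ^+ m i.
  have := phi_window_le N0 a0 eps0 epsa kapE sN s0 (win i); rewrite -/(d i).
  rewrite -ler_expR [X in _ <= X -> _]expRD => T; apply: (le_trans T).
  rewrite -[leRHS]mulrA ler_wpM2l ?expR_ge0//.
  have tK : `|d i / s| <= K%:R.
    rewrite normrM normfV (gtr0_norm s0) ler_pdivrMr//; apply: (le_trans (win i)).
    by rewrite -sN expr2 -mulrA mulrC ler_wpM2r// ltW.
  apply: (le_trans (expR_sqr_le_lattice kap0 tK)).
  rewrite le_eqVlt; apply/orP; left; apply/eqP; congr (_ * _); apply: eq_bigr => j _.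
  rewrite -expRM_natl -expRD; congr expR; rewrite /theta /d; field; exact: lt0r_neq0.
rewrite /bweight; apply: (@le_trans _ _ (\prod_(i < r)
    (expR (N%:R * beta / z * a `^ z + beta * a `^ (z - 1) * d i) * expR (kap / 2) *
    \sum_(j < K + K.+1) expR (kap * (- theta K j * (N%:R * a) / s - theta K j ^+ 2 / 2)) *
      expR (kap * theta K j / s) ^+ m i))).
  by apply: ler_prod => i _; rewrite expR_ge0 P.
rewrite !big_split /= bigA_distr_bigA /= prodr_const card_ord; apply: ler_pM.
- by rewrite mulr_ge0 ?exprn_ge0 ?expR_ge0// prodr_ge0// => i _; exact: expR_ge0.
- by apply: sumr_ge0 => tau _; apply: prodr_ge0 => i _; rewrite mulr_ge0 ?exprn_ge0 ?expR_ge0.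
- rewrite ler_wpM2r ?exprn_ge0 ?expR_ge0// -expR_sum ler_expR big_split /= sumr_const card_ord.
  rewrite -mulr_sumr lerD//; last by rewrite ler_wpM2l// mulr_ge0 ?powR_ge0// ltW.
  by rewrite -[leLHS]mulr_natl mulrCA.
- by apply: ler_sum => tau _; rewrite big_split.
Qed.

(** Expanding each [expR] to second order, the linear terms cancel against the centring up to [H D].
    As [n / r <= N (a + eps)], the quadratic terms combine to the coefficient
    [- kap (1 - kap (a + eps) expR H) / 2], whose negativity is the condition of [small_window]. *)
Lemma lattice_term_le r (a eps kap D s H : R) N n K (tau : 'I_r -> nat) : (0 < r)%N ->
  0 < a -> 0 < eps -> 0 < kap -> 0 <= D -> s ^+ 2 = N%:R -> 0 < s ->
  (forall i, `|kap * theta K (tau i) / s| <= H) -> D <= N%:R * eps ->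
  `|n%:R - N%:R * (r%:R * a)| <= D ->
  (\prod_i expR (kap * (- theta K (tau i) * (N%:R * a) / s - theta K (tau i) ^+ 2 / 2))) *
    (\sum_i expR (kap * theta K (tau i) / s)) ^+ n <=
  r%:R ^+ n * expR (H * D) *
  \prod_i expR (- (kap * (1 - kap * (a + eps) * expR H) / 2 * theta K (tau i) ^+ 2)).
Proof.
move=> r0 a0 eps0 kap0 D0 sN s0 hH DN nD.
have q0 : 0 < r%:R :> R by rewrite ltr0n.
pose h i := kap * theta K (tau i) / s.
have S1 : \sum_i expR (h i) <=
    r%:R * expR (r%:R^-1 * (\sum_i h i + expR H / 2 * \sum_i h i ^+ 2)).
  apply: (@le_trans _ _ (\sum_i (1 + (h i + expR H / 2 * h i ^+ 2)))).
    apply: ler_sum => i _; have := expR_taylor2_le (hH i); rewrite -/(h i); lra.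
  rewrite big_split /= sumr_const card_ord big_split /= -mulr_sumr.
  set Y := _ + _; apply: le_trans (ler_wpM2l (ltW q0) (expR_ge1Dx _)).
  by rewrite mulrDr mulr1 mulrA mulfV ?gt_eqF// mul1r.
have S2 : (\sum_i expR (h i)) ^+ n <=
    r%:R ^+ n * expR (n%:R * (r%:R^-1 * (\sum_i h i + expR H / 2 * \sum_i h i ^+ 2))).
  rewrite expRM_natl -exprMn; apply: lerXn2r => //; rewrite nnegrE ?mulr_ge0 ?expR_ge0 ?(ltW q0)//.
  by apply: sumr_ge0 => i _; exact: expR_ge0.
rewrite -!expR_sum; apply: (le_trans (ler_wpM2l (expR_ge0 _) S2)).
rewrite [leLHS]mulrCA -[leRHS]mulrA ler_wpM2l ?exprn_ge0// -!expRD ler_expR.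
set A := n%:R / r%:R - N%:R * a.
have nr : n%:R / r%:R = N%:R * a + A by rewrite /A addrC subrK.
have AD : `|A| <= D / r%:R.
  have -> : A = (n%:R - N%:R * (r%:R * a)) / r%:R by rewrite /A; field; exact: lt0r_neq0.
  by rewrite normrM normfV (gtr0_norm q0) ler_wpM2r// invr_ge0 ltW.
have AH : A * (\sum_i h i) <= H * D.
  apply: le_trans (ler_norm _) _; rewrite normrM.
  have : `|\sum_i h i| <= r%:R * H.
    apply: le_trans (ler_norm_sum _ _ _) _.
    rewrite -[r in X in _ <= X * _]card_ord mulr_natl -sumr_const; apply: ler_sum => i _.
    exact: hH.
  move=> hs; have : `|A| * `|\sum_i h i| <= D / r%:R * (r%:R * H) by apply: ler_pM.
  by rewrite (_ : D / r%:R * (r%:R * H) = H * D) //; field; exact: lt0r_neq0.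
have nN : n%:R / r%:R <= N%:R * (a + eps).
  rewrite nr mulrDr lerD2l; apply: le_trans (ler_norm _) _; apply: (le_trans AD).
  apply: le_trans DN; rewrite ler_pdivrMr// ler_peMr// ler1n//.
have N0 : 0 < N%:R :> R by rewrite -sN exprn_gt0.
have Q : n%:R / r%:R * (expR H / 2 * \sum_i h i ^+ 2) <=
    (a + eps) * (expR H / 2 * (kap ^+ 2 * \sum_i theta K (tau i) ^+ 2)).
  have -> : \sum_i h i ^+ 2 = kap ^+ 2 * (\sum_i theta K (tau i) ^+ 2) / N%:R.
    rewrite mulr_sumr mulr_suml; apply: eq_bigr => i _.
    by rewrite /h expr_div_n exprMn sN.
  set T := kap ^+ 2 * _; have T0 : 0 <= T.
    by rewrite mulr_ge0 ?sqr_ge0// sumr_ge0// => i _; exact: sqr_ge0.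
  have E2 : 0 <= expR H / 2 * (T / N%:R).
    apply: mulr_ge0; first by rewrite divr_ge0 ?expR_ge0.
    by rewrite divr_ge0 ?(ltW N0).
  apply: (le_trans (ler_wpM2r E2 nN)).
  rewrite le_eqVlt; apply/orP; left; apply/eqP; field; exact: lt0r_neq0.
have C : \sum_i kap * (- theta K (tau i) * (N%:R * a) / s - theta K (tau i) ^+ 2 / 2) =
    - (N%:R * a) * (\sum_i h i) - kap / 2 * (\sum_i theta K (tau i) ^+ 2).
  rewrite !mulr_sumr -sumrB; apply: eq_bigr => i _; rewrite /h; field; exact: lt0r_neq0.
rewrite C sumrN -mulr_sumr mulrA nr.
rewrite nr in Q; move: AH Q; set T := \sum_i theta K (tau i) ^+ 2; set U := \sum_i h i.
set V := \sum_i h i ^+ 2; clear; lra.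
Qed.

(* Discretised Hubbard-Stratonovich transform: each Gaussian factor
   exp (kap d^2 / 2N) is dominated by a sum over a lattice of spacing 1/sqrt N of
   exponentials linear in d, which [spinsum] integrates exactly. *)
Lemma window_weight_le r (a eps kap D : R) : (0 < r)%N -> 0 < a -> 0 < eps -> eps <= a / 2 ->
  kap = beta * ((z - 1) * (a + eps) `^ (z - 2)) ->
  kap * (a + eps) * expR (2 * kap * eps) < 1 -> 0 <= D ->
  exists2 C : R, 0 < C & exists N0 : nat, forall N n, (N0 <= N)%N ->
    `|n%:R - N%:R * (r%:R * a)| <= D ->
    spinsum n (fun m => (inwin N a eps m)%:R * bweight z beta N m) (fun _ : 'I_r => 0%N) <=
    C * (r%:R ^+ n * expR (N%:R * beta / z * (r%:R * a `^ z))).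
Proof.
move=> r0 a0 eps0 epsa kapE kap1 D0.
have ae0 : 0 < a + eps by exact: addr_gt0.
have kap0 : 0 < kap by rewrite kapE !mulr_gt0 ?powR_gt0.
set H := 2 * kap * eps in kap1 *; set rho := 1 - kap * (a + eps) * expR H.
have rho0 : 0 < rho by rewrite /rho subr_gt0.
pose lam := kap * rho / 2; have lam0 : 0 < lam by rewrite divr_gt0// mulr_gt0.
pose S := 2 / (1 - expR (- lam)).
have S0 : 0 < S by rewrite divr_gt0// subr_gt0 expR_lt1 oppr_lt0.
exists (expR (beta * a `^ (z - 1) * D) * expR (kap / 2) ^+ r * (expR (H * D) * S ^+ r)).
  by rewrite !mulr_gt0 ?exprn_gt0 ?expR_gt0.
(* The thresholds give [D <= N eps] and [1 <= s eps]. The latter yields [K <= 2 s eps], whence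
   [|kap theta / s| <= 2 kap eps = H]. *)
exists (maxn 1 (maxn (Num.truncn (D / eps)).+1 (Num.truncn (eps ^- 2)).+1)) => N n.
rewrite !geq_max => /and3P[N0 N1 N2] nD.
have N0' : 0 < N%:R :> R by rewrite ltr0n.
have DN : D <= N%:R * eps.
  rewrite -ler_pdivrMr//; apply: ltW; apply: lt_le_trans (truncnS_gt _) _.
  by rewrite ler_nat.
pose s := Num.sqrt (N%:R : R).
have s0 : 0 < s by rewrite sqrtr_gt0.
have sN : s ^+ 2 = N%:R by rewrite sqr_sqrtr // ltW.
have se : 1 <= s * eps.
  rewrite -(@ler_pXn2r _ 2) ?nnegrE ?mulr_ge0 ?(ltW s0) ?(ltW eps0)// expr1n exprMn sN.
  rewrite -ler_pdivrMr ?exprn_gt0// mul1r; apply: ltW; apply: lt_le_trans (truncnS_gt _) _.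
  by rewrite ler_nat.
clearbody s.
pose K := (Num.truncn (s * eps)).+1.
have sK : s * eps <= K%:R by apply: ltW; exact: truncnS_gt.
have Ks : K%:R <= s * eps + 1.
  rewrite /K -natr1 lerD2r truncn_le; lra.
clearbody K.
pose coef (tau : {ffun 'I_r -> 'I_(K + K.+1)}) :=
  \prod_i expR (kap * (- theta K (tau i) * (N%:R * a) / s - theta K (tau i) ^+ 2 / 2)).
pose B := expR (N%:R * beta / z * (r%:R * a `^ z) + beta * a `^ (z - 1) * D) * expR (kap / 2) ^+ r.
have B0 : 0 <= B by rewrite mulr_ge0 ?exprn_ge0 ?expR_ge0.
apply: (@le_trans _ _ (spinsum n (fun m => B * \sum_(tau : {ffun 'I_r -> 'I_(K + K.+1)})
    coef tau * \prod_i expR (kap * theta K (tau i) / s) ^+ m i) (fun _ : 'I_r => 0%N))).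
  apply: spinsum_le => m; rewrite [X in (X + _)%N]big1// add0n => Hm.
  case: (boolP (inwin N a eps m)) => [win|_]; last first.
    rewrite mul0r mulr_ge0// sumr_ge0// => tau _; rewrite mulr_ge0 ?prodr_ge0// => i _;
    by rewrite ?exprn_ge0 ?expR_ge0.
  by rewrite mul1r; apply: window_pointwise nD Hm win.
rewrite spinsumZ spinsum_sum.
have T tau : spinsum n (fun m => coef tau * \prod_i expR (kap * theta K (tau i) / s) ^+ m i)
      (fun _ : 'I_r => 0%N) <=
    r%:R ^+ n * expR (H * D) * \prod_i expR (- (lam * theta K (tau i) ^+ 2)).
  rewrite spinsumZ spinsum_prod [X in _ * (_ * X)]big1 ?mulr1 => [|i _]; last by rewrite expr0.
  apply: (lattice_term_le r0 a0 eps0 kap0 D0 sN s0 _ DN nD) => i.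
  rewrite normrM normfV (gtr0_norm s0) ler_pdivrMr// normrM (gtr0_norm kap0) /H.
  have th : `|theta K (tau i)| <= K%:R.
    have jK : ((tau i) <= K + K)%N by rewrite -ltnS -addnS.
    have : (tau i)%:R <= K%:R + K%:R :> R by rewrite -natrD ler_nat.
    have : 0 <= (tau i)%:R :> R by [].
    by rewrite ler_norml /theta; lra.
  have : kap * `|theta K (tau i)| <= kap * (2 * (s * eps)).
    rewrite ler_wpM2l ?(ltW kap0)//; lra.
  lra.
have : B * (\sum_tau spinsum n (fun m => coef tau * \prod_i expR (kap * theta K (tau i) / s) ^+ m i)
      (fun _ : 'I_r => 0%N)) <= B * (r%:R ^+ n * expR (H * D) * S ^+ r).
  rewrite ler_wpM2l//; apply: (le_trans (ler_sum _ (fun tau _ => T tau))).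
  rewrite -mulr_sumr ler_wpM2l ?mulr_ge0 ?exprn_ge0 ?expR_ge0//.
  rewrite -(bigA_distr_bigA (fun (i : 'I_r) (j : 'I_(K + K.+1)) => expR (- (lam * theta K j ^+ 2)))).
  rewrite -[r in leRHS]card_ord -prodr_const; apply: ler_prod => i _.
  rewrite sumr_ge0 => [|j _]; last exact: expR_ge0.
  exact: lattice_gauss_le.
move=> HH; apply: (le_trans HH).
rewrite /B expRD le_eqVlt; apply/orP; left; apply/eqP; ring.
Qed.

(** Tangents of [phi] at the minimiser bound the weight from below by a multiple of the multinomial
    law of [x]. Under this law [m i0] has mean [n x i0], which exceeds [N (a + eps)] by a multiple
    of [N]; as [m i0 <= n], the first moment gives the outside of the window a positive
    probability. *)
Lemma ordered_weight_ge r (nu a eps D : R) (x : 'rV[R]_r) i0 : (0 < r)%N -> 0 < nu ->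
  0 < a -> 0 < eps -> 0 <= D -> minimizer z (beta * nu `^ (z - 1)) x -> a + eps < nu * x 0 i0 ->
  exists2 c : R, 0 < c & exists N0 : nat, forall N n, (N0 <= N)%N -> `|n%:R - N%:R * nu| <= D ->
    c * expR (- (N%:R * nu * potts_free_energy (beta * nu `^ (z - 1)) z x)) <=
    spinsum n (fun m => (~~ inwin N a eps m)%:R * bweight z beta N m) (fun _ : 'I_r => 0%N).
Proof.
move=> r0 nu0 a0 eps0 D0 mx gap; have [sx _] := mx; have [x0 x1] := sx.
set b := beta * nu `^ (z - 1) in mx *.
have b0 : 0 <= b by rewrite mulr_ge0 ?powR_ge0// ltW.
have st i := minimizer_stationary z2 i b0 mx.
have G0 : 0 < \sum_j expR (b * x 0 j `^ (z - 1)).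
  by apply: (sumr_gt0_ex (i := i0)) => [j|]; rewrite ?expR_ge0 ?expR_gt0.
set G := \sum_j _ in st G0.
(* Stationarity makes the factors coming from the tangents proportional to [x] itself. *)
have stG i : expR (b * x 0 i `^ (z - 1)) = G * x 0 i.
  by rewrite [in RHS]st mulrCA mulfV ?mulr1// gt_eqF.
have pos i : 0 < x 0 i by rewrite st divr_gt0// expR_gt0.
have lnx i : ln (x 0 i) = b * x 0 i `^ (z - 1) - ln G.
  by rewrite {1}st ln_div ?posrE ?expR_gt0// expRK.
clearbody G.
have FE : potts_free_energy b z x = b * (1 - z^-1) * energy z x - ln G.
  have lG : ln G = \sum_i ln G * x 0 i by rewrite -mulr_sumr x1 mulr1.
  rewrite [X in _ = _ - X]lG free_energyE /energy !mulr_sumr -!sumrB.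
  apply: eq_bigr => i _; rewrite lnx -(mulr_powRB1 (x0 i) z0); ring.
pose gam := (nu * x 0 i0 - a - eps) / (2 * nu).
have gam0 : 0 < gam by rewrite divr_gt0 ?mulr_gt0//; lra.
exists (gam * expR (- (D * `|ln G|))); first by rewrite mulr_gt0 ?expR_gt0.
pose e := nu * x 0 i0 - a - eps; have e0 : 0 < e by rewrite /e; lra.
exists (maxn (Num.truncn (2 * D / e)).+1 (Num.truncn (2 * D / nu)).+1) => N n.
rewrite geq_max => /andP[N1 N2] nD.
have N0' : 0 < N%:R :> R by rewrite ltr0n (leq_trans _ N1).
have N0 : (0 < N)%N by rewrite -(ltr0n R).
have N1' : 2 * D < N%:R * e.
  by rewrite -ltr_pdivrMr//; apply: lt_le_trans (truncnS_gt _) _; rewrite ler_nat.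
have N2' : 2 * D < N%:R * nu.
  by rewrite -ltr_pdivrMr//; apply: lt_le_trans (truncnS_gt _) _; rewrite ler_nat.
move: nD; rewrite ler_norml => /andP[nD1 nD2].
have n0 : 0 < n%:R :> R by lra.
pose y i := nu * x 0 i; have y0 i : 0 <= y i by rewrite mulr_ge0 ?(ltW nu0).
have yb i : beta * y i `^ (z - 1) = b * x 0 i `^ (z - 1).
  by rewrite /y powRM ?(ltW nu0)// /b mulrA.
pose E0 := expR (- (N%:R * nu * (b * (1 - z^-1) * energy z x))).
have W (m : 'I_r -> nat) : (\sum_i m i = n)%N ->
    E0 * G ^+ n * \prod_i x 0 i ^+ m i <= bweight z beta N m.
  move=> Hm; have -> : G ^+ n = \prod_i G ^+ m i by rewrite prodrXr Hm.
  rewrite -mulrA -big_split /=.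
  have -> : \prod_i (G ^+ m i * x 0 i ^+ m i) = expR (\sum_i (m i)%:R * (b * x 0 i `^ (z - 1))).
    rewrite expR_sum; apply: eq_bigr => i _.
    by rewrite expRM_natl stG exprMn.
  rewrite /E0 -expRD /bweight -expR_sum ler_expR.
  have -> : N%:R * nu * (b * (1 - z^-1) * energy z x) =
      \sum_i (b * x 0 i `^ (z - 1) * (N%:R * y i) - N%:R * beta / z * y i `^ z).
    rewrite /energy !mulr_sumr; apply: eq_bigr => i _.
    rewrite -(mulr_powRB1 (y0 i) z0) -(mulr_powRB1 (x0 i) z0).
    have -> : N%:R * beta / z * (y i * y i `^ (z - 1)) = N%:R / z * y i * (beta * y i `^ (z - 1)).
      by ring.
    rewrite yb /y; ring.
  rewrite -sumrN -big_split /=; apply: ler_sum => i _.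
  by have := phi_tangent z2 beta0 (m i) N0 (y0 i); rewrite yb; lra.
(* The indicator of the outside is at least [(m i0 - N (a + eps)) / n], which is nonpositive in the
   window and at most 1 everywhere. *)
have lower : spinsum n (fun m => E0 * G ^+ n / n%:R *
      (\prod_i x 0 i ^+ m i * (m i0)%:R) +
      (- (E0 * G ^+ n / n%:R * (N%:R * (a + eps)))) * (\prod_i x 0 i ^+ m i)) (fun _ : 'I_r => 0%N) <=
    spinsum n (fun m => (~~ inwin N a eps m)%:R * bweight z beta N m) (fun _ : 'I_r => 0%N).
  apply: spinsum_le => m; rewrite [X in (X + _)%N]big1// add0n => Hm.
  have P0 : 0 <= \prod_i x 0 i ^+ m i by apply: prodr_ge0 => i _; rewrite exprn_ge0.
  have EG : 0 <= E0 * G ^+ n by rewrite mulr_ge0 ?expR_ge0 ?exprn_ge0 ?(ltW G0).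
  have -> : E0 * G ^+ n / n%:R * (\prod_i x 0 i ^+ m i * (m i0)%:R) +
      (- (E0 * G ^+ n / n%:R * (N%:R * (a + eps)))) * (\prod_i x 0 i ^+ m i) =
      ((m i0)%:R - N%:R * (a + eps)) / n%:R * (E0 * G ^+ n * \prod_i x 0 i ^+ m i).
    by ring.
  have EGP := mulr_ge0 EG P0.
  case: (boolP (inwin N a eps m)) => [/forallP /(_ i0)|_]; rewrite ?mul0r ?mul1r.
    rewrite ler_norml => /andP[_ h]; rewrite mulr_le0_ge0// pmulr_lle0 ?invr_gt0//; lra.
  apply: le_trans (W m Hm); rewrite ler_piMl// ler_pdivrMr// mul1r.
  have : (m i0)%:R <= n%:R :> R by rewrite ler_nat -Hm (bigD1 i0) //= leq_addr.
  have : 0 <= N%:R * (a + eps) by rewrite mulr_ge0 ?(ltW N0')// addr_ge0 ?ltW.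
  lra.
apply: le_trans lower.
rewrite spinsum_lin spinsum_moment // spinsum_prod x1 expr1n.
have -> : \prod_i x 0 i ^+ 0 = 1 by apply: big1 => i _; rewrite expr0.
rewrite !mul1r mulr1 add0r.
have -> : E0 * G ^+ n / n%:R * (n%:R * x 0 i0) + - (E0 * G ^+ n / n%:R * (N%:R * (a + eps))) =
    (n%:R * x 0 i0 - N%:R * (a + eps)) / n%:R * (E0 * G ^+ n) by ring.
rewrite -[leLHS]mulrA; apply: ler_pM.
- exact: ltW.
- by rewrite mulr_ge0 ?expR_ge0.
- rewrite ler_pdivlMr//.
  have xi1 : x 0 i0 <= 1 := simplex_le1 i0 sx.
  have ge : gam * (2 * nu) = e by rewrite /gam divfK// gt_eqF// mulr_gt0.
  have xg : 0 <= x 0 i0 - gam.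
    rewrite -(pmulr_rge0 _ nu0); move: ge; rewrite /e; lra.
  have : (N%:R * nu - D) * (x 0 i0 - gam) <= n%:R * (x 0 i0 - gam) by rewrite ler_wpM2r//; lra.
  have : D * (x 0 i0 - gam) <= D * 1 by rewrite ler_wpM2l//; lra.
  have : N%:R * (gam * (2 * nu)) = N%:R * e by rewrite ge.
  move: N1'; rewrite /e; lra.
- rewrite /E0 -[G]lnK ?posrE// -expRM_natl lnK ?posrE// -!expRD ler_expR FE.
  have : - (D * `|ln G|) <= (n%:R - N%:R * nu) * ln G.
    rewrite lerNl; apply: le_trans (ler_norm _) _; rewrite normrN normrM ler_wpM2r//.
    by rewrite ler_norml nD1.
  lra.
Qed.

(** By convexity the excess over the tangent at [a] grows with the distance from [a] on either side,
    so its values at [a + eps] and [a - eps] bound it from below outside the window. *)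
Lemma powR_gap (a eps : R) : 1 < z - 1 -> 0 < a -> 0 < eps -> eps <= a -> exists2 del : R, 0 < del &
  forall v : R, 0 <= v -> eps <= `|v - a| ->
    a `^ (z - 1) + (z - 1) * a `^ (z - 2) * (v - a) + del <= v `^ (z - 1).
Proof.
move=> c1' a0 eps0 ea.
have e2 : z - 1 - 1 = z - 2 by ring.
pose g (v : R) := v `^ (z - 1) - a `^ (z - 1) - (z - 1) * a `^ (z - 2) * (v - a).
have g0 (v : R) : 0 <= v -> v <> a -> 0 < g v.
  move=> v0 va; have := powR_tangent_lt c1' (ltW a0) v0 va.
  rewrite e2 /g; lra.
have ga1 := g0 (a + eps) ltac:(lra) ltac:(lra).
have ga2 := g0 (a - eps) ltac:(lra) ltac:(lra).
exists (Num.min (g (a + eps)) (g (a - eps))); first by rewrite lt_min ga1.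
move=> v v0; have [va|va] := lerP a v.
  move=> ev; have : Num.min (g (a + eps)) (g (a - eps)) <= g (a + eps) by rewrite ge_min lexx.
  have := powR_tangent c1 (ltac:(lra) : 0 <= a + eps) v0; rewrite e2.
  have M : a `^ (z - 2) <= (a + eps) `^ (z - 2).
    by apply: powR_ge0_le; [have := z2; lra|exact: ltW|lra].
  have : (z - 1) * a `^ (z - 2) * (v - (a + eps)) <=
      (z - 1) * (a + eps) `^ (z - 2) * (v - (a + eps)).
    by rewrite ler_wpM2r ?ler_wpM2l ?(ltW c0)//; lra.
  rewrite /g; lra.
move=> ev; have : Num.min (g (a + eps)) (g (a - eps)) <= g (a - eps) by rewrite ge_min lexx orbT.
have := powR_tangent c1 (ltac:(lra) : 0 <= a - eps) v0; rewrite e2.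
have M : (a - eps) `^ (z - 2) <= a `^ (z - 2).
  by apply: powR_ge0_le; [have := z2; lra|lra|lra].
have : (z - 1) * (a - eps) `^ (z - 2) * (a - eps - v) <=
    (z - 1) * a `^ (z - 2) * (a - eps - v).
  by rewrite ler_wpM2r ?ler_wpM2l ?(ltW c0)//; lra.
rewrite /g; lra.
Qed.

(** [expR h >= 1 + h] and the tangent of [v ^ (z - 1)] at [a] bound every configuration from below
    by a quantity depending only on [n]; a state outside the window adds the gap [del]. *)
Lemma outside_growth_ge r (a eps del : R) N n (m : 'I_r -> nat) : (0 < N)%N -> 0 < a ->
  0 <= del ->
  (forall v, 0 <= v -> eps <= `|v - a| ->
    a `^ (z - 1) + (z - 1) * a `^ (z - 2) * (v - a) + del <= v `^ (z - 1)) ->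
  (\sum_i m i = n)%N ->
  expR (beta * a `^ (z - 1)) * (r%:R +
    beta * ((z - 1) * a `^ (z - 2) * (n%:R / N%:R - r%:R * a) + del * (~~ inwin N a eps m)%:R)) <=
  \sum_i expR (phi z beta N (m i).+1 - phi z beta N (m i)).
Proof.
move=> N0 a0 del0 Hdel Hm; have N0' : 0 < N%:R :> R by rewrite ltr0n.
pose v i : R := (m i)%:R / N%:R; have v0 i : 0 <= v i by rewrite divr_ge0.
pose T := (z - 1) * a `^ (z - 2).
apply: (@le_trans _ _ (\sum_i expR (beta * a `^ (z - 1)) *
    (1 + beta * (v i `^ (z - 1) - a `^ (z - 1))))); last first.
  apply: ler_sum => i _; apply: (@le_trans _ _ (expR (beta * v i `^ (z - 1)))).
    rewrite (_ : beta * v i `^ (z - 1) =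
      beta * a `^ (z - 1) + beta * (v i `^ (z - 1) - a `^ (z - 1))); last by ring.
    by rewrite expRD ler_wpM2l ?expR_ge0// expR_ge1Dx.
  by rewrite ler_expR; exact: phi_succ_ge.
rewrite -mulr_sumr ler_wpM2l ?expR_ge0// big_split /= sumr_const card_ord lerD2l.
rewrite -mulr_sumr ler_wpM2l ?(ltW beta0)//.
have low i : T * (v i - a) <= v i `^ (z - 1) - a `^ (z - 1).
  have := powR_tangent c1 (ltW a0) (v0 i).
  by rewrite (_ : z - 1 - 1 = z - 2) ?/T; [lra|ring].
have sv : \sum_i T * (v i - a) = T * (n%:R / N%:R - r%:R * a).
  rewrite -mulr_sumr sumrB /v -mulr_suml -natr_sum Hm sumr_const card_ord.
  by rewrite -[a *+ r]mulr_natl.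
rewrite -/T -sv; case: (boolP (inwin N a eps m)) => [_|/forallPn[i]] /=.
  by rewrite mulr0 addr0; apply: ler_sum.
rewrite -ltNge => win; rewrite mulr1.
have wi : eps <= `|v i - a|.
  have -> : v i - a = ((m i)%:R - N%:R * a) / N%:R by rewrite /v; field; exact: lt0r_neq0.
  by rewrite normrM normfV (gtr0_norm N0') ler_pdivlMr// mulrC ltW.
rewrite (bigD1 i) //= [leRHS](bigD1 i) //= addrAC; apply: lerD; last exact: ler_sum.
by have := Hdel _ (v0 i) wi; rewrite -/T; lra.
Qed.

End PhaseWeights.

(** * The jump of the growth at coexistence *)

Section GrowthJump.
Variables (R : realType) (z beta : R).
Hypotheses (z2 : 2 < z) (beta0 : 0 < beta).

Let z2' : 2 <= z. Proof. exact: ltW. Qed.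
Let z0 : 0 < z. Proof. exact: lt_trans z2. Qed.
Let c0 : 0 < z - 1. Proof. by have := z2; lra. Qed.

Lemma nonuniform_coord_gt r (x : 'rV[R]_r) : simplex x -> x <> unif R r ->
  exists i, r%:R^-1 < x 0 i.
Proof.
move=> sx xu; have r0 := simplex_gt0 sx; have [_ x1] := sx.
apply/not_existsP => H; apply: xu; apply/rowP => i; rewrite mxE.
have le j : 0 <= r%:R^-1 - x 0 j by rewrite subr_ge0 leNgt; apply/negP/H.
have : \sum_j (r%:R^-1 - x 0 j) == 0.
  rewrite sumrB x1 sumr_const card_ord -[_ *+ r]mulr_natl mulfV ?subrr// pnatr_eq0.
  by rewrite -lt0n.
rewrite psumr_eq0 // => /allP /(_ i (mem_index_enum _)) /=.
by rewrite subr_eq0 => /eqP.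
Qed.

Let uniform_weight r (nu b : R) : (0 < r)%N -> 0 < nu -> beta * nu `^ (z - 1) = b ->
  beta / z * (r%:R * (nu / r%:R) `^ z) =
  - nu * potts_free_energy b z (unif R r) - nu * ln r%:R.
Proof.
move=> r0 nu0 bE; have q0 : 0 < r%:R :> R by rewrite ltr0n.
rewrite free_energyE /energy (sum_unif r (fun v => v * ln v)) (sum_unif r (fun v => v `^ z)) lnV ?posrE //.
rewrite powRM ?invr_ge0 ?(ltW nu0) ?(ltW q0)// -(mulr_powRB1 (ltW nu0) z0) -bE.
by field; rewrite !gt_eqF.
Qed.

(** The growth is the mean of a one-step factor that is everywhere at least its uniform value up to
    [O(1 / N)], and larger by a constant outside the window. The tolerance 2 absorbs the rounding of
    [nu n] and the shift from [n] to [N = n + 1]. *)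
Lemma growth_jump r (nu : R) : admissible r z -> 0 < nu -> beta * nu `^ (z - 1) = beta_c r z ->
  exists2 gam : R, 0 < gam & exists N0 : nat, forall N n, (N0 <= N)%N ->
    `|n%:R - N%:R * nu| <= 2 ->
    r%:R * expR (beta * (nu / r%:R) `^ (z - 1)) + gam <= growth z beta r n N.
Proof.
move=> adm nu0 bE; have r0 : (0 < r)%N by case/and3P: adm => /ltnW.
have q0 : 0 < r%:R :> R by rewrite ltr0n.
pose a := nu / r%:R; have a0 : 0 < a by rewrite divr_gt0.
have ra : r%:R * a = nu by rewrite /a mulrC divfK ?gt_eqF.
have [_ [x [xu mx FE]]] := beta_c_attained z2' z2 adm.
have [sx _] := mx; have [i0 xi0] := nonuniform_coord_gt sx xu.
have gap : 0 < (nu * x 0 i0 - a) / 2.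
  by rewrite divr_gt0// subr_gt0 /a ltr_pM2l.
have spin : beta * (z - 1) * a `^ (z - 1) < 1.
  have := beta_c_lt_spinodal z2' z2 adm; rewrite /spinodal ltr_pdivlMr// -bE.
  have R0 : 0 < r%:R `^ (z - 1) :> R by rewrite powR_gt0.
  rewrite -ra powRM ?(ltW q0) ?(ltW a0)// => H; rewrite -(ltr_pM2r R0) mul1r.
  by apply: le_lt_trans H; rewrite le_eqVlt; apply/orP; left; apply/eqP; ring.
have [eps [kap [eps0 epsa epsb kapE kap1]]] := small_window z2' beta0 a0 gap spin.
have [C C0 [N1 win]] := window_weight_le z2' beta0 r0 a0 eps0 epsa kapE kap1 (ler0n R 2).
rewrite ra in win; rewrite -bE in mx FE.
have gap' : a + eps < nu * x 0 i0 by lra.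
have [c cpos [N2 out]] := ordered_weight_ge z2' beta0 r0 nu0 a0 eps0 (ler0n R 2) mx gap'.
rewrite FE in out.
have c1 : 1 < z - 1 by have := z2; lra.
have epsa' : eps <= a by lra.
have [del del0 Hdel] := powR_gap z2' c1 a0 eps0 epsa'.
set F := potts_free_energy _ _ _ in out.
(* [n] exceeds [N nu] by at most 2, so [r ^ n] costs at most [r ^ 2] over the power with exponent
   [N nu]. *)
pose C' := C * expR (2 * ln r%:R); have C'0 : 0 < C' by rewrite mulr_gt0 ?expR_gt0.
pose B := expR (beta * a `^ (z - 1)); have B0 : 0 < B by exact: expR_gt0.
pose T := (z - 1) * a `^ (z - 2); have T0 : 0 <= T by rewrite mulr_ge0 ?powR_ge0 ?ltW.
(* The share of the weight outside the window: both phases carry the same exponential, with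
   constants at most [C'] inside and at least [c] outside. *)
pose p := c / (c + C'); have p0 : 0 < p by rewrite divr_gt0 ?addr_gt0.
have cC : p * (c + C') = c by rewrite /p divfK// gt_eqF// addr_gt0.
(* Half of the gain [B beta del p]; the other half pays for the [O(1 / N)] error. *)
pose gam := B * beta * del * p / 2.
have gam0 : 0 < gam.
  apply: divr_gt0 => //; apply: mulr_gt0 => //; apply: mulr_gt0 => //.
  exact: mulr_gt0.
exists gam => //.
exists (maxn 1 (maxn N1 (maxn N2 (Num.truncn (2 * (B * beta * T) / gam)).+1))) => N n.
rewrite !geq_max => /and4P[N_gt0 NN1 NN2 NN3] nD.
have N0' : 0 < N%:R :> R by rewrite ltr0n.
have NT : 2 * (B * beta * T) <= N%:R * gam.
  rewrite -ler_pdivrMr//; apply: ltW; apply: lt_le_trans (truncnS_gt _) _.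
  by rewrite ler_nat.
have {}win := win N n NN1 nD; have {}out := out N n NN2 nD.
set Wi := spinsum _ _ _ in win; set Wo := spinsum _ _ _ in out.
have partE : part z beta r n N = Wi + Wo.
  rewrite -[Wi]mul1r -[Wo]mul1r -spinsum_lin /part; congr spinsum.
  by apply/funext => m; case: inwin; rewrite /= ?mul1r ?mul0r ?addr0 ?add0r.
move: (nD); rewrite ler_norml => /andP[nD1 nD2].
have WiC : Wi <= C' * expR (- (N%:R * nu * F)).
  have rn : r%:R ^+ n = expR (n%:R * ln r%:R) :> R by rewrite expRM_natl lnK ?posrE.
  have UW := uniform_weight r0 nu0 (erefl _); rewrite -/a -/F in UW.
  apply: (le_trans win); rewrite /C' -[leRHS]mulrA ler_pM2l// rn -!expRD ler_expR.
  rewrite -[N%:R * beta / z]mulrA -[N%:R * _ * _]mulrA UW.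
  have L0 : 0 <= ln r%:R :> R by rewrite ln_ge0// ler1n.
  have := ler_wpM2r L0 nD2; lra.
have pW : p * part z beta r n N <= Wo.
  rewrite partE; have X0 : 0 <= Wo by apply: le_trans out; rewrite mulr_ge0 ?expR_ge0 ?ltW.
  have : c * Wi <= C' * Wo.
    apply: (@le_trans _ _ (c * (C' * expR (- (N%:R * nu * F))))); first by rewrite ler_pM2l.
    by rewrite mulrCA ler_pM2l.
  move=> H; rewrite /p mulrAC ler_pdivrMr ?addr_gt0//; lra.
rewrite -/a -/B /growth ler_pdivlMr ?part_gt0//.
pose al := B * (r%:R - beta * T * (2 / N%:R)); pose ka := B * beta * del.
have H1 : al * part z beta r n N + ka * Wo <= part z beta r n.+1 N.
  rewrite {2}/part spinsumS -spinsum_lin; apply: spinsum_le => m.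
  rewrite [X in (X + _)%N]big1// add0n => Hm.
  under [leRHS]eq_bigr do rewrite bweight_addspin.
  rewrite -mulr_sumr.
  have := outside_growth_ge z2' beta0 N_gt0 a0 (ltW del0) Hdel Hm.
  rewrite ra -/B -/T => H.
  have : al + ka * (~~ inwin N a eps m)%:R <=
      \sum_i expR (phi z beta N (m i).+1 - phi z beta N (m i)).
    apply: le_trans H; rewrite /al /ka.
    have : - (2 / N%:R) <= n%:R / N%:R - nu.
      rewrite -mulNr ler_pdivrMr// mulrBl divfK ?gt_eqF//; lra.
    move=> /(ler_wpM2l (mulr_ge0 (ltW (mulr_gt0 B0 beta0)) T0)); lra.
  move=> /(ler_wpM2l (ltW (bweight_gt0 z beta N m))); apply: le_trans.
  by rewrite le_eqVlt; apply/orP; left; apply/eqP; ring.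
apply: le_trans H1; have P0 := part_gt0 z beta n N r0.
have ka0 : 0 <= ka by rewrite !mulr_ge0 ?ltW.
have := ler_wpM2l ka0 pW; have : B * beta * T * (2 / N%:R) <= gam.
  by rewrite mulrA ler_pdivrMr// mulrC [leRHS]mulrC.
move=> /(ler_wpM2r (ltW P0)); rewrite /al /ka /gam; lra.
Qed.

End GrowthJump.

(** * Discontinuity of the limiting conditional probability *)

Section NonGibbsSide.
Local Open Scope classical_set_scope.
Local Open Scope ring_scope.
Variables (R : realType) (z beta : R).
Hypotheses (z2 : 2 < z) (beta0 : 0 < beta).

Let z2' : 2 <= z. Proof. exact: ltW. Qed.
Let z0 : 0 < z. Proof. exact: lt_trans z2. Qed.
Let c0 : 0 < z - 1. Proof. by have := z2; lra. Qed.

Lemma growth_le_expR r n N : (0 < r)%N -> (n < N)%N ->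
  growth z beta r n N <= r%:R * expR beta.
Proof.
move=> r0 nN; have N0 : (0 < N)%N by apply: leq_ltn_trans nN.
have N0' : 0 < N%:R :> R by rewrite ltr0n.
rewrite /growth ler_pdivrMr ?part_gt0 // /part spinsumS -spinsumZ.
apply: spinsum_le => m; rewrite [X in (X + _)%N]big1// add0n => Hm.
under [leLHS]eq_bigr do rewrite bweight_addspin.
rewrite -mulr_sumr mulrC ler_wpM2r ?(ltW (bweight_gt0 _ _ _ _))//.
rewrite -[r in leRHS]card_ord mulr_natl -sumr_const; apply: ler_sum => i _; rewrite ler_expR.
apply: le_trans (phi_succ_le z2' beta0 _ N0) _; rewrite ler_piMr ?(ltW beta0)//.
have E1 : 1 `^ (z - 1) = 1 :> R by rewrite powR1.
rewrite -[leRHS]E1; apply: powR_ge0_le; rewrite ?divr_ge0 ?(ltW c0)//.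
rewrite ler_pdivrMr// mul1r ler_nat; apply: leq_trans nN; rewrite ltnS -Hm.
by rewrite (bigD1 i) //= leq_addr.
Qed.

Lemma expR_slope_uniform r b : (0 < r)%N -> uniform_unique_minimizer r b z ->
  expR (slope z r b) = r%:R * expR (b * r%:R^-1 `^ (z - 1)).
Proof.
move=> r0 U; have q0 : 0 < r%:R :> R by rewrite ltr0n.
have [sx Hx] := argminP z2' b r0.
have xu : argmin z r b = unif R r.
  apply: contrapT => xu; have := U _ sx xu; rewrite ltNge Hx //.
  exact: simplex_unif.
rewrite /slope xu /energy.
rewrite (sum_unif r (fun v => v * ln v)) (sum_unif r (fun v => v `^ z)) lnV ?posrE //.
rewrite -[X in _ = X * _]lnK ?posrE// -expRD; congr expR.
rewrite -(mulr_powRB1 _ z0) ?invr_ge0 ?ler0n//; field; exact: lt0r_neq0.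
Qed.

Section Conditional.
Variables (q s : nat) (f : 'I_q -> 'I_s).
Hypothesis fsurj : forall l, exists i, f i = l.

Let g n (eta : {ffun 'I_n -> 'I_s}) l := growth z beta (class_size f l) (cnt eta l) n.+1.

Let g_gt0 n (eta : {ffun 'I_n -> 'I_s}) l : 0 < g eta l.
Proof. by apply: growth_gt0; exact: class_size_gt0. Qed.

Let sum_g_gt0 n (eta : {ffun 'I_n -> 'I_s}) (k : 'I_s) : 0 < \sum_l g eta l.
Proof. by apply: (sumr_gt0_ex (i := k)) => // l; exact: ltW. Qed.

(** The odds [Q / (1 - Q)] divided by the growth of [k] are the inverse of the sum of the other
    growths, which does not decrease from [eta] to [eta']. The cross-multiplied form passes to
    limits without division. *)
Lemma Qcond_monotone n (eta eta' : {ffun 'I_n -> 'I_s}) k :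
  (forall l, l != k -> (cnt eta l <= cnt eta' l)%N) ->
  Qcond f beta z eta' 0 k * (1 - Qcond f beta z eta 0 k) * g eta k <=
  Qcond f beta z eta 0 k * (1 - Qcond f beta z eta' 0 k) * g eta' k.
Proof.
move=> H; rewrite !QcondE // -/(g eta k) -/(g eta' k).
rewrite -!/(g eta _) -!/(g eta' _).
have S := sum_g_gt0 eta k; have S' := sum_g_gt0 eta' k.
have L : \sum_(l | l != k) g eta l <= \sum_(l | l != k) g eta' l.
  by apply: ler_sum => l lk; apply: growth_le => //; [exact: class_size_gt0|exact: H].
have E : \sum_l g eta l = g eta k + \sum_(l | l != k) g eta l by rewrite (bigD1 k).
have E' : \sum_l g eta' l = g eta' k + \sum_(l | l != k) g eta' l by rewrite (bigD1 k).
have a0 := g_gt0 eta k; have a0' := g_gt0 eta' k.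
rewrite E E' in S S' *.
move: (g eta k) (g eta' k) (\sum_(l | l != k) g eta l) (\sum_(l | l != k) g eta' l)
  L S S' a0 a0' => A A' L L' LL S S' A0 A0'.
have -> : A' / (A' + L') * (1 - A / (A + L)) * A = A * A' / ((A + L) * (A' + L')) * L.
  by field; rewrite !gt_eqF.
have -> : A / (A + L) * (1 - A' / (A' + L')) * A' = A * A' / ((A + L) * (A' + L')) * L'.
  by field; rewrite !gt_eqF.
by rewrite ler_wpM2l// divr_ge0 ?mulr_ge0 ?ltW.
Qed.

(** Keeps limits away from 0 and, applied to a second class, away from 1. *)
Lemma Qcond_ge n (eta : {ffun 'I_n -> 'I_s}) k :
  (s%:R * (q%:R * expR beta))^-1 <= Qcond f beta z eta 0 k.
Proof.
have S := sum_g_gt0 eta k; rewrite QcondE // ler_pdivlMr //.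
have le1 : 1 <= g eta k.
  apply: le_trans (growth_ge_card z2' beta0 _ (class_size_gt0 fsurj k) _) => //.
  by rewrite ler1n class_size_gt0.
apply: le_trans le1; rewrite mulrC ler_pdivrMr ?mul1r; last first.
  have s0 : (0 < s)%N by apply: leq_ltn_trans (ltn_ord k).
  have q0 : (0 < q)%N.
    by have [i _] := fsurj k; apply: leq_ltn_trans (ltn_ord i).
  by rewrite !mulr_gt0 ?ltr0n ?expR_gt0.
rewrite -[s in leRHS]card_ord mulr_natl -sumr_const; apply: ler_sum => l _.
apply: le_trans (growth_le_expR (class_size_gt0 fsurj l) _) _.
  by rewrite ltnS cnt_le.
by rewrite ler_wpM2r ?expR_ge0// ler_nat class_size_le.
Qed.

Lemma Qcond_sum n (eta : {ffun 'I_n -> 'I_s}) (k l : 'I_s) : l != k ->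
  Qcond f beta z eta 0 k + Qcond f beta z eta 0 l <= 1.
Proof.
move=> lk; have S := sum_g_gt0 eta k; rewrite !QcondE // -mulrDl ler_pdivrMr // mul1r.
rewrite (bigD1 k) //= (bigD1 l) //= lerD2l lerDl sumr_ge0 // => i _; exact: (ltW (g_gt0 _ _)).
Qed.

End Conditional.

Definition two_block s (k l : 'I_s) (j n : nat) : {ffun 'I_n -> 'I_s} :=
  [ffun i : 'I_n => if (i < j)%N then k else l].

Lemma cnt_two_block s (k l : 'I_s) j n i : l != k -> (j <= n)%N ->
  cnt (two_block k l j n) i = if i == k then j else if i == l then (n - j)%N else 0%N.
Proof.
move=> lk jn; have J : (\sum_(x < n) (x < j) = j)%N.
  rewrite -[RHS]card_ord -sum1_card (big_ord_widen n (fun=> 1%N) jn) [RHS]big_mkcond.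
  by apply: eq_bigr => x _; case: ifP.
rewrite cntE; case: eqVneq => [->|ik].
  rewrite -[RHS]J; apply: eq_bigr => x _; rewrite ffunE; case: ifP; rewrite ?eqxx //.
  by rewrite (negbTE lk).
case: eqVneq => [->|il]; last first.
  by rewrite big1 // => x _; rewrite ffunE; case: ifP; rewrite eq_sym ?(negbTE ik) ?(negbTE il).
apply: (@addIn j); rewrite subnK // -[X in (_ + X)%N]J -big_split /=.
rewrite -[RHS]card_ord -sum1_card; apply: eq_bigr => x _; rewrite ffunE.
by case: ifP => _; rewrite ?eqxx // eq_sym (negbTE lk).
Qed.

Definition two_point s (k l : 'I_s) (nu : R) : 'rV[R]_s :=
  \row_i (if i == k then nu else if i == l then 1 - nu else 0).

Lemma two_point_simplex s (k l : 'I_s) nu : l != k -> 0 <= nu <= 1 ->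
  simplex (two_point k l nu).
Proof.
move=> lk /andP[nu0 nu1]; split=> [i|].
  by rewrite mxE; case: ifP => // _; case: ifP => // _; rewrite subr_ge0.
rewrite (bigD1 k) //= (bigD1 l) //= !mxE !eqxx (negbTE lk) big1 ?addr0 ?subrKC //.
by move=> i /andP[/negbTE ik /negbTE il]; rewrite mxE ik il.
Qed.

Lemma truncn_density (nu : R) : 0 <= nu ->
  (Num.truncn (nu * n%:R))%:R / n%:R @[n --> \oo] --> nu.
Proof.
move=> nu0; apply/cvgrPdist_le => e e0; near=> n.
have n0 : 0 < n%:R :> R by rewrite ltr0n; near: n; exact: nbhs_infty_gt.
have ne : 1 <= e * n%:R.
  rewrite mulrC -ler_pdivrMr //; near: n; exact: nbhs_infty_ger.
have /andP[t1 t2] := truncn_itv (mulr_ge0 nu0 (ltW n0)).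
rewrite -natr1 in t2; rewrite ger0_norm.
  by rewrite lerBlDr -lerBlDl ler_pdivlMr//; lra.
by rewrite subr_ge0 ler_pdivrMr.
Unshelve. all: end_near. Qed.

Lemma emp_two_block s (k l : 'I_s) nu (c : nat -> nat) : l != k ->
  (forall n, (c n <= n)%N) -> (c n)%:R / n%:R @[n --> \oo] --> nu ->
  emp R (two_block k l (c n) n) @[n --> \oo] --> two_point k l nu.
Proof.
move=> lk cn H; apply: cvg_rV => i; rewrite mxE.
have E n : emp R (two_block k l (c n) n) 0 i =
    (if i == k then c n else if i == l then (n - c n)%N else 0%N)%:R / n%:R.
  by rewrite empE cnt_two_block.
rewrite (_ : (fun n => _) = (fun n =>
  (if i == k then c n else if i == l then (n - c n)%N else 0%N)%:R / n%:R)); last exact/funext.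
case: ifP => // _; case: ifP => _.
  have : 1 - (c n)%:R / n%:R @[n --> \oo] --> 1 - nu by apply: cvgB => //; exact: cvg_cst.
  apply: cvg_trans; apply: near_eq_cvg; near=> n.
  rewrite natrB // mulrBl divff // pnatr_eq0 -lt0n.
  by near: n; exact: nbhs_infty_gt.
by rewrite (_ : (fun n => _) = (fun=> 0)); [exact: cvg_cst|apply/funext => n; rewrite mul0r].
Unshelve. all: end_near. Qed.

Lemma within_cvg (V : topologicalType) m (A : set 'rV[R]_m) (Q : 'rV[R]_m -> V) nu
    (u : nat -> 'rV[R]_m) : {within A, continuous Q} -> A nu -> (forall n, A (u n)) ->
  u n @[n --> \oo] --> nu -> Q (u n) @[n --> \oo] --> Q nu.
Proof.
move=> /subspace_continuousP Qc Anu Au H; apply: (@cvg_comp _ _ _ u Q _ _ _ _ (Qc nu Anu)).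
by move=> P /H; rewrite /nbhs /=; apply: filterS => n; apply.
Qed.

Lemma cvg_balance (u v w : nat -> R) (a b d : R) : u n @[n --> \oo] --> a ->
  v n @[n --> \oo] --> b -> w n @[n --> \oo] --> d ->
  u n * (1 - v n) * w n @[n --> \oo] --> a * (1 - b) * d.
Proof.
move=> ua vb wd; apply: cvgM => //; apply: cvgM => //.
by apply: cvgB => //; exact: cvg_cst.
Qed.

Lemma not_gibbs_above_beta_c q s (f : 'I_q -> 'I_s) : (forall l, exists i, f i = l) ->
  has_rstar f z -> (1 < s)%N -> beta_c (r_star f z) z <= beta -> ~ fuzzy_gibbs f beta z.
Proof.
move=> fsurj hr s1 bb [Qinf [Qc HQ]].
have [k adm rE] := r_star_attained hr.
have [l lk] : exists l : 'I_s, l != k.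
  have [->|nk] := eqVneq k (Ordinal (ltnW s1)); first by exists (Ordinal s1).
  by exists (Ordinal (ltnW s1)); rewrite eq_sym.
rewrite -rE in bb; set r := class_size f k in rE bb adm.
have r0 : (0 < r)%N by case/and3P: adm => /ltnW.
have q0 : 0 < r%:R :> R by rewrite ltr0n.
have [bc0 _] := beta_c_attained z2' z2 adm.
pose nuc := (beta_c r z / beta) `^ (z - 1)^-1.
have nuc0 : 0 < nuc by apply: powR_gt0; exact: divr_gt0.
have nuc1 : nuc <= 1.
  have E1 : 1 `^ (z - 1)^-1 = 1 :> R by rewrite powR1.
  rewrite -[leRHS]E1; apply: powR_ge0_le.
  - by rewrite invr_ge0 ltW.
  - by rewrite divr_ge0 ?ltW.
  - by rewrite ler_pdivrMr// mul1r.
have nucE : beta * nuc `^ (z - 1) = beta_c r z.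
  rewrite -powRrM mulVf ?gt_eqF// powRr1 ?divr_ge0 ?(ltW bc0) ?(ltW beta0)//.
  by rewrite mulrC divfK// gt_eqF.
have [gam gam0 [N0 jump]] := growth_jump z2 beta0 adm nuc0 nucE.
set G := r%:R * _ in jump.
have G0 : 0 < G by rewrite mulr_gt0 ?expR_gt0.
pose c (nu : R) n := Num.truncn (nu * n%:R).
have cn (nu : R) : 0 <= nu <= 1 -> forall n, (c nu n <= n)%N.
  move=> /andP[nu0 nu1] n; rewrite -(ler_nat R).
  apply: (@le_trans _ _ (nu * n%:R)); first by rewrite truncn_le mulr_ge0.
  by rewrite ler_piMl.
pose eta (nu : R) n := two_block k l (c nu n) n.
pose Y (nu : R) := Qinf (two_point k l nu) 0 k.
have Qlim (nu : R) i : 0 <= nu <= 1 ->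
    Qcond f beta z (eta nu n) 0 i @[n --> \oo] --> Qinf (two_point k l nu) 0 i.
  move=> nu01; apply: cvg_rV_coord; apply: HQ; first exact: two_point_simplex.
  apply: emp_two_block => //; first exact: cn.
  by apply: truncn_density; case/andP: nu01.
pose c1 : R := (s%:R * (q%:R * expR beta))^-1.
have c10 : 0 < c1.
  have [i _] := fsurj k; rewrite invr_gt0 !mulr_gt0 ?expR_gt0 ?ltr0n ?(ltnW s1)//.
  exact: leq_ltn_trans (ltn_ord i).
have Qge (nu : R) i : 0 <= nu <= 1 -> c1 <= Qinf (two_point k l nu) 0 i.
  move=> nu01; apply: (ler_cvg_to (cvg_cst c1) (Qlim nu i nu01)).
  by near=> n; exact: Qcond_ge.
have Yle (nu : R) : 0 <= nu <= 1 -> Y nu <= 1 - c1.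
  move=> nu01; have := Qge nu l nu01.
  have : Y nu + Qinf (two_point k l nu) 0 l <= 1.
    have L : Qcond f beta z (eta nu n) 0 k + Qcond f beta z (eta nu n) 0 l @[n --> \oo] -->
        Y nu + Qinf (two_point k l nu) 0 l by apply: cvgD; exact: Qlim.
    apply: (ler_cvg_to L (cvg_cst (1 : R))).
    by near=> n; exact: Qcond_sum.
  lra.
have nuc01 : 0 <= nuc <= 1 by rewrite ltW.
(* [Qcond_monotone] in the limit; at [nuc] the lower bound [G + gam] stands in for a limit of the
   growth. As [nu] increases to [nuc], continuity would give [Y nuc (1 - Y nuc) (G + gam) <= Y nuc
   (1 - Y nuc) G], absurd for [Y nuc] strictly between 0 and 1. *)
have key (nu : R) : 0 <= nu < nuc -> Y nu * (1 - Y nuc) * (G + gam) <= Y nuc * (1 - Y nu) * G.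
  move=> /andP[nu0 nuc']; have nu01 : 0 <= nu <= 1 by rewrite nu0 ltW// (lt_le_trans nuc').
  have b0 : beta * nu `^ (z - 1) < beta_c r z.
    by rewrite -nucE ltr_pM2l//; apply: powR_ge0_lt.
  have U := unique_below_beta_c z2' b0.
  have := growth_lim z2' beta0 r0 nu0 (unique_energy_of_uniform U)
    (cvg_density (cn nu nu01) (truncn_density nu0)).
  rewrite expR_slope_uniform // -mulrA -powRM ?invr_ge0 ?ler0n//.
  set G' := r%:R * _ => A'lim.
  have G'G : G' <= G.
    rewrite ler_pM2l// ler_expR ler_pM2l//; apply: powR_ge0_le; first exact: ltW.
      by rewrite divr_ge0// ltW.
    by rewrite ler_pM2r ?invr_gt0// ltW.
  have Yk := Qlim nuc k nuc01; have Yk' := Qlim nu k nu01.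
  apply: (@le_trans _ _ (Y nuc * (1 - Y nu) * G')); last first.
    rewrite ler_wpM2l// mulr_ge0 ?subr_ge0//.
      exact: le_trans (ltW c10) (Qge _ _ nuc01).
    by have := Yle _ nu01; lra.
  have L1 : Qcond f beta z (eta nu n) 0 k * (1 - Qcond f beta z (eta nuc n) 0 k) * (G + gam)
      @[n --> \oo] --> Y nu * (1 - Y nuc) * (G + gam).
    by apply: cvg_balance => //; exact: cvg_cst.
  have L2 : Qcond f beta z (eta nuc n) 0 k * (1 - Qcond f beta z (eta nu n) 0 k) *
      growth z beta r (c nu n) n.+1 @[n --> \oo] --> Y nuc * (1 - Y nu) * G'.
    exact: cvg_balance.
  apply: (ler_cvg_to L1 L2); near=> n.
  have n0 : (N0 <= n.+1)%N by rewrite ltnW// ltnS; near: n; exact: nbhs_infty_ge.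
  have nk : cnt (eta nuc n) k = c nuc n by rewrite cnt_two_block ?cn// eqxx.
  have nk' : cnt (eta nu n) k = c nu n by rewrite cnt_two_block ?cn// eqxx.
  (* [c nuc n] is within 1 of [nuc n], and [nuc <= 1] bounds the effect of replacing [n] by
     [n + 1]. *)
  have J : G + gam <= growth z beta r (c nuc n) n.+1.
    apply: jump => //; have /andP[t1 t2] := truncn_itv (mulr_ge0 (ltW nuc0) (ler0n R n)).
    rewrite -/(c nuc n) -natr1 in t1 t2 *; rewrite ler_norml; lra.
  apply: le_trans (_ : _ <= Qcond f beta z (eta nu n) 0 k * (1 - Qcond f beta z (eta nuc n) 0 k) *
    growth z beta r (c nuc n) n.+1) _.
    rewrite ler_wpM2l// mulr_ge0//.
      exact: le_trans (ltW c10) (Qcond_ge fsurj _ _).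
    have := Qcond_sum fsurj (eta nuc n) lk.
    have := Qcond_ge fsurj (eta nuc n) l; rewrite -/c1; lra.
  have := Qcond_monotone fsurj (eta := eta nuc n) (eta' := eta nu n) (k := k); rewrite nk nk'; apply.
  move=> i ik; rewrite !cnt_two_block ?cn// (negbTE ik); case: eqP => // _.
  rewrite leq_sub2l// le_truncn// ler_wpM2r// ltW//.
pose nus (j : nat) : R := nuc - nuc * harmonic j.
have nus_cvg : nus j @[j --> \oo] --> nuc.
  rewrite -[X in _ --> X]subr0 -[X in _ - X](mulr0 nuc).
  by apply: cvgB; [exact: cvg_cst|apply: cvgM; [exact: cvg_cst|exact: cvg_harmonic]].
have nus_lt j : 0 <= nus j < nuc.
  rewrite subr_ge0 ltrBlDr ltrDl mulr_gt0 ?harmonic_gt0// andbT ler_piMr ?(ltW nuc0)//.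
  by rewrite /harmonic /= invf_le1 ?ltr0n// ler1n.
have Ylim : Y (nus j) @[j --> \oo] --> Y nuc.
  apply: cvg_rV_coord; apply: (within_cvg Qc); first exact: two_point_simplex.
    move=> j; apply: two_point_simplex => //; have /andP[-> h] := nus_lt j.
    by rewrite ltW// (lt_le_trans h).
  apply: cvg_rV => i; rewrite mxE.
  under eq_fun do rewrite mxE.
  case: ifP => // _; case: ifP => // _; last exact: cvg_cst.
  by apply: cvgB => //; exact: cvg_cst.
have L1 : Y (nus j) * (1 - Y nuc) * (G + gam) @[j --> \oo] --> Y nuc * (1 - Y nuc) * (G + gam).
  by apply: cvg_balance => //; exact: cvg_cst.
have L2 : Y nuc * (1 - Y (nus j)) * G @[j --> \oo] --> Y nuc * (1 - Y nuc) * G.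
  by apply: cvg_balance => //; exact: cvg_cst.
have : Y nuc * (1 - Y nuc) * (G + gam) <= Y nuc * (1 - Y nuc) * G.
  by apply: (ler_cvg_to L1 L2); near=> j; exact: key.
have y0 : 0 < Y nuc by apply: lt_le_trans c10 (Qge _ _ nuc01).
have y1 : 0 < 1 - Y nuc by have := Yle _ nuc01; lra.
by rewrite ler_pM2l ?mulr_gt0//; lra.
Unshelve. all: end_near. Qed.

End NonGibbsSide.

(** * The Gibbs property along a collapsing scheme *)

Lemma gibbs_one_class (R : realType) (q s : nat) (f : 'I_q -> 'I_s) (z beta : R) :
  2 <= z -> 0 < beta -> (forall l, exists i, f i = l) -> s = 1%N -> fuzzy_gibbs f beta z.
Proof.
move=> z2 beta0 fsurj s1; exists (fun=> const_mx 1); split.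
  by move=> x; exact: cvg_cst.
move=> nu _ eta _; apply: cvg_rV => k; rewrite mxE.
rewrite (_ : (fun n => _) = (fun=> 1)); first exact: cvg_cst.
apply/funext => n; rewrite QcondE //; subst s.
by rewrite big_ord1 ord1 divff// gt_eqF// growth_gt0// class_size_gt0.
Qed.

Lemma collapsing_two_classes (q T : nat) (s : nat -> nat) (f : forall t, 'I_q -> 'I_(s t)) t :
  collapsing_scheme T f -> (t < T)%N -> (1 < s t)%N.
Proof.
move=> [_ _ _ _ strict] tT; have [i [j [ne _]]] := strict t tT.
rewrite ltnNge; apply/negP => s1; apply: ne; apply: val_inj => /=.
by have := leq_trans (ltn_ord (f t i)) s1; have := leq_trans (ltn_ord (f t j)) s1; case: (f t i : nat) (f t j : nat) => [|?] [|?].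
Qed.

Theorem theorem4p3 (R : realType) (q T : nat) (s : nat -> nat)
    (f : forall t, 'I_q -> 'I_(s t)) (z beta : R) :
  (2 <= q)%N -> 2 < z -> 0 < beta -> regular_scheme T f z ->
  ((forall t, (1 <= t <= T)%N -> fuzzy_gibbs (f t) beta z)
     <-> beta < beta_c (r_star (f 1%N) z) z) /\
  ((forall t, (1 <= t <= T.-1)%N -> ~ fuzzy_gibbs (f t) beta z)
     <-> beta_c (r_star (f T.-1) z) z <= beta) /\
  (beta_c (r_star (f 1%N) z) z <= beta < beta_c (r_star (f T.-1) z) z ->
     exists tG : nat, (2 <= tG <= T.-1)%N /\
       (forall t, (1 <= t <= tG.-1)%N -> ~ fuzzy_gibbs (f t) beta z) /\
       (forall t, (tG <= t <= T)%N -> fuzzy_gibbs (f t) beta z)).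
Proof.
move=> _ z2 beta0 [scheme T2 hr mono]; have z2' := ltW z2.
have [fsurj _ sT _ _] := scheme.
have T1 : (1 <= T.-1)%N by rewrite -ltnS prednK // ltnW.
have TT t : (1 <= t <= T)%N -> (1 <= t <= T.-1)%N \/ t = T.
  case/andP=> -> /=; rewrite leq_eqVlt => /predU1P[->|tT]; [by right|left].
  by rewrite -ltnS prednK // (leq_trans _ tT).
have tT t : (1 <= t <= T.-1)%N -> (t < T)%N.
  by case/andP=> _; rewrite -ltnS prednK // (leq_trans _ T2).
have surj t : (1 <= t <= T.-1)%N -> forall l, exists i, f t i = l.
  by move=> /tT /ltnW; exact: fsurj.
(* The last partition has one class, so its conditional probability is 1 whatever [beta]. *)
have gibbsT : fuzzy_gibbs (f T) beta z by apply: gibbs_one_class => //; exact: fsurj.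
have gibbs t : (1 <= t <= T.-1)%N -> beta < beta_c (r_star (f t) z) z ->
    fuzzy_gibbs (f t) beta z.
  by move=> Ht; apply: gibbs_below_beta_c => //; [exact: surj|exact: hr].
have nongibbs t : (1 <= t <= T.-1)%N -> beta_c (r_star (f t) z) z <= beta ->
    ~ fuzzy_gibbs (f t) beta z.
  move=> Ht; apply: not_gibbs_above_beta_c => //; [exact: surj|exact: hr|].
  exact: collapsing_two_classes scheme (tT t Ht).
have le_beta_c t1 t2 : (1 <= t1)%N -> (t1 <= t2)%N -> (t2 <= T.-1)%N ->
    beta_c (r_star (f t1) z) z <= beta_c (r_star (f t2) z) z.
  move=> h1 h12 h2; have h1' : (1 <= t1 <= T.-1)%N by rewrite h1 (leq_trans h12).
  apply: beta_c_le => //; last exact: mono.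
  by have [l adm <-] := r_star_attained (hr t1 h1').
have one : (1 <= 1 <= T.-1)%N by [].
have last : (1 <= T.-1 <= T.-1)%N by rewrite T1 leqnn.
split; [split=> [H|H t Ht]|split; [split=> [H|H t Ht]|]].
- rewrite ltNge; apply/negP => /(nongibbs _ one); apply; apply: H.
  by rewrite leqnn ltnW.
- have [Ht'|->//] := TT t Ht; apply: gibbs => //; apply: (lt_le_trans H).
  by case/andP: Ht' => t1 tl; exact: le_beta_c.
- by rewrite leNgt; apply/negP => /(gibbs _ last); exact: H last.
- apply: nongibbs => //; apply: le_trans H.
  by case/andP: Ht => t1 tl; exact: le_beta_c.
(* The transition time is the least [t] whose critical value exceeds [beta]; from then on the
   critical values stay above [beta] by [le_beta_c]. *)
- case/andP=> b1 bT; pose P t := (1 <= t <= T.-1)%N && (beta < beta_c (r_star (f t) z) z).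
  have exP : exists t, P t by exists T.-1; rewrite /P last.
  case: (ex_minnP exP) => tG /andP[/andP[tG1 tGT] btG] tGmin; exists tG; split; [|split].
  + rewrite tGT andbT ltn_neqAle tG1 andbT; apply/eqP => E.
    by move: btG; rewrite -E ltNge b1.
  + move=> t /andP[t1 tt]; have tG' : (t < tG)%N by rewrite -(prednK tG1) ltnS.
    have Ht : (1 <= t <= T.-1)%N by rewrite t1 (leq_trans (ltnW tG')).
    apply: nongibbs => //; rewrite leNgt; apply/negP => bt.
    by have := tGmin t; rewrite /P Ht bt => /(_ isT); rewrite leqNgt tG'.
  + move=> t /andP[tGt tleT]; have [Ht|->//] := TT t ltac:(by rewrite (leq_trans tG1 tGt)).
    apply: gibbs => //; apply: (lt_le_trans btG).
    by case/andP: Ht => _ tl; exact: le_beta_c.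
Qed.
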